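(* Let $\mathbf{S}^{\mathrm{emb}}_{\mathrm{grp}}(1)$ be the category of all simplicial groups with order-unit with normalized positive group embeddings, and let $\mathbf{AF}$ be the category of all AF C*-algebras with C*-homomorphisms. Then there is no functor $\Gamma\colon\mathbf{S}^{\mathrm{emb}}_{\mathrm{grp}}(1)\to\mathbf{AF}$ such that $\mathrm{K}_0\circ\Gamma\cong\mathrm{id}$ (that is, such that $\mathrm{K}_0\circ\Gamma$ is naturally isomorphic, as a functor to preordered abelian groups, to the functor $(G,u)\mapsto G$, $f\mapsto f$).
   Context: A simplicial group is a partially ordered abelian group isomorphic to $\mathbb{Z}^n$ with componentwise order, for some natural number $n$. An order-unit of a simplicial group $G$ is an element $u\in G^+$ such that each $x\in G$ satisfies $x\leq nu$ for some positive integer $n$. A normalized positive group embedding $(G,u)\to(H,w)$ is a one-to-one group homomorphism $f\colon G\to H$ with $f(G^+)\subseteq H^+$ and $f(u)=w$. A C*-algebra is AF (approximately finite) if it is a (possibly uncountable) C*-direct limit of finite-dimensional C*-algebras; AF algebras are not assumed separable. For an AF C*-algebra $A$, $\mathrm{K}_0(A)$ is the Grothendieck group of $\mathrm{V}(A)$, preordered with positive cone the image of $\mathrm{V}(A)$, where $\mathrm{V}(A)$ is the commutative monoid of Murray-von Neumann equivalence classes of idempotents of $\mathrm{M}_\infty(A)=\bigcup_n\mathrm{M}_n(A)$ ($a\sim b$ if $a=xy$, $b=yx$ for some $x,y\in\mathrm{M}_\infty(A)$), with addition determined by $[a]+[b]=[a+b]$ if $ab=ba=0$. C*-homomorphisms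 induce homomorphisms of $\mathrm{V}$ and $\mathrm{K}_0$ in the usual way. *)

(* Defs.v *)
From HB Require Import structures.
From mathcomp Require Import all_boot all_order all_algebra.
From mathcomp Require Import complex.
From mathcomp Require Import all_classical all_reals all_analysis.
Import Order.TTheory GRing.Theory Num.Theory numFieldNormedType.Exports.

Set Implicit Arguments.
Unset Strict Implicit.
Unset Printing Implicit Defensive.

Local Open Scope classical_set_scope.
Local Open Scope quotient_scope.
Local Open Scope complex_scope.
Local Open Scope ring_scope.

Record category := Category {
  ob :> Type;
  hom : ob -> ob -> Type;
  idm : forall x, hom x x;
  comp : forall x y z, hom y z -> hom x y -> hom x z;
  compIm : forall x y (f : hom x y), comp (idm y) f = f;
  compmI : forall x y (f : hom x y), comp f (idm x) = f;
  compA : forall x y z t (h : hom z t) (g : hom y z) (f : hom x y),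
    comp h (comp g f) = comp (comp h g) f }.
Arguments hom {c}.
Arguments idm {c}.
Arguments comp {c x y z}.

Record functor (C D : category) := Functor {
  fob :> C -> D;
  fhom : forall x y : C, hom x y -> hom (fob x) (fob y);
  fhom_id : forall x : C, fhom (idm x) = idm (fob x);
  fhom_comp : forall (x y z : C) (g : hom y z) (f : hom x y),
    fhom (comp g f) = comp (fhom g) (fhom f) }.
Arguments fhom {C D} _ {x y}.

Section FunctorComp.
Variables (C D E : category) (G : functor D E) (F : functor C D).

Lemma functor_comp_id x : fhom G (fhom F (idm x)) = idm (G (F x)).
Proof. by rewrite !fhom_id. Qed.

Lemma functor_comp_comp (x y z : C) (g : hom y z) (f : hom x y) :
  fhom G (fhom F (comp g f)) =
  comp (fhom G (fhom F g)) (fhom G (fhom F f)).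
Proof. by rewrite !fhom_comp. Qed.

Definition functor_comp : functor C E :=
  @Functor C E (fun x => G (F x)) (fun x y f => fhom G (fhom F f))
    functor_comp_id functor_comp_comp.
End FunctorComp.

Definition is_iso (C : category) (x y : C) (f : hom x y) : Prop :=
  exists g : hom y x, comp g f = idm x /\ comp f g = idm y.

Definition naturally_isomorphic (C D : category) (F G : functor C D) : Prop :=
  exists eta : forall x : C, hom (F x) (G x),
    (forall x, is_iso (eta x)) /\
    (forall (x y : C) (f : hom x y),
        comp (eta y) (fhom F f) = comp (fhom G f) (eta x)).

Definition directed d (I : porderType d) : Prop :=
  (exists i : I, True) /\
  (forall i j : I, exists k, (i <= k)%O /\ (j <= k)%O).

Record poset_diagram (C : category) d (I : porderType d) := PosetDiagram {
  dob :> I -> C;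
  dhom : forall i j, (i <= j)%O -> hom (dob i) (dob j);
  dhom_id : forall i (le_ii : (i <= i)%O), dhom le_ii = idm (dob i);
  dhom_comp : forall i j k (le_ij : (i <= j)%O) (le_jk : (j <= k)%O)
      (le_ik : (i <= k)%O),
    dhom le_ik = comp (dhom le_jk) (dhom le_ij) }.
Arguments dhom {C d I} _ {i j}.

Definition is_cocone (C : category) d (I : porderType d)
    (D : poset_diagram C I) (A : C) (c : forall i, hom (D i) A) : Prop :=
  forall i j (le_ij : (i <= j)%O), comp (c j) (dhom D le_ij) = c i.

Definition is_colimit (C : category) d (I : porderType d)
    (D : poset_diagram C I) (A : C) (c : forall i, hom (D i) A) : Prop :=
  is_cocone c /\
  (forall (B : C) (b : forall i, hom (D i) B), is_cocone b ->
     exists! h : hom A B, forall i, comp h (c i) = b i).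

(* A C*-algebra need not have a unit, so the multiplication cannot come from
   the ring structures of MathComp.  The norm takes its values in R[i], as
   always for normed modules over R[i]. *)
HB.mixin Record CompleteNormedModule_isCStarAlgebra (R : realType) A
    of CompleteNormedModule R[i] A := {
  cmul : A -> A -> A;
  cstar : A -> A;
  cmulA : associative cmul;
  cmulDl : left_distributive cmul +%R;
  cmulDr : right_distributive cmul +%R;
  cmulZl : forall (k : R[i]) (a b : A), cmul (k *: a) b = k *: cmul a b;
  cmulZr : forall (k : R[i]) (a b : A), cmul a (k *: b) = k *: cmul a b;
  cstarK : involutive cstar;
  cstarD : {morph cstar : a b / a + b};
  cstarZ : forall (k : R[i]) (a : A), cstar (k *: a) = k^* *: cstar a;
  cstarM : forall a b, cstar (cmul a b) = cmul (cstar b) (cstar a);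
  cnormM : forall a b : A, `|cmul a b| <= `|a| * `|b|;
  cnorm_star : forall a : A, `|cmul (cstar a) a| = `|a| ^+ 2 }.

#[short(type="cstarAlgType")]
HB.structure Definition CStarAlgebra (R : realType) :=
  { A of CompleteNormedModule_isCStarAlgebra R A & CompleteNormedModule R[i] A }.

Section CStarCategory.
Variable R : realType.

Record cstar_hom (A B : cstarAlgType R) := CStarHom {
  chom :> A -> B;
  chom_linear : linear chom;
  chomM : {morph chom : a b / cmul a b};
  chom_star : {morph chom : a / cstar a} }.

Lemma cstar_hom_ext (A B : cstarAlgType R) (f g : cstar_hom A B) :
  f =1 g -> f = g.
Proof.
case: f g => f f1 f2 f3 [g g1 g2 g3] /= /funext fg.
by case: g / fg g1 g2 g3 => *; congr CStarHom; exact: Prop_irrelevance.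
Qed.

Definition cstar_id (A : cstarAlgType R) : cstar_hom A A.
Proof. by exists id. Defined.

Definition cstar_comp (A B C : cstarAlgType R)
  (g : cstar_hom B C) (f : cstar_hom A B) : cstar_hom A C.
Proof.
exists (g \o f).
- by move=> k a b /=; rewrite !chom_linear.
- by move=> a b /=; rewrite !chomM.
- by move=> a /=; rewrite !chom_star.
Defined.

Definition CStar : category.
Proof.
by apply: (@Category (cstarAlgType R) cstar_hom cstar_id cstar_comp) => *;
  exact: cstar_hom_ext.
Defined.

Definition finite_dimensional (A : cstarAlgType R) : Prop :=
  exists (n : nat) (f : {linear A -> 'rV[R[i]]_n}), bijective f.

(* No cardinality bound is put on I: AF algebras need not be separable. *)
Definition is_AF (A : cstarAlgType R) : Prop :=
  exists (d : Order.disp_t) (I : porderType d) (D : poset_diagram CStar I)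
      (c : forall i, hom (D i) (A : CStar)),
    [/\ directed I, forall i, finite_dimensional (D i) & is_colimit c].

Record AF_algebra := AFAlgebra {
  AF_carrier :> cstarAlgType R;
  AF_is_AF : is_AF AF_carrier }.

Definition AF : category.
Proof.
apply: (@Category AF_algebra (fun A B => cstar_hom A B)
  (fun A => cstar_id A) (fun A B C g f => cstar_comp g f)) => *;
  exact: cstar_hom_ext.
Defined.
End CStarCategory.

Section Minf.
Variables (R : realType).
Implicit Types A B : cstarAlgType R.

(* The union of the M_n(A), a matrix being padded with zeros. *)
Definition Minf A : set (nat -> nat -> A) :=
  [set x | exists n, forall i j, (n <= maxn i j)%N -> x i j = 0].

(* The sums are finite when x or y belongs to Minf. *)
Definition mmul A (x y : nat -> nat -> A) : nat -> nat -> A :=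
  fun i j => \sum_(k \in [set: nat]) cmul (x i k) (y k j).

Definition mmap A B (f : A -> B) (x : nat -> nat -> A) : nat -> nat -> B :=
  fun i j => f (x i j).

Lemma cmul0l A (a : A) : cmul 0 a = 0.
Proof. by have := cmulZl 0 0 a; rewrite !scale0r. Qed.

Lemma cmul0r A (a : A) : cmul a 0 = 0.
Proof. by have := cmulZr 0 a 0; rewrite !scale0r. Qed.

Lemma cmul_suml A n (F : 'I_n -> A) a :
  cmul (\sum_i F i) a = \sum_i cmul (F i) a.
Proof.
apply: (big_morph (fun x => cmul x a)) => [x y|]; first exact: cmulDl.
exact: cmul0l.
Qed.

Lemma cmul_sumr A n (F : 'I_n -> A) a :
  cmul a (\sum_i F i) = \sum_i cmul a (F i).
Proof.
apply: (big_morph (cmul a)) => [x y|]; first exact: cmulDr.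
exact: cmul0r.
Qed.

Lemma chom0 A B (f : cstar_hom A B) : f 0 = 0.
Proof. by have := chom_linear f (-1) 0 0; rewrite scaler0 add0r scaleN1r addNr. Qed.

Lemma chomD A B (f : cstar_hom A B) : {morph f : x y / x + y}.
Proof. by move=> x y; rewrite -{1}[x]scale1r chom_linear scale1r. Qed.

Lemma chom_sum A B (f : cstar_hom A B) n (F : 'I_n -> A) :
  f (\sum_i F i) = \sum_i f (F i).
Proof. exact: (big_morph f (chomD f) (chom0 f)). Qed.

Lemma Minf_bound A (x y : nat -> nat -> A) : Minf x -> Minf y ->
  exists n, forall i j, (n <= maxn i j)%N -> x i j = 0 /\ y i j = 0.
Proof.
move=> [n xn] [m ym]; exists (maxn n m) => i j.
rewrite geq_max => /andP[nij mij].
by split; [exact: xn|exact: ym].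
Qed.

Lemma fsum_ord A n (F : nat -> A) : (forall k, (n <= k)%N -> F k = 0) ->
  \sum_(k \in [set: nat]) F k = \sum_(k < n) F k.
Proof.
move=> F0; rewrite (@fsbigE _ _ _ _ _ (iota 0 n)) ?iota_uniq//.
  rewrite -[X in iota _ X]subn0 -/(index_iota 0 n) big_mkord.
  by apply: eq_bigl => i; rewrite in_setT.
by move=> i _; rewrite mem_iota /= add0n -leqNgt => /F0.
Qed.

Lemma mmulE A (x y : nat -> nat -> A) n :
  (forall i j, (n <= j)%N -> x i j = 0) \/
  (forall i j, (n <= i)%N -> y i j = 0) ->
  forall i j, mmul x y i j = \sum_(k < n) cmul (x i k) (y k j).
Proof.
move=> xy i j; rewrite /mmul (@fsum_ord _ n) // => k nk.
by case: xy => [->//|->//]; rewrite ?cmul0l ?cmul0r.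
Qed.

Lemma Minf_row A (x : nat -> nat -> A) n :
  (forall i j, (n <= maxn i j)%N -> x i j = 0) ->
  forall i j, (n <= i)%N -> x i j = 0.
Proof. by move=> x0 i j ni; rewrite x0 // leq_max ni. Qed.

Lemma Minf_col A (x : nat -> nat -> A) n :
  (forall i j, (n <= maxn i j)%N -> x i j = 0) ->
  forall i j, (n <= j)%N -> x i j = 0.
Proof. by move=> x0 i j nj; rewrite x0 // leq_max nj orbT. Qed.

Lemma Minf0 A : Minf (0 : nat -> nat -> A).
Proof. by exists 0%N. Qed.

Lemma MinfD A (x y : nat -> nat -> A) : Minf x -> Minf y -> Minf (x + y).
Proof.
move=> xf yf; have [n n0] := Minf_bound xf yf.
by exists n => i j /n0[xij yij]; rewrite !fctE xij yij addr0.
Qed.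

Lemma Minf_mul A (x y : nat -> nat -> A) : Minf x -> Minf y -> Minf (mmul x y).
Proof.
move=> xf yf; have [n n0] := Minf_bound xf yf; exists n => i j.
rewrite leq_max /mmul => /orP[ni|nj]; apply: fsbig1 => k _.
  by rewrite (n0 i k _).1 ?cmul0l // leq_max ni.
by rewrite (n0 k j _).2 ?cmul0r // leq_max nj orbT.
Qed.

Lemma mmul0l A (x : nat -> nat -> A) : mmul 0 x = 0.
Proof.
by apply/funext => i; apply/funext => j; apply: fsbig1 => k _; rewrite cmul0l.
Qed.

Lemma mmul0r A (x : nat -> nat -> A) : mmul x 0 = 0.
Proof.
by apply/funext => i; apply/funext => j; apply: fsbig1 => k _; rewrite cmul0r.
Qed.

Lemma mmulA A (x y z : nat -> nat -> A) : Minf x -> Minf z ->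
  mmul x (mmul y z) = mmul (mmul x y) z.
Proof.
move=> xf zf; have [n n0] := Minf_bound xf zf.
have xn := Minf_col (fun i j h => (n0 i j h).1).
have zn := Minf_row (fun i j h => (n0 i j h).2).
apply/funext => i; apply/funext => j.
rewrite (mmulE (or_introl xn)) (mmulE (or_intror zn)).
under eq_bigr => k _ do rewrite (mmulE (or_intror zn)) cmul_sumr.
rewrite exchange_big /=; apply: eq_bigr => k _.
rewrite (mmulE (or_introl xn)) cmul_suml.
by apply: eq_bigr => l _; rewrite cmulA.
Qed.

Lemma mmulDl A (x y z : nat -> nat -> A) : Minf z ->
  mmul (x + y) z = mmul x z + mmul y z.
Proof.
move=> [n n0]; have zn := Minf_row n0.
apply/funext => i; apply/funext => j; rewrite !fctE !(mmulE (or_intror zn)).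
by rewrite -big_split; apply: eq_bigr => k _; exact: cmulDl.
Qed.

Lemma mmulDr A (x y z : nat -> nat -> A) : Minf x ->
  mmul x (y + z) = mmul x y + mmul x z.
Proof.
move=> [n n0]; have xn := Minf_col n0.
apply/funext => i; apply/funext => j; rewrite !fctE !(mmulE (or_introl xn)).
by rewrite -big_split; apply: eq_bigr => k _; exact: cmulDr.
Qed.

Lemma Minf_map A B (f : cstar_hom A B) (x : nat -> nat -> A) :
  Minf x -> Minf (mmap f x).
Proof. by move=> [n n0]; exists n => i j /n0; rewrite /mmap => ->; exact: chom0. Qed.

Lemma mmap_mul A B (f : cstar_hom A B) (x y : nat -> nat -> A) :
  Minf x -> mmap f (mmul x y) = mmul (mmap f x) (mmap f y).
Proof.
move=> [n n0]; have xn := Minf_col n0.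
apply/funext => i; apply/funext => j; rewrite /mmap (mmulE (or_introl xn)).
rewrite chom_sum (@mmulE _ _ _ n); last by left=> ? ? /xn ->; exact: chom0.
by apply: eq_bigr => k _; exact: chomM.
Qed.

Record idempotent A := Idempotent {
  idem_mx :> nat -> nat -> A;
  idem_Minf : Minf idem_mx;
  idem_idem : mmul idem_mx idem_mx = idem_mx }.

HB.instance Definition _ A := gen_eqMixin (idempotent A).
HB.instance Definition _ A := gen_choiceMixin (idempotent A).

Lemma idem_ext A (a b : idempotent A) : idem_mx a = b -> a = b.
Proof.
case: a b => a a1 a2 [b b1 b2] /= ab; case: b / ab b1 b2 => *.
by congr Idempotent; exact: Prop_irrelevance.
Qed.

Definition mvn A (a b : idempotent A) : Prop :=
  exists x y : nat -> nat -> A,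
    [/\ Minf x, Minf y, idem_mx a = mmul x y & idem_mx b = mmul y x].

Definition mvnb A : rel (idempotent A) := fun a b => `[< mvn a b >].

Lemma mvn_refl A (a : idempotent A) : mvn a a.
Proof. by exists a, a; split; rewrite ?idem_idem//; exact: idem_Minf. Qed.

Lemma mvn_sym A (a b : idempotent A) : mvn a b -> mvn b a.
Proof. by move=> [x [y [xf yf ax bx]]]; exists y, x. Qed.

Lemma mvn_trans A (b a c : idempotent A) : mvn a b -> mvn b c -> mvn a c.
Proof.
move=> [x [y [xf yf ax bx]]] [z [t [zf tf bz cz]]].
exists (mmul x z), (mmul t y); split; try exact: Minf_mul.
  rewrite -mmulA//; last exact: Minf_mul.
  rewrite (mmulA _ zf yf) -bz bx -idem_idem {1}ax {1}ax.
  by rewrite !mmulA//; exact: Minf_mul.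
rewrite -mmulA//; last exact: Minf_mul.
rewrite (mmulA _ yf zf) -bx bz -idem_idem {1}cz {1}cz.
by rewrite !mmulA//; exact: Minf_mul.
Qed.

Lemma mvnb_is_equiv A : equiv_class_of (@mvnb A).
Proof.
split.
- by move=> a; apply/asboolP/mvn_refl.
- by move=> a b; apply/idP/idP => /asboolP/mvn_sym/asboolP.
- by move=> b a c /asboolP ab /asboolP bc; apply/asboolP/(mvn_trans ab).
Qed.

Canonical mvn_equiv A := EquivRelPack (@mvnb_is_equiv A).

Lemma mvn_corner A (a b : idempotent A) : mvn a b ->
  exists x y : nat -> nat -> A,
    [/\ Minf x, Minf y, idem_mx a = mmul x y & idem_mx b = mmul y x] /\
    [/\ mmul a x = x, mmul x b = x, mmul b y = y & mmul y a = y].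
Proof.
move=> [x [y [xf yf ax bx]]].
have [af bf] := (idem_Minf a, idem_Minf b).
have aa := idem_idem a; have bb := idem_idem b.
have xb : mmul x b = mmul a x by rewrite bx ax mmulA.
have ya : mmul y a = mmul b y by rewrite bx ax mmulA.
exists (mmul a x), (mmul b y); split; split.
- exact: Minf_mul.
- exact: Minf_mul.
- rewrite -ya -mmulA//; last exact: Minf_mul.
  by rewrite (mmulA _ xf af) -ax aa aa.
- rewrite -xb -mmulA//; last exact: Minf_mul.
  by rewrite (mmulA _ yf bf) -bx bb bb.
- by rewrite mmulA// aa.
- by rewrite -xb -mmulA// bb.
- by rewrite mmulA// bb.
- by rewrite -ya -mmulA// aa.
Qed.

Definition orthogonal_idem A (a b : idempotent A) : Prop :=
  mmul a b = 0 /\ mmul b a = 0.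

Lemma mmul_orth A (x a b y : nat -> nat -> A) : Minf x -> Minf a -> Minf b ->
  Minf y -> mmul x a = x -> mmul b y = y -> mmul a b = 0 -> mmul x y = 0.
Proof.
move=> xf af bf yf <- <- ab.
rewrite -mmulA//; last exact: Minf_mul.
by rewrite (mmulA _ af yf) ab mmul0l mmul0r.
Qed.

Lemma mvn_orthD A (a b c a' b' c' : idempotent A) :
  orthogonal_idem a b -> orthogonal_idem a' b' ->
  idem_mx c = (a : nat -> nat -> A) + b ->
  idem_mx c' = (a' : nat -> nat -> A) + b' ->
  mvn a a' -> mvn b b' -> mvn c c'.
Proof.
move=> [ab ba] [ab' ba'] cE cE' /mvn_corner[x [y [[xf yf axy axy'] [ax xa' ay ya]]]].
move=> /mvn_corner[z [t [[zf tf bzt bzt'] [bz zb' bt tb]]]].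
have [af bf] := (idem_Minf a, idem_Minf b).
have [af' bf'] := (idem_Minf a', idem_Minf b').
exists (x + z), (y + t); split; try exact: MinfD.
  rewrite cE mmulDr ?mmulDl//; last exact: MinfD.
  rewrite (mmul_orth zf bf' af' yf)// (mmul_orth xf af' bf' tf)//.
  by rewrite addr0 add0r axy bzt.
rewrite cE' mmulDr ?mmulDl//; last exact: MinfD.
rewrite (mmul_orth tf bf af xf)// (mmul_orth yf af bf zf)//.
by rewrite addr0 add0r axy' bzt'.
Qed.

Lemma idem0_idem A : mmul (0 : nat -> nat -> A) 0 = 0.
Proof. exact: mmul0l. Qed.

Definition idem0 A : idempotent A := Idempotent (@Minf0 A) (@idem0_idem A).

Lemma idem_map_idem A B (f : cstar_hom A B) (a : idempotent A) :
  mmul (mmap f a) (mmap f a) = mmap f a.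
Proof. by rewrite -mmap_mul ?idem_idem//; exact: idem_Minf. Qed.

Definition idem_map A B (f : cstar_hom A B) (a : idempotent A) : idempotent B :=
  Idempotent (Minf_map f (idem_Minf a)) (idem_map_idem f a).

Lemma mvn_map A B (f : cstar_hom A B) (a b : idempotent A) :
  mvn a b -> mvn (idem_map f a) (idem_map f b).
Proof.
move=> [x [y [xf yf ax bx]]]; exists (mmap f x), (mmap f y); split.
- exact: Minf_map.
- exact: Minf_map.
- by rewrite -mmap_mul// -ax.
- by rewrite -mmap_mul// -bx.
Qed.

(* Copies of a on the even (s = false) or on the odd (s = true) indices. *)
Definition spread A (s : bool) (a : nat -> nat -> A) : nat -> nat -> A :=
  fun i j => if (odd i == s) && (odd j == s) then a i./2 j./2 else 0.

Definition spread_row A (s : bool) (a : nat -> nat -> A) : nat -> nat -> A :=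
  fun i j => if odd i == s then a i./2 j else 0.

Definition spread_col A (s : bool) (a : nat -> nat -> A) : nat -> nat -> A :=
  fun i j => if odd j == s then a i j./2 else 0.

Lemma odd_halfD (s : bool) k : odd (s + k.*2) = s.
Proof. by rewrite oddD odd_double addbF oddb. Qed.

Lemma half_bitD (s : bool) k : (s + k.*2)./2 = k.
Proof. exact: half_bit_double. Qed.

Lemma fsum_spread A (s : bool) (F : nat -> A) n :
  (forall k, (n <= k)%N -> F k = 0) ->
  \sum_(k \in [set: nat]) (if odd k == s then F k./2 else 0) =
  \sum_(k \in [set: nat]) F k.
Proof.
move=> F0; rewrite (fsum_ord F0) (@fsum_ord _ n.*2); last first.
  by move=> k nk; rewrite F0 ?if_same// geq_half_double.
rewrite -(big_mkord xpredT (fun k => if odd k == s then F k./2 else 0)).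
rewrite -(big_mkord xpredT F).
elim: n {F0} => [|n IH]; first by rewrite /= !big_geq.
rewrite doubleS !big_nat_recr//= IH -addrA; congr (_ + _).
rewrite odd_double uphalf_double doubleK.
by case: s {IH}; rewrite /= ?addr0 ?add0r.
Qed.

Lemma Minf_spread A s (a : nat -> nat -> A) : Minf a -> Minf (spread s a).
Proof.
move=> [n n0]; exists n.*2 => i j; rewrite /spread; case: ifP => // _ nij.
by apply: n0; move: nij; rewrite !leq_max !geq_half_double.
Qed.

Lemma Minf_spread_row A s (a : nat -> nat -> A) : Minf a -> Minf (spread_row s a).
Proof.
move=> [n n0]; exists n.*2 => i j; rewrite /spread_row; case: ifP => // _ nij.
apply: n0; move: nij; rewrite !leq_max geq_half_double => /orP[->//|nj].
by rewrite (leq_trans _ nj) ?orbT// -addnn leq_addr.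
Qed.

Lemma Minf_spread_col A s (a : nat -> nat -> A) : Minf a -> Minf (spread_col s a).
Proof.
move=> [n n0]; exists n.*2 => i j; rewrite /spread_col; case: ifP => // _ nij.
apply: n0; move: nij; rewrite !leq_max geq_half_double => /orP[ni|->//].
  by rewrite (leq_trans _ ni)// -addnn leq_addr.
by rewrite orbT.
Qed.

Lemma mmul_spread_col_row A s (a b : nat -> nat -> A) : Minf a ->
  mmul (spread_col s a) (spread_row s b) = mmul a b.
Proof.
move=> [n n0]; apply/funext => i; apply/funext => j; rewrite /mmul.
rewrite -(@fsum_spread _ s (fun k => cmul (a i k) (b k j)) n); last first.
  by move=> k nk; rewrite n0 ?cmul0l// leq_max nk orbT.
apply: eq_fsbigr => k _; rewrite /spread_col /spread_row.
by case: ifP => // _; rewrite cmul0l.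
Qed.

Lemma mmul_spread_row_col A s (a b : nat -> nat -> A) :
  mmul (spread_row s a) (spread_col s b) = spread s (mmul a b).
Proof.
apply/funext => i; apply/funext => j.
rewrite /spread /mmul /spread_row /spread_col; case: ifPn => [/andP[-> ->]//|].
rewrite negb_and => /orP[]/negPf->; apply: fsbig1 => k _.
  by rewrite cmul0l.
by rewrite cmul0r.
Qed.

Lemma mmul_spread A s (a b : nat -> nat -> A) : Minf a ->
  mmul (spread s a) (spread s b) = spread s (mmul a b).
Proof.
move=> [n n0]; apply/funext => i; apply/funext => j.
rewrite /spread /mmul; case: ifPn => [/andP[-> ->]/=|].
  rewrite -(@fsum_spread _ s (fun k => cmul (a i./2 k) (b k j./2)) n); last first.
    by move=> k nk; rewrite n0 ?cmul0l// leq_max nk orbT.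
  apply: eq_fsbigr => k _; rewrite andbT.
  by case: ifP => // _; rewrite cmul0l.
rewrite negb_and => /orP[]/negPf->; apply: fsbig1 => k _.
  by rewrite cmul0l.
by rewrite andbF cmul0r.
Qed.

Lemma mmul_spread_orth A s (a b : nat -> nat -> A) :
  mmul (spread s a) (spread (~~ s) b) = 0.
Proof.
apply/funext => i; apply/funext => j; apply: fsbig1 => k _; rewrite /spread.
by case: s (odd k) => -[]; rewrite /= ?(andbT, andbF) ?cmul0l ?cmul0r.
Qed.

Lemma idem_spread_idem A s (a : idempotent A) :
  mmul (spread s a) (spread s a) = spread s a.
Proof. by rewrite mmul_spread ?idem_idem//; exact: idem_Minf. Qed.

Definition idem_spread A s (a : idempotent A) : idempotent A :=
  Idempotent (Minf_spread s (idem_Minf a)) (idem_spread_idem s a).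

Lemma mvn_spread A s (a : idempotent A) : mvn a (idem_spread s a).
Proof.
have af := idem_Minf a; exists (spread_col s a), (spread_row s a); split.
- exact: Minf_spread_col.
- exact: Minf_spread_row.
- by rewrite mmul_spread_col_row// idem_idem.
- by rewrite mmul_spread_row_col idem_idem.
Qed.

Lemma orth_idem_idem A (a b : idempotent A) : orthogonal_idem a b ->
  mmul ((a : nat -> nat -> A) + b) ((a : nat -> nat -> A) + b) =
  (a : nat -> nat -> A) + b.
Proof.
move=> [ab ba]; have [af bf] := (idem_Minf a, idem_Minf b).
rewrite mmulDr ?mmulDl//; last exact: MinfD.
by rewrite ab ba !idem_idem addr0 add0r.
Qed.

Definition idem_add A (a b : idempotent A) (ab : orthogonal_idem a b) :
  idempotent A :=
  Idempotent (MinfD (idem_Minf a) (idem_Minf b)) (orth_idem_idem ab).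

Lemma orthogonal_spread A (a b : idempotent A) :
  orthogonal_idem (idem_spread false a) (idem_spread true b).
Proof. by split; rewrite (mmul_spread_orth false, mmul_spread_orth true). Qed.

Definition idem_oplus A (a b : idempotent A) : idempotent A :=
  idem_add (orthogonal_spread a b).

Lemma mvn_oplus A (a b a' b' : idempotent A) : mvn a a' -> mvn b b' ->
  mvn (idem_oplus a b) (idem_oplus a' b').
Proof.
move=> aa' bb'; apply: (mvn_orthD (orthogonal_spread a b) (orthogonal_spread a' b')) => //.
  apply: mvn_trans (mvn_spread _ _).
  by apply: mvn_trans aa'; apply/mvn_sym/mvn_spread.
apply: mvn_trans (mvn_spread _ _).
by apply: mvn_trans bb'; apply/mvn_sym/mvn_spread.
Qed.

Lemma mvn_add_oplus A (a b : idempotent A) (ab : orthogonal_idem a b) :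
  mvn (idem_add ab) (idem_oplus a b).
Proof.
by apply: (mvn_orthD ab (orthogonal_spread a b)) => //; exact: mvn_spread.
Qed.

Lemma idem_oplusC A (a b : idempotent A) :
  mvn (idem_oplus a b) (idem_oplus b a).
Proof.
have ba : orthogonal_idem (idem_spread true a) (idem_spread false b).
  by have [? ?] := orthogonal_spread b a; split.
apply: (mvn_orthD (orthogonal_spread a b) ba) => //.
- by rewrite /= addrC.
- by apply: mvn_trans (mvn_spread _ _); apply/mvn_sym/mvn_spread.
- by apply: mvn_trans (mvn_spread _ _); apply/mvn_sym/mvn_spread.
Qed.

Lemma spreadD A s (a b : nat -> nat -> A) :
  spread s (a + b) = spread s a + spread s b.
Proof.
apply/funext => i; apply/funext => j; rewrite !fctE /spread.
by case: ifP; rewrite ?addr0.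
Qed.

Lemma spread0 A s : spread s (0 : nat -> nat -> A) = 0.
Proof.
by apply/funext => i; apply/funext => j; rewrite /spread; case: ifP.
Qed.

Lemma idem_oplus0 A (a : idempotent A) : mvn (idem_oplus (idem0 A) a) a.
Proof.
have -> : idem_oplus (idem0 A) a = idem_spread true a.
  by apply: idem_ext; rewrite /= spread0 add0r.
exact/mvn_sym/mvn_spread.
Qed.

Lemma idem_oplusA A (a b c : idempotent A) :
  mvn (idem_oplus a (idem_oplus b c)) (idem_oplus (idem_oplus a b) c).
Proof.
pose sp s (x : idempotent A) := idem_spread s x.
have orth s x y : orthogonal_idem (sp s x) (sp (~~ s) y).
  by split; [exact: mmul_spread_orth | rewrite -{2}[s]negbK mmul_spread_orth].
have bc : orthogonal_idem (sp true (sp false b)) (sp true (sp true c)).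
  have [h1 h2] := orth false b c.
  split; rewrite /= mmul_spread ?h1 ?h2 ?spread0//; exact: Minf_spread (idem_Minf _).
have a_b : orthogonal_idem (sp false a) (sp true (sp false b)) by exact: orth.
have ab'c : orthogonal_idem (idem_add a_b) (sp true (sp true c)).
  have [h1 h2] := orth false a (sp true c).
  have [h3 h4] := bc.
  have f s x := Minf_spread s (idem_Minf (x : idempotent A)).
  split; rewrite /= ?mmulDl ?mmulDr; try exact: Minf_spread (f _ _); try exact: f.
    by rewrite [X in X + _]h1 [X in _ + X]h3 addr0.
  by rewrite [X in X + _]h2 [X in _ + X]h4 addr0.
apply: (mvn_orthD ab'c (orthogonal_spread (idem_oplus a b) c)) => //.
- by rewrite /= spreadD addrA.
- apply: mvn_trans (mvn_spread _ _).
  apply: (mvn_orthD a_b (orthogonal_spread a b)) => //.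
    exact: mvn_refl.
  apply: mvn_trans (mvn_spread _ _).
  do 2!apply: (mvn_trans (mvn_sym (mvn_spread _ _))).
  exact: mvn_refl.
- exact/mvn_sym/mvn_spread.
Qed.

End Minf.

Section V.
Variable R : realType.
Implicit Types A B C : cstarAlgType R.

Definition V A := {eq_quot (@mvn_equiv R A)}.

HB.instance Definition _ A := Choice.on (V A).
HB.instance Definition _ A := EqQuotient.on (V A).

Definition Vclass A (a : idempotent A) : V A := \pi_(V A) a.

Lemma Vclass_eq A (a b : idempotent A) : Vclass a = Vclass b <-> mvn a b.
Proof.
split=> [/eqquotP/asboolP//|ab]; rewrite /Vclass.
by apply/eqquotP/asboolP.
Qed.

Lemma mvn_repr A (a : idempotent A) : mvn (repr (Vclass a)) a.
Proof. by apply/Vclass_eq; rewrite /Vclass reprK. Qed.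

Lemma Vclass_repr A (x : V A) : Vclass (repr x) = x.
Proof. exact: reprK. Qed.

Definition Vadd A (x y : V A) : V A := Vclass (idem_oplus (repr x) (repr y)).

Lemma Vadd_class A (a b : idempotent A) :
  Vadd (Vclass a) (Vclass b) = Vclass (idem_oplus a b).
Proof. by apply/Vclass_eq/mvn_oplus; exact: mvn_repr. Qed.

Lemma VaddA A : associative (@Vadd A).
Proof.
move=> x y z; rewrite -[x]Vclass_repr -[y]Vclass_repr -[z]Vclass_repr.
by rewrite !Vadd_class; apply/Vclass_eq/idem_oplusA.
Qed.

Lemma VaddC A : commutative (@Vadd A).
Proof. by move=> x y; apply/Vclass_eq/idem_oplusC. Qed.

Lemma Vadd0 A : left_id (Vclass (idem0 A)) (@Vadd A).
Proof.
by move=> x; rewrite -[x]Vclass_repr Vadd_class; apply/Vclass_eq/idem_oplus0.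
Qed.

HB.instance Definition _ A :=
  GRing.isNmodule.Build (V A) (@VaddA A) (@VaddC A) (@Vadd0 A).

(* This property determines the addition of V A, since [a] = [spread false a]
   and [b] = [spread true b]. *)
Lemma Vclass_add A (a b : idempotent A) (ab : orthogonal_idem a b) :
  Vclass a + Vclass b = Vclass (idem_add ab).
Proof.
by rewrite [LHS]Vadd_class; apply/Vclass_eq/mvn_sym/mvn_add_oplus.
Qed.

Definition Vmap A B (f : cstar_hom A B) (x : V A) : V B :=
  Vclass (idem_map f (repr x)).

Lemma Vmap_class A B (f : cstar_hom A B) (a : idempotent A) :
  Vmap f (Vclass a) = Vclass (idem_map f a).
Proof. by apply/Vclass_eq/mvn_map/mvn_repr. Qed.

Lemma Vmap_is_nmod_morphism A B (f : cstar_hom A B) :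
  nmod_morphism (Vmap f).
Proof.
split=> [|x y].
  rewrite [LHS]Vmap_class; congr Vclass; apply: idem_ext => /=.
  by apply/funext => i; apply/funext => j; exact: chom0.
rewrite -[x]Vclass_repr -[y]Vclass_repr [_ + _ in LHS]Vadd_class !Vmap_class.
rewrite [RHS]Vadd_class; congr Vclass; apply: idem_ext => /=.
apply/funext => i; apply/funext => j; rewrite /mmap /spread !fctE chomD.
by congr (_ + _); case: ifP => // _; exact: chom0.
Qed.

HB.instance Definition _ A B (f : cstar_hom A B) :=
  GRing.isNmodMorphism.Build (V A) (V B) (Vmap f) (Vmap_is_nmod_morphism f).

Lemma Vmap_id A (x : V A) : Vmap (cstar_id A) x = x.
Proof.
rewrite -[x]Vclass_repr Vmap_class; congr Vclass; exact: idem_ext.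
Qed.

Lemma Vmap_comp A B C (g : cstar_hom B C) (f : cstar_hom A B) (x : V A) :
  Vmap (cstar_comp g f) x = Vmap g (Vmap f x).
Proof.
rewrite -[x]Vclass_repr !Vmap_class; congr Vclass; exact: idem_ext.
Qed.
End V.

Section Grothendieck.
Implicit Types M N P : nmodType.

Definition groth_rel M : rel (M * M) :=
  fun x y => `[< exists k, x.1 + y.2 + k = y.1 + x.2 + k >].

Lemma groth_rel_is_equiv M : equiv_class_of (@groth_rel M).
Proof.
split.
- by move=> x; apply/asboolP; exists 0.
- by move=> x y; apply/idP/idP => /asboolP[k e]; apply/asboolP; exists k.
- move=> y x z /asboolP[k e] /asboolP[l e']; apply/asboolP.
  exists (y.2 + k + l).
  rewrite [LHS](AC (2*3) ((1*3*4)*(2*5))) /= e.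
  rewrite [LHS](AC (3*2) ((1*4*5)*(2*3))) /= e'.
  by rewrite [LHS](AC (3*2) ((1*4)*(2*5*3))).
Qed.

Canonical groth_equiv M := EquivRelPack (@groth_rel_is_equiv M).

Definition groth M := {eq_quot (@groth_equiv M)}.

HB.instance Definition _ M := Choice.on (groth M).
HB.instance Definition _ M := EqQuotient.on (groth M).

(* The formal difference x - y. *)
Definition gdiff M (x y : M) : groth M := \pi_(groth M) (x, y).

Lemma gdiff_eq M (x y z t : M) :
  gdiff x y = gdiff z t <-> exists k, x + t + k = z + y + k.
Proof.
split=> [/eqquotP/asboolP//|xy]; rewrite /gdiff.
by apply/eqquotP/asboolP.
Qed.

Lemma gdiff_repr M (x : groth M) : gdiff (repr x).1 (repr x).2 = x.
Proof. by rewrite /gdiff -surjective_pairing; exact: reprK. Qed.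

Lemma grothP M (x : groth M) : exists y z, x = gdiff y z.
Proof. by exists (repr x).1, (repr x).2; rewrite gdiff_repr. Qed.

Definition gadd M (x y : groth M) : groth M :=
  gdiff ((repr x).1 + (repr y).1) ((repr x).2 + (repr y).2).

Definition gopp M (x : groth M) : groth M := gdiff (repr x).2 (repr x).1.

Lemma gadd_diff M (x y z t : M) :
  gadd (gdiff x y) (gdiff z t) = gdiff (x + z) (y + t).
Proof.
have /gdiff_eq[k ek] := gdiff_repr (gdiff x y).
have /gdiff_eq[l el] := gdiff_repr (gdiff z t).
apply/gdiff_eq; exists (k + l).
by rewrite (addrACA _ _ y) addrACA ek el addrACA (addrACA x).
Qed.

Lemma gopp_diff M (x y : M) : gopp (gdiff x y) = gdiff y x.
Proof.
have /gdiff_eq[k ek] := gdiff_repr (gdiff x y).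
apply/gdiff_eq; exists k.
by rewrite [_ + x]addrC -ek [y + _]addrC.
Qed.

Lemma gaddA M : associative (@gadd M).
Proof.
move=> x y z; have [x1 [x2 ->]] := grothP x; have [y1 [y2 ->]] := grothP y.
by have [z1 [z2 ->]] := grothP z; rewrite !gadd_diff !addrA.
Qed.

Lemma gaddC M : commutative (@gadd M).
Proof.
move=> x y; have [x1 [x2 ->]] := grothP x; have [y1 [y2 ->]] := grothP y.
by rewrite !gadd_diff [x1 + _]addrC [x2 + _]addrC.
Qed.

Lemma gadd0 M : left_id (gdiff (0 : M) 0) (@gadd M).
Proof.
by move=> x; have [x1 [x2 ->]] := grothP x; rewrite gadd_diff !add0r.
Qed.

Lemma gaddN M : left_inverse (gdiff (0 : M) 0) (@gopp M) (@gadd M).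
Proof.
move=> x; have [x1 [x2 ->]] := grothP x; rewrite gopp_diff gadd_diff.
by apply/gdiff_eq; exists 0; rewrite !addr0 !add0r addrC.
Qed.

HB.instance Definition _ M := GRing.isZmodule.Build (groth M)
  (@gaddA M) (@gaddC M) (@gadd0 M) (@gaddN M).

Definition groth_of M (x : M) : groth M := gdiff x 0.

Definition groth_map M N (f : {additive M -> N}) (x : groth M) : groth N :=
  gdiff (f (repr x).1) (f (repr x).2).

Lemma groth_map_diff M N (f : {additive M -> N}) (x y : M) :
  groth_map f (gdiff x y) = gdiff (f x) (f y).
Proof.
have /gdiff_eq[k ek] := gdiff_repr (gdiff x y).
by apply/gdiff_eq; exists (f k); rewrite -!raddfD ek.
Qed.

Lemma groth_mapD M N (f : {additive M -> N}) :
  {morph groth_map f : x y / x + y}.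
Proof.
move=> x y; have [x1 [x2 ->]] := grothP x; have [y1 [y2 ->]] := grothP y.
by rewrite [_ + _ in LHS]gadd_diff !groth_map_diff [RHS]gadd_diff !raddfD.
Qed.
End Grothendieck.

(* The preorder is given by its positive cone. *)
Record preab := PreAbGroup {
  pab_zmod :> zmodType;
  pcone : set pab_zmod;
  pcone0 : pcone 0;
  pconeD : forall x y, pcone x -> pcone y -> pcone (x + y) }.

Record preab_hom (G H : preab) := PreAbHom {
  phom :> G -> H;
  phomD : {morph phom : x y / x + y};
  phom_pos : forall x, pcone x -> pcone (phom x) }.

Lemma preab_hom_ext (G H : preab) (f g : preab_hom G H) : f =1 g -> f = g.
Proof.
case: f g => f f1 f2 [g g1 g2] /= /funext fg.
by case: g / fg g1 g2 => *; congr PreAbHom; exact: Prop_irrelevance.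
Qed.

Definition preab_id (G : preab) : preab_hom G G.
Proof. by exists id. Defined.

Definition preab_comp (G H K : preab) (g : preab_hom H K) (f : preab_hom G H) :
  preab_hom G K.
Proof.
exists (g \o f) => [x y|x xp] /=; first by rewrite !phomD.
by do 2!apply: phom_pos.
Defined.

Definition PreAb : category.
Proof.
by apply: (@Category preab preab_hom preab_id preab_comp) => *;
  exact: preab_hom_ext.
Defined.

Section K0.
Variable R : realType.

Definition K0_ob (A : AF_algebra R) : preab.
Proof.
exists (groth (V A)) (range (@groth_of (V A))); first by exists 0.
move=> _ _ [x _ <-] [y _ <-]; exists (x + y) => //.
by rewrite /groth_of [RHS]gadd_diff addr0.
Defined.

Definition K0_hom (A B : AF_algebra R) (f : cstar_hom A B) :
  preab_hom (K0_ob A) (K0_ob B).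
Proof.
exists (groth_map (Vmap f)); first exact: groth_mapD.
move=> _ [x _ <-]; exists (Vmap f x) => //.
by rewrite /groth_of groth_map_diff raddf0.
Defined.

Definition K0 : functor (AF R) PreAb.
Proof.
apply: (@Functor (AF R) PreAb K0_ob K0_hom) => [A|A B C g f];
  apply: preab_hom_ext => x; have [y [z ->]] := grothP x => /=.
  by rewrite groth_map_diff /= !Vmap_id.
by rewrite (groth_map_diff (Vmap f)) !groth_map_diff /= !Vmap_comp.
Defined.
End K0.

Definition simplicial (G : porderZmodType) : Prop :=
  exists (n : nat) (f : {additive G -> 'rV[int]_n}),
    bijective f /\
    (forall x y : G, (x <= y) = [forall i, f x ord0 i <= f y ord0 i]).

Definition order_unit (G : porderZmodType) (u : G) : Prop :=
  0 <= u /\ forall x : G, exists n : nat, (0 < n)%N /\ x <= u *+ n.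

Record simp_group := SimpGroup {
  sgroup :> porderZmodType;
  sunit : sgroup;
  sgroup_simplicial : simplicial sgroup;
  sunit_order_unit : order_unit sunit }.

Record simp_emb (G H : simp_group) := SimpEmb {
  semb :> G -> H;
  sembD : {morph semb : x y / x + y};
  semb_inj : injective semb;
  semb_pos : forall x, 0 <= x -> 0 <= semb x;
  semb_unit : semb (sunit G) = sunit H }.

Lemma simp_emb_ext (G H : simp_group) (f g : simp_emb G H) : f =1 g -> f = g.
Proof.
case: f g => f f1 f2 f3 f4 [g g1 g2 g3 g4] /= /funext fg.
by case: g / fg g1 g2 g3 g4 => *; congr SimpEmb; exact: Prop_irrelevance.
Qed.

Definition simp_id (G : simp_group) : simp_emb G G.
Proof. by exists id. Defined.

Definition simp_comp (G H K : simp_group) (g : simp_emb H K)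
  (f : simp_emb G H) : simp_emb G K.
Proof.
exists (g \o f) => [x y|x y|x x0|] /=.
- by rewrite !sembD.
- by move=> /semb_inj/semb_inj.
- by do 2!apply: semb_pos.
- by rewrite !semb_unit.
Defined.

Definition SGrpEmb1 : category.
Proof.
by apply: (@Category simp_group simp_emb simp_id simp_comp) => *;
  exact: simp_emb_ext.
Defined.

Definition simp_preab (G : simp_group) : preab.
Proof.
apply: (@PreAbGroup G [set x | 0 <= x]); first exact: lexx.
move=> x y /=.
have [n [f [_ fle]]] := sgroup_simplicial G.
rewrite !fle => /forallP x0 /forallP y0; apply/forallP => i.
have := lerD (x0 i) (y0 i); by rewrite raddfD raddf0 !mxE addr0.
Defined.

Definition forget_unit : functor SGrpEmb1 PreAb.
Proof.
apply: (@Functor SGrpEmb1 PreAb simp_preab (fun G H f =>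
    @PreAbHom (simp_preab G) (simp_preab H) f (sembD f) (semb_pos f))) => *;
  exact: preab_hom_ext.
Defined.

(* Main.v *)
From HB Require Import structures.
From mathcomp Require Import all_boot all_order all_algebra.
From mathcomp Require Import complex.
From mathcomp Require Import ring lra zify.
From mathcomp Require Import all_classical all_reals all_analysis.
Require Import Defs.
From mathcomp Require Import all_reals.
Import Order.TTheory GRing.Theory Num.Theory numFieldNormedType.Exports.

(* Consider the commutative square of (Z,1) -> (Z^2,(1,1)) -> (Z^3,(2,2,2)),
   x |-> (x,x) and (a,b) |-> (a+b,2a,2b), and of (Z,1) -> (Z,2) -> (Z^3,(2,2,2)),
   x |-> 2x and x |-> (x,x,x).  The swap sigma of Z^2 and the swap s of the last
   two coordinates of Z^3 are compatible with the square.  Suppose that the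
   diagram lifts, and let p be the image of an idempotent of class 1 over
   Gamma(Z,1) in the matrices over Gamma(Z^3).
   - Along Z^2, p = c1 + c2 with c1 and c2 orthogonal, and s exchanges c1 and c2.
   - Along (Z,2), p is the unit of a system of 2x2 matrix units fixed by s; thus
     s fixes every element of the component M_2(C) of the corner of p that belongs
     to the first coordinate of Z^3.
   Hence c1 and c2 have the same image in M_2(C), although they are orthogonal
   with sum 1.  The facts about K_0 used here rest on three properties of the
   matrices over an AF algebra: they are semiprime and Dedekind-finite, and
   e M e = C e for every idempotent e without proper nonzero subidempotents.  The
   last two pass from finite-dimensional algebras to the limit by approximation. *)

Set Implicit Arguments.
Unset Strict Implicit.
Unset Printing Implicit Defensive.

Local Open Scope classical_set_scope.
Local Open Scope complex_scope.
Local Open Scope ring_scope.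

(** * Finite-dimensional algebras *)

(** An automorphism that is trivial on K_0 can still be a nontrivial conjugation, so information on
    classes never shows by itself that an idempotent is fixed. The only source of rigidity is
    uniqueness: a minimal idempotent that occurs with multiplicity one below [p] is the only one of
    its type there. The classes are chosen for this. The summands c1 and c2 have classes (1,2,0) and
    (1,0,2), which meet only in the coordinate that s fixes, and the two halves of p that come from
    (Z,2) have class (1,1,1), which is one in that coordinate.

    A second obstacle is that equal classes in K_0 only give equivalence of idempotents after adding
    a third one, and that these idempotents need not be self-adjoint. Dedekind-finiteness yields
    that only 0 has class 0; beyond that, cancellation is replaced by comparing the minimal
    idempotents that occur on both sides.

    Finally, an AF algebra is given by a universal property alone, along an arbitrary directed
    poset. The density of the union of the images has to be deduced from it. *)

Section DimLe.
Variables (K : fieldType) (V : lmodType K).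
Implicit Types S T : set V.

(** A bound by linear dependence requires no basis and no subspace structure on [S], and it is
    inherited by subsets such as left ideals. *)
Definition dim_le S (d : nat) : Prop :=
  forall v : 'I_d.+1 -> V, (forall i, S (v i)) ->
    exists c : 'I_d.+1 -> K, (exists i, c i != 0) /\ \sum_i c i *: v i = 0.

Lemma dim_leS S T d : S `<=` T -> dim_le T d -> dim_le S d.
Proof. by move=> ST Td v vS; apply: Td => i; apply: ST. Qed.

(** The coordinates of [#|I|.+1] vectors form a matrix with more rows than columns. Its left kernel
    is therefore nonzero, and any nonzero row of [kermx] is a linear relation. *)
Lemma dim_le_span (I : finType) (g : I -> V) S :
  (forall x, S x -> exists a : I -> K, x = \sum_i a i *: g i) -> dim_le S #|I|.
Proof.
move=> Sg v vS; have /choice[a av] i := Sg _ (vS i).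
pose A : 'M[K]_(#|I|.+1, #|I|) := \matrix_(i, j) a i (enum_val j).
have [i ki] : exists i, row i (kermx A) != 0.
  apply: contrapT => kA.
  have /eqP : kermx A = 0.
    by apply/row_matrixP => i; rewrite row0; apply/eqP; apply: contrapT => ri; apply: kA;
      exists i; apply/negP.
  rewrite -mxrank_eq0 mxrank_ker subn_eq0 => rA.
  by have := leq_trans rA (rank_leq_col A); rewrite ltnn.
have [j kj] : exists j, row i (kermx A) ord0 j != 0.
  apply: contrapT => k0; case/negP: ki; apply/eqP/rowP => j; rewrite [RHS]mxE.
  by apply/eqP; apply: contrapT => kj; apply: k0; exists j; apply/negP.
exists (row i (kermx A) ord0); split; first by exists j.
have rA : row i (kermx A) *m A = 0 by rewrite -row_mul mulmx_ker row0.
under eq_bigr => k _ do rewrite av scaler_sumr.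
rewrite exchange_big big1 // => l _.
under eq_bigr => k _ do rewrite scalerA.
rewrite -scaler_suml.
have := congr1 (fun M : 'rV_#|I| => M ord0 (enum_rank l)) rA.
rewrite mxE [RHS]mxE; under eq_bigr => k _ do rewrite [A _ _]mxE enum_rankK.
by move=> ->; rewrite scale0r.
Qed.
End DimLe.

(** * Algebraic elements and semiprime finite-dimensional subalgebras *)

Section FiniteDimensionalAlgebra.
Variables (K : fieldType) (U : algType K).
Implicit Types (S : set U) (x y z e f : U) (P Q : {poly K}).

Local Notation hor := (@horner_alg K U).

Definition algebraic_elt x : Prop := exists2 P, P != 0 & hor x P = 0.

Lemma horner_algMC x P Q : hor x P * hor x Q = hor x Q * hor x P.
Proof. by rewrite -!rmorphM mulrC. Qed.

Lemma horner_alg_comm x P : x * hor x P = hor x P * x.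
Proof. by rewrite -{1 4}[x]horner_algX horner_algMC. Qed.

Lemma horner_algXn x n : hor x 'X^n = x ^+ n.
Proof. by rewrite rmorphXn /= horner_algX. Qed.

(* Fitting's lemma: X^(m+1) and the prime-to-X part of P are coprime. *)
Lemma fitting x : algebraic_elt x -> (forall n, x ^+ n.+1 != 0) ->
  exists Q, x * hor x Q * (x * hor x Q) = x * hor x Q /\ x * hor x Q != 0.
Proof.
move=> [P Pn0 Px] xn.
have [m [Q Q0 PE]] := multiplicity_XsubC P 0.
move: Q0 PE; rewrite Pn0 subr0 /= => Q0 PE.
have /Bezout_eq1_coprimepP[[u v] /= uv] : coprimep ('X^(m.+1) : {poly K}) Q.
  by rewrite coprimep_expl // coprimep_sym -(subr0 'X) -(polyC0 K) coprimep_XsubC.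
have QX : hor x (Q * 'X^(m.+1)) = 0.
  by rewrite exprSr mulrA -PE rmorphM /= Px mul0r.
(* By Bezout, [u * 'X^(m.+1)] is idempotent modulo [Q * 'X^(m.+1)], which vanishes at [x]. One
   factor [x] stays outside, so that the idempotent lies in every subalgebra containing [x], with or
   without unit. *)
exists (u * 'X^m).
have xE : x * hor x (u * 'X^m) = hor x (u * 'X^(m.+1)).
  by rewrite -{1}[x]horner_algX -rmorphM /= exprS mulrCA.
rewrite xE; split.
- apply/eqP; rewrite -subr_eq0 -rmorphM -rmorphB /=.
  have -> : u * 'X^(m.+1) * (u * 'X^(m.+1)) - u * 'X^(m.+1) =
      - (u * v) * (Q * 'X^(m.+1)) + (u * 'X^(m.+1) + v * Q - 1) * (u * 'X^(m.+1)) by ring.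
  by rewrite uv subrr mul0r addr0 rmorphM /= QX mulr0.
- apply/eqP => f0; case/negP: (xn m); rewrite -horner_algXn.
  have -> : 'X^(m.+1) = u * 'X^(m.+1) * 'X^(m.+1) + v * (Q * 'X^(m.+1)).
    by rewrite [v * _]mulrA -mulrDl uv mul1r.
  rewrite rmorphD (rmorphM _ (u * _)) (rmorphM _ v) /= f0 mul0r add0r.
  by apply/eqP; rewrite QX mulr0.
Qed.

Lemma algebraic_addC x c : algebraic_elt x -> algebraic_elt (x + c *: 1).
Proof.
move=> [P P0 Px]; exists (P \Po ('X - c%:P)).
  by rewrite comp_poly2_eq0 // size_XsubC.
rewrite -Px; elim/poly_ind: P {P0 Px} => [|Q a IH]; first by rewrite comp_poly0 !rmorph0.
rewrite comp_polyD comp_polyM comp_polyX comp_polyC !rmorphD !rmorphM /= IH.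
by rewrite rmorphB /= !horner_algC !horner_algX addrK.
Qed.

(** The powers of X that divide an annihilating polynomial can be cancelled by multiplying with
    powers of [r] on the right. What remains has a nonzero constant term, and solving for this term
    exhibits a two-sided inverse that is a polynomial in [x]. *)
Lemma algebraic_rinv x r : algebraic_elt x -> x * r = 1 ->
  exists q, x * q = 1 /\ q * x = 1.
Proof.
move=> [P Pn0 Px] xr.
have xmr m : x ^+ m * r ^+ m = 1.
  elim: m => [|m IH]; first by rewrite mulr1.
  by rewrite exprSr [r ^+ _]exprS mulrA -(mulrA _ x) xr mulr1.
have [m [Q Q0 PE]] := multiplicity_XsubC P 0.
move: Q0 PE; rewrite Pn0 subr0 /= => Q0 PE.
have Qx : hor x Q = 0.
  by rewrite -[LHS]mulr1 -(xmr m) mulrA -horner_algXn -rmorphM /= -PE Px mul0r.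
have [q qE] : exists q, Q = Q.[0]%:P + 'X * q.
  have /factor_theorem[q qE] : root (Q - Q.[0]%:P) 0.
    by rewrite /root !hornerE subrr.
  by exists q; rewrite mulrC -[X in _ * X]subr0 -qE addrC subrK.
have c0 : Q.[0] != 0 by [].
have xq : Q.[0] *: 1 + x * hor x q = 0.
  by rewrite -Qx {2}qE rmorphD rmorphM /= horner_algC horner_algX.
have xq1 : x * hor x q = - Q.[0] *: 1.
  by apply/eqP; rewrite scaleNr -addr_eq0 addrC xq.
exists (- Q.[0]^-1 *: hor x q).
rewrite -scalerAr -scalerAl -horner_alg_comm xq1 scalerA mulrNN mulVf // scale1r.
by split.
Qed.

(** A subset of a unital algebra and not an algebra of its own: the matrices of a fixed size do not
    contain the unit of the ambient unitization, while evaluation of polynomials requires one. *)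
Record semiprime_findim S : Prop := SemiprimeFindim {
  sf0 : S 0;
  sfD : forall x y, S x -> S y -> S (x + y);
  sfZ : forall k x, S x -> S (k *: x);
  sfM : forall x y, S x -> S y -> S (x * y);
  sf_dim : exists d, dim_le S d;
  sf_semiprime : forall x, S x -> (forall y, S y -> x * y * x = 0) -> x = 0 }.

Section SemiprimeFindim.
Variables (S : set U) (Sf : semiprime_findim S).

Lemma sfB x y : S x -> S y -> S (x - y).
Proof. by move=> Sx Sy; rewrite -scaleN1r; apply: (sfD Sf) => //; apply: (sfZ Sf). Qed.

Lemma sfXM x y n : S x -> S y -> S (x ^+ n * y).
Proof.
move=> Sx Sy; elim: n => [|n IH]; first by rewrite mul1r.
by rewrite exprS -mulrA; exact: (sfM Sf).
Qed.

Lemma sf_horner x P : S x -> S (x * hor x P).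
Proof.
move=> Sx; elim/poly_ind: P => [|P a IH]; first by rewrite rmorph0 mulr0; exact: (sf0 Sf).
rewrite rmorphD rmorphM /= horner_algC horner_algX mulrDr mulrA -scalerAr mulr1.
by apply: (sfD Sf); [apply: (sfM Sf)|apply: (sfZ Sf)].
Qed.

Lemma sf_algebraic x : S x -> algebraic_elt x.
Proof.
move=> Sx; have [d dS] := sf_dim Sf.
have [|c [[i ci] cx]] := dS (fun i => x ^+ i * x); first by move=> i; exact: sfXM.
exists ((\sum_i c i *: 'X^i) * 'X).
  rewrite mulf_neq0 ?polyX_eq0 //; apply: contra_neq ci => P0.
  have := congr1 (fun P : {poly K} => P`_i) P0; rewrite coef0 coef_sum.
  rewrite (bigD1 i) //= coefZ coefXn eqxx mulr1 big1 ?addr0 // => j ji.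
  by rewrite coefZ coefXn eq_sym val_eqE (negPf ji) mulr0.
rewrite rmorphM /= horner_algX rmorph_sum mulr_suml -[RHS]cx.
by apply: eq_bigr => j _;
  rewrite -mul_polyC rmorphM /= horner_algC horner_algXn mulr_algl -scalerAl.
Qed.

(* Right multiplication by the nilpotent z = r y is not injective on S y, hence
   the dimension drops from S y to S (y z). *)
Lemma nil_left_ideal_eq0 d y : S y -> dim_le [set s * y | s in S] d ->
  (forall r, S r -> exists n, (r * y) ^+ n.+1 = 0) -> y = 0.
Proof.
elim: d y => [|d IH] y Sy dy nily; apply: contrapT => y0.
all: have [r Sr yry] : exists2 r, S r & y * r * y <> 0
  by apply: contrapT => nr; apply: y0; apply: (sf_semiprime Sf) => // r Sr;
     apply: contrapT => yry; apply: nr; exists r.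
all: pose z := r * y; have Sz : S z by exact: (sfM Sf).
all: have [k zk zk1] : exists2 k, z ^+ k.+1 != 0 & z ^+ k.+2 = 0.
1,3: have zn : exists n, z ^+ n.+1 == 0 by [have [n zn] := nily _ Sr; exists n; apply/eqP].
1,2: case: (ex_minnP zn) => -[/eqP z0|k /eqP zk kmin]; first by case: yry;
  rewrite -mulrA -/z -[z]expr1 z0 mulr0.
1,2: by exists k => //; apply/negP => /kmin; rewrite ltnn.
(* The last nonzero power of [z] is an element of [S y] that [z] kills on the right. For [d = 0] its
   existence is already absurd. *)
all: have zky : [set s * y | s in S] (z ^+ k.+1)
  by exists (z ^+ k * r); [exact: sfXM|rewrite exprSr mulrA].
  have [//|c [[i ci]]] := dy (fun=> z ^+ k.+1).
  rewrite big_ord1 => /eqP; rewrite scaler_eq0 (negPf zk) orbF.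
  by move: ci; rewrite (ord1 i) => /negPf->.
have : y * z = 0; last by rewrite mulrA.
apply: IH; first exact: (sfM Sf); last first.
  by move=> s Ss; have [n] := nily (s * y * r) (sfM Sf (sfM Sf Ss Sy) Sr); exists n;
    rewrite /z !mulrA.
move=> v vS; have /choice[s sv] i : exists s, S s /\ s * (y * z) = v i.
  by have [s ? ?] := vS i; exists s.
(* This power is adjoined to the elements [s j * y]. Multiplying the resulting relation by [z]
   removes the extra term and leaves a relation between the [s j * (y * z)]. *)
have [|c [[i ci]]] := dy (fun i => if unlift ord0 i is Some j then s j * y else z ^+ k.+1).
  by move=> i; case: unlift => // j; exists (s j) => //; case: (sv j).
rewrite big_ord_recl unlift_none => cE.
exists (fun j => c (lift ord0 j)); split.
  apply: contrapT => c0; move: cE; rewrite big1 => [|j _]; last first.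
    have -> : c (lift ord0 j) = 0; last by rewrite scale0r.
    by apply/eqP; apply: contrapT => cj; apply: c0; exists j; apply/negP.
  move=> /eqP; rewrite addr0 scaler_eq0 (negPf zk) orbF => c00.
  case: (unliftP ord0 i) ci => [j ->|-> /negP//] cj; by apply: c0; exists j.
have := congr1 (fun u => u * z) cE; rewrite mul0r mulrDl -scalerAl -exprSr zk1 scaler0 add0r.
rewrite mulr_suml => {2}<-; apply: eq_bigr => j _; rewrite liftK -scalerAl -mulrA.
by case: (sv j) => _ ->.
Qed.

Lemma semiprime_non_nilpotent y : S y -> y != 0 ->
  exists2 r, S r & forall n, (r * y) ^+ n.+1 != 0.
Proof.
move=> Sy y0; apply: contrapT => nr; case/negP: y0; apply/eqP.
have [d dS] := sf_dim Sf; apply: (@nil_left_ideal_eq0 d) => //.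
  by apply: dim_leS dS => _ [s Ss <-]; exact: (sfM Sf).
move=> r Sr; apply: contrapT => rn; apply: nr; exists r => // n.
by apply/negP => /eqP rn0; apply: rn; exists n.
Qed.
End SemiprimeFindim.
End FiniteDimensionalAlgebra.

(** * Primitive idempotents over an algebraically closed field *)

Section ClosedField.
Variables (K : closedFieldType) (U : algType K) (S : set U).
Hypothesis Sf : semiprime_findim S.
Implicit Types x y e f t : U.

(** The linear factors of an annihilating polynomial of [x], applied to [e] one after the other, end
    at 0; the last nonzero value is an eigenvector. It is fixed by [e] on the left because
    [e * x = x]. *)
Lemma eigenvector_mul x e : S x -> e != 0 -> e * e = e -> e * x = x ->
  exists l t, [/\ e * t = t, t != 0 & x * t = l *: t].
Proof.
move=> Sx e0 ee ex.
have [P P0 Px] := sf_algebraic Sf Sx.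
have [r Pr] := closed_field_poly_normal P.
have {Pr Px} : horner_alg x (\prod_(z <- r) ('X - z%:P)) = 0.
  apply/eqP; move/eqP: Px; rewrite {1}Pr -mul_polyC rmorphM /= horner_algC mulr_algl.
  by rewrite scaler_eq0 lead_coef_eq0 (negPf P0).
move=> /(congr1 (fun u => u * e)); rewrite mul0r.
move: e0 ee; move: {1 3 4 5}e => t t0 et.
elim: r t t0 et => [|z r IH] t t0 et.
  by rewrite big_nil rmorph1 mul1r => /eqP; rewrite (negPf t0).
rewrite big_cons mulrC rmorphM rmorphB /= horner_algC horner_algX -mulrA mulrBl mulr_algl.
have [xt _|xt] := eqVneq (x * t - z *: t) 0.
  by exists z, t; split=> //; apply/eqP; rewrite -subr_eq0 xt.
by apply: IH => //; rewrite mulrBr mulrA ex -scalerAr et.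
Qed.

(** Let [l] be an eigenvalue of [e * x * e] with eigenvector [t], and suppose that
    [y = e * x * e - l *: e] is nonzero. Semiprimeness gives a non-nilpotent [w = e * r * y], and
    Fitting's lemma a nonzero idempotent that is a polynomial in [w] and lies in the corner of [e].
    By primitivity it equals [e]; but it kills [t], since [y * t = 0]. *)
Lemma primitive_corner_scalar e : S e -> e != 0 -> e * e = e ->
  (forall f, S f -> f * f = f -> e * f = f -> f * e = f -> f = 0 \/ f = e) ->
  forall x, S x -> exists l, e * x * e = l *: e.
Proof.
move=> Se e0 ee eprim x Sx.
have Sx' : S (e * x * e) by do 2!apply: (sfM Sf) => //.
have [|l [t [et t0 xt]]] := eigenvector_mul Sx' e0 ee; first by rewrite !mulrA ee.
exists l; apply/eqP; rewrite -subr_eq0; apply/negPn/negP.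
set y := _ - _ => y0.
have Sy : S y by apply: (sfB Sf) => //; exact: (sfZ Sf).
have ey : e * y = y by rewrite /y mulrBr -scalerAr !mulrA ee.
have ye : y * e = y by rewrite /y mulrBl -scalerAl -!mulrA ee.
have yt : y * t = 0 by rewrite /y mulrBl xt -scalerAl et subrr.
have [r Sr ry] := semiprime_non_nilpotent Sf Sy y0.
pose w := e * r * y.
have Sw : S w by do 2!apply: (sfM Sf) => //.
have yw n : y * w ^+ n = y * (r * y) ^+ n.
  elim: n => // n IH; rewrite exprSr mulrA IH [in RHS]exprSr [RHS]mulrA.
  case: n {IH} => [|n]; first by rewrite !mulr1 /w !mulrA ye.
  by rewrite exprSr !mulrA -(mulrA _ y e) ye.
have wn n : w ^+ n.+1 != 0.
  apply/negP => /eqP wn0; case/negP: (ry n.+1).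
  by rewrite exprS -mulrA -yw wn0 !mulr0.
have [Q [ff f0]] := fitting (sf_algebraic Sf Sw) wn.
have fe : w * horner_alg w Q * e = w * horner_alg w Q.
  by rewrite horner_alg_comm -mulrA /w -(mulrA _ y e) ye.
have ef : e * (w * horner_alg w Q) = w * horner_alg w Q.
  by rewrite mulrA /w !mulrA ee.
case: (eprim _ (sf_horner Sf Q Sw) ff ef fe) => [/eqP|fE]; first by rewrite (negPf f0).
case/negP: t0; rewrite -et -fE horner_alg_comm -mulrA /w -(mulrA _ y t) yt.
by rewrite !mulr0.
Qed.
End ClosedField.

(** * Closures of directed unions of finite-dimensional algebras *)

Section LocallyFiniteDimensional.
Variables (R : realType) (K : closedFieldType) (U : algType K).
Variables (M : set U) (N : U -> R) (I : Type) (F : I -> set U).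
Implicit Types (x y e f r : U) (i j : I).

(* M is a Banach algebra, the closure of a directed union of finite-dimensional
   semiprime subalgebras F i.  It is not assumed to contain the unit of U. *)
Record locally_findim : Prop := LocallyFindim {
  lfD : forall x y, M x -> M y -> M (x + y);
  lfZ : forall k x, M x -> M (k *: x);
  lfM : forall x y, M x -> M y -> M (x * y);
  lf_norm0 : N 0 = 0;
  lf_normN : forall x, N (- x) = N x;
  lf_normD : forall x y, N (x + y) <= N x + N y;
  lf_normM : forall x y, M x -> M y -> N (x * y) <= N x * N y;
  lf_norm_eq0 : forall x, M x -> N x = 0 -> x = 0;
  lf_complete : forall (u : nat -> U) (C : R), (forall k, M (u k)) ->
    (forall k, N (u k.+1 - u k) <= C / 2 ^+ k) ->
    exists2 l, M l & N (u k - l) @[k --> \oo] --> (0 : R);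
  lf_sub : forall i, F i `<=` M;
  lf_semiprime : forall i, semiprime_findim (F i);
  lf_closed : forall i (u : nat -> U) l, (forall k, F i (u k)) -> M l ->
    N (u k - l) @[k --> \oo] --> (0 : R) -> F i l;
  lf_dense : forall i x (eps : R), M x -> 0 < eps ->
    exists j y, [/\ F i `<=` F j, F j y & N (x - y) < eps];
  lf_index : exists i : I, True }.

Hypothesis lf : locally_findim.

Let MN x : M x -> M (- x).
Proof. by move=> Mx; rewrite -scaleN1r; exact: (lfZ lf). Qed.

Let MB x y : M x -> M y -> M (x - y).
Proof. by move=> Mx My; apply: (lfD lf) => //; exact: MN. Qed.

Let M0 : M 0.
Proof. by have [i _] := lf_index lf; apply: (lf_sub lf (i := i));
  exact: (sf0 (lf_semiprime lf i)). Qed.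

Let N_ge0 x : 0 <= N x.
Proof.
have := lf_normD lf x (- x); rewrite subrr (lf_norm0 lf) (lf_normN lf).
by lra.
Qed.

Let NB x y : N (x - y) <= N x + N y.
Proof. by rewrite -(lf_normN lf y); exact: (lf_normD lf). Qed.

Let NC x y : N (x - y) = N (y - x).
Proof. by rewrite -(lf_normN lf) opprB. Qed.

Lemma norm_le_cvg0 x (a : nat -> R) : M x -> (forall k, N x <= a k) ->
  a k @[k --> \oo] --> (0 : R) -> x = 0.
Proof.
move=> Mx xa a0; apply: (lf_norm_eq0 lf) => //; apply/eqP; rewrite eq_le N_ge0 andbT.
rewrite -(cvg_lim _ a0) //; apply: limr_ge; first by apply/cvg_ex; exists 0.
by near=> k.
Unshelve. all: by end_near. Qed.

(** The iterates of [x |-> r + r * x] are the partial sums of the geometric series without its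
    constant term, which need not lie in [M]. *)
Lemma neumann r : M r -> N r <= 2^-1 ->
  exists2 q, M q & (1 - r) * (1 + q) = 1 /\ (1 + q) * (1 - r) = 1.
Proof.
move=> Mr r2; pose s k := iter k (fun x => r + r * x) 0.
have Ms k : M (s k) by elim: k => //= k IH; apply: (lfD lf) => //; exact: (lfM lf).
have sr k : s k * r = r * s k.
  by elim: k => /= [|k IH]; rewrite ?mul0r ?mulr0 // mulrDr mulrDl -mulrA IH.
have [|q Mq sq] := @lf_complete lf s 1 Ms.
  move=> k; rewrite mul1r; elim: k => [|k IH] /=.
    by rewrite mulr0 addr0 subr0 expr0 invr1 (le_trans r2) //; lra.
  have -> : r + r * (r + r * s k) - (r + r * s k) = r * (s k.+1 - s k).
    by rewrite opprD addrACA subrr add0r -mulrBr.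
  apply: (le_trans (lf_normM lf Mr (MB (Ms _) (Ms _)))).
  by rewrite exprS invfM ler_pM.
have sq1 := sq; rewrite -cvg_shiftS /= in sq1.
exists q => //.
have lim0 : N (s k.+1 - q) + N r * N (s k - q) @[k --> \oo] --> (0 : R).
  rewrite -[X in _ --> X]addr0 -[X in _ + X](mulr0 (N r)).
  by apply: cvgD => //; apply: cvgMr.
have e1 : r + r * q - q = 0.
  apply: norm_le_cvg0 lim0 => [|k].
    by apply: MB => //; apply: (lfD lf) => //; exact: (lfM lf).
  have -> : r + r * q - q = s k.+1 - q - r * (s k - q).
    by rewrite /= mulrBr opprB [RHS](AC (3*2) ((1*4*3)*(2*5))) /= subrr addr0.
  apply: (le_trans (NB _ _)); rewrite lerD2l.
  by apply: (lf_normM lf) => //; exact: MB.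
have e2 : r + q * r - q = 0.
  apply: norm_le_cvg0 lim0 => [|k].
    by apply: MB => //; apply: (lfD lf) => //; exact: (lfM lf).
  have -> : r + q * r - q = s k.+1 - q - (s k - q) * r.
    by rewrite /= mulrBl sr opprB [RHS](AC (3*2) ((1*4*3)*(2*5))) /= subrr addr0.
  apply: (le_trans (NB _ _)); rewrite lerD2l mulrC.
  by apply: (lf_normM lf) => //; exact: MB.
split.
  rewrite mulrBl mul1r mulrDr mulr1 -[RHS]subr0 -[in RHS]e1.
  by rewrite opprB addrA.
rewrite mulrBr mulr1 mulrDl mul1r -[RHS]subr0 -[in RHS]e2.
by rewrite opprB addrA.
Qed.

(* Newton's iteration x |-> 3x^2 - 2x^3 squares the defect x^2 - x. *)
Lemma newton_step x : let y := x - (x *+ 2 - 1) * (x * x - x) in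
  let d := x * x - x in y * y - y = d * d * d *+ 4 - d * d *+ 3.
Proof.
(* Only powers of [x] occur, so the identity is proved in the commutative ring [{poly K}] and then
   evaluated at [x]. *)
pose X : {poly K} := 'X.
pose Y := X - (X *+ 2 - 1) * (X * X - X); pose D := X * X - X.
have /(congr1 (horner_alg x)) : Y * Y - Y = D * D * D *+ 4 - D * D *+ 3.
  by rewrite /Y /D; ring.
rewrite /Y /D /X !(rmorphB, rmorphM, rmorphMn, rmorph1) /=.
by rewrite !horner_algX.
Qed.

Lemma lim_idempotent (u : nat -> U) e (C : R) : (forall k, M (u k)) -> M e ->
  (forall k, N (u k) <= C) ->
  N (u k - e) @[k --> \oo] --> (0 : R) ->
  N (u k * u k - u k) @[k --> \oo] --> (0 : R) -> e * e = e.
Proof.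
move=> Mu Me uC ue uu; apply/eqP; rewrite -subr_eq0; apply/eqP.
have lim0 : N (u k * u k - u k) + (C + N e + 1) * N (u k - e) @[k --> \oo] --> (0 : R).
  rewrite -[X in _ --> X]addr0 -[X in _ --> _ + X](mulr0 (C + N e + 1)).
  by apply: cvgD => //; apply: cvgMr.
apply: norm_le_cvg0 lim0 => [|k]; first by apply: MB => //; exact: (lfM lf).
have -> : e * e - e = u k * u k - u k - (u k * (u k - e) + (u k - e) * e - (u k - e)).
  rewrite mulrBr mulrBl [_ - u k * e + _]addrA subrK !opprB.
  by rewrite [RHS](AC (2*(2*2)) ((5*4)*(1*6)*(3*2))) /= !subrr !addr0.
apply: (le_trans (NB _ _)); rewrite lerD2l.
apply: (le_trans (NB _ _)); rewrite (mulrDl (C + N e)) (mulrDl C) mul1r lerD2r.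
apply: (le_trans (lf_normD lf _ _)); rewrite lerD //.
  apply: (le_trans (lf_normM lf _ _)) => //; first exact: MB.
  by rewrite ler_wpM2r.
rewrite mulrC; apply: (lf_normM lf) => //; exact: MB.
Qed.

(** Newton's iteration started at [a] stays in [F i], which is closed. Its convergence is quadratic,
    but halving the defect is enough: below 1/8, the bound [4 N(D)^3 + 3 N(D)^2] is at most
    [7/16 N(D)]. The step from [u k] is at most [2 N(u k) + 1] times the defect, and all steps
    together amount to at most [2 L d <= 1]. So [N(u k) <= N a + 1], which explains the condition
    [2 N a + 3 <= L]. *)
Lemma idempotent_near i a (L d : R) : F i a -> N a *+ 2 + 3 <= L ->
  N (a * a - a) <= d -> d <= 8^-1 -> L * d <= 2^-1 ->
  exists2 e, F i e & e * e = e /\ N (e - a) <= L * d *+ 2.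
Proof.
move=> Fa aL ad d8 Ld.
have d0 : 0 <= d by rewrite (le_trans _ ad).
pose st x := x - (x *+ 2 - 1) * (x * x - x).
have stE x : st x - x = (x * x - x) - (x * (x * x - x) + x * (x * x - x)).
  by rewrite /st addrAC subrr add0r mulrBl mul1r mulr2n mulrDl opprB.
pose u k := iter k st a.
have Sf := lf_semiprime lf i.
have Fst x : F i x -> F i (st x).
  move=> Fx; have Fxx := sfM Sf Fx Fx; have Fd := sfB Sf Fxx Fx.
  rewrite -[st x](subrK x) stE; apply: (sfD Sf) => //; apply: (sfB Sf) => //.
  by apply: (sfD Sf); exact: (sfM Sf).
have Fu k : F i (u k) by elim: k => //= k IH; exact: Fst.
have Mu k : M (u k) := lf_sub lf (Fu k).
have step k : N (u k - a) <= L * d *+ 2 * (1 - (2 ^+ k)^-1) ->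
    N (u k * u k - u k) <= d / 2 ^+ k -> N (u k.+1 - u k) <= L * d / 2 ^+ k.
  move=> ua ud; rewrite /= stE.
  have Mdk : M (u k * u k - u k) by apply: MB => //; exact: (lfM lf).
  have uL : N (u k) *+ 2 + 1 <= L.
    have ua1 : N (u k) <= N a + 1.
      rewrite -[u k](subrK a) (le_trans (lf_normD lf _ _)) // addrC lerD2l.
      apply: (le_trans ua); rewrite -mulr_natr.
      have t0 : 0 <= (2 ^+ k : R)^-1 by rewrite invr_ge0 exprn_ge0.
      have Ld0 : 0 <= L * d by rewrite mulr_ge0 // (le_trans _ aL) // addr_ge0 // mulrn_wge0.
      by nra.
    by move: aL; rewrite !mulr2n; lra.
  rewrite -mulrA; apply: le_trans (ler_pM _ _ uL ud); rewrite ?N_ge0 ?addr_ge0 ?mulrn_wge0 //.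
  apply: (le_trans (NB _ _)); rewrite mulrDl mul1r addrC lerD2r.
  apply: (le_trans (lf_normD lf _ _)); rewrite -mulr2n mulrnAl ler_wMn2r //.
  exact: (lf_normM lf).
have inv k : N (u k - a) <= L * d *+ 2 * (1 - (2 ^+ k)^-1) /\
    N (u k * u k - u k) <= d / 2 ^+ k.
  elim: k => [|k [IH1 IH2]]; first by rewrite /= subrr lf_norm0 // expr0 invr1 subrr mulr0 mulr1.
  split.
    rewrite -[_ - a](subrKA (u k)) (le_trans (lf_normD lf _ _)) //.
    apply: (le_trans (lerD (step _ IH1 IH2) IH1)).
    by rewrite exprS invfM -(mulr_natr (L * d)); move: (L * d) ((2 ^+ k : R)^-1) => s t; lra.
  rewrite [u k.+1]/= newton_step.
  move: IH2; set D := u k * u k - u k => IH2.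
  have MD : M D by apply: MB => //; exact: (lfM lf).
  have dk8 : N D <= 8^-1.
    apply: (le_trans IH2); rewrite (le_trans _ d8) // ler_piMr // invf_le1 ?exprn_gt0 //.
    by rewrite exprn_ege1 // ler1n.
  have NDD : N (D * D) <= N D * N D by exact: (lf_normM lf).
  have NDDD : N (D * D * D) <= N D * N D * N D.
    by apply: (le_trans (lf_normM lf _ _)) => //; [exact: (lfM lf)|rewrite ler_wpM2r].
  apply: (le_trans (NB _ _)).
  have -> : D * D * D *+ 4 = D * D * D + D * D * D + (D * D * D + D * D * D).
    by rewrite -!mulr2n -mulrnA.
  have -> : D * D *+ 3 = D * D + D * D + D * D by rewrite mulrSr mulr2n.
  have n4 y : N (y + y + (y + y)) <= N y * 4.
    by apply: (le_trans (lf_normD lf _ _)); have := lf_normD lf y y; lra.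
  have n3 y : N (y + y + y) <= N y * 3.
    by apply: (le_trans (lf_normD lf _ _)); have := lf_normD lf y y; lra.
  have nn : N D * N D <= N D / 8 by rewrite ler_wpM2l.
  have nnn : N D * N D * N D <= N D / 64.
    apply: le_trans (ler_wpM2r (N_ge0 _) nn) _.
    by rewrite -mulrA [_^-1 * _]mulrC mulrA -subr_ge0; move: nn; set n2 := N D * N D; lra.
  have -> : d / 2 ^+ k.+1 = d / 2 ^+ k / 2 by rewrite exprS invfM mulrCA mulrC.
  have := n4 (D * D * D); have := n3 (D * D); have := N_ge0 D.
  move: IH2 NDD NDDD nn nnn; set t := d / _; set n2 := N D * N D; set n3' := n2 * _.
  lra.
have [e Me ue] := lf_complete lf Mu (fun k => step k (inv k).1 (inv k).2).
exists e; first exact: (lf_closed lf Fu Me ue).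
have geo : d / 2 ^+ k @[k --> \oo] --> (0 : R).
  rewrite (_ : (fun k => d / 2 ^+ k) = geometric d 2^-1).
    by apply: cvg_geometric; rewrite ger0_norm ?invf_lt1 ?ltr1n.
  by apply/funext => k; rewrite /geometric /= exprVn.
have uaL k : N (u k - a) <= L * d *+ 2.
  apply: (le_trans (inv k).1); rewrite ler_piMr ?gerBl ?invr_ge0 ?exprn_ge0 //.
  by rewrite mulrn_wge0 // mulr_ge0 // (le_trans _ aL) // addr_ge0 // mulrn_wge0.
split.
  apply: (lim_idempotent Mu Me _ ue) => [k|].
    rewrite -[u k](subrK a); apply: (le_trans (lf_normD lf _ _)).
    by apply: lerD (uaL k) (lexx (N a)).
  apply: (squeeze_cvgr _ (cvg_cst 0) geo); near=> k; rewrite N_ge0.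
  exact: (inv k).2.
have lim : N (u k - e) + L * d *+ 2 @[k --> \oo] --> L * d *+ 2.
  by rewrite -[X in _ --> X]add0r; apply: cvgD => //; exact: cvg_cst.
rewrite -(cvg_lim _ lim) //; apply: limr_ge; first by apply/cvg_ex; eexists; exact: lim.
near=> k; rewrite -(subrKA (u k)) (le_trans (lf_normD lf _ _)) // NC lerD2l.
exact: uaL.
Unshelve. all: by end_near. Qed.

(** The usual intertwiner of two idempotents is close to 1 when they are close to each other. Its
    distance to 1 is the norm of [(f - e) - 2 e (f - e)], whence the factor [1 + 2 N e] in the
    hypothesis. *)
Lemma near_idempotents_conjugate e f : M e -> M f -> e * e = e -> f * f = f ->
  (1 + N e *+ 2) * N (f - e) <= 2^-1 ->
  exists w w', [/\ M (w - 1), M (w' - 1), w * w' = 1, w' * w = 1 & w * f * w' = e].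
Proof.
move=> Me Mf ee ff ef; pose h := f - e; pose r := h - (e * h + e * h).
have Mh : M h by exact: MB.
have Meh : M (e * h) by exact: (lfM lf).
have Mr : M r by apply: MB => //; exact: (lfD lf).
have [|q Mq [rq qr]] := neumann Mr.
  apply: le_trans ef; rewrite mulrDl mul1r mulrnAl.
  apply: (le_trans (NB _ _)); rewrite lerD2l.
  by apply: (le_trans (lf_normD lf _ _)); rewrite -mulr2n ler_wMn2r // (lf_normM lf).
(* The intertwiner of e and f is 1 - r = e f + (1 - e) (1 - f). *)
exists (1 - r), (1 + q); split=> //.
- by rewrite addrC addKr; exact: MN.
- by rewrite addrC addKr.
have wE : 1 - r = e * f + (1 - e) * (1 - f).
  rewrite /r /h !mulrBr !mulrBl !mul1r !mulr1 ee !opprB.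
  by rewrite !(opprB, opprD, opprK, addrA) subrK [e * f + 1]addrC.
have wf : (1 - r) * f = e * (1 - r).
  have f1 : (1 - f) * f = 0 by rewrite mulrBl mul1r ff subrr.
  have e1 : e * (1 - e) = 0 by rewrite mulrBr mulr1 ee subrr.
  by rewrite wE mulrDl -(mulrA e f) ff -(mulrA _ _ f) f1 mulr0 addr0 mulrDr !mulrA ee e1 mul0r
    addr0.
by rewrite wf -mulrA rq mulr1.
Qed.

(** An approximation of [e] in some [F i] is almost idempotent; it is corrected to an idempotent of
    [F i], which is then close enough to [e] to be conjugate to it. *)
Lemma idempotent_conjugate e : M e -> e * e = e -> exists i f w w',
  [/\ F i f, f * f = f & [/\ M (w - 1), M (w' - 1), w * w' = 1, w' * w = 1 & w * f * w' = e]].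
Proof.
move=> Me ee; pose L := N e *+ 2 + 5.
have L5 : 5 <= L by rewrite lerDr mulrn_wge0.
pose t := L^-1; have t0 : 0 < t by rewrite invr_gt0 (lt_le_trans _ L5).
have Lt : L * t = 1 by rewrite divff // gt_eqF // (lt_le_trans _ L5).
have t5 : t <= 5^-1 by rewrite lef_pV2 ?posrE // (lt_le_trans _ L5).
(* Each stage costs a factor [L]: the defect of [a] is at most [L * eps], the correction moves [a]
   by at most [2 L^2 eps], and conjugation requires [L] times the total distance to be at most 1/2.
   Hence the cube of [t = L^-1]. *)
pose eps := t * t * t / 64; have eps0 : 0 < eps by rewrite !mulr_gt0.
have Leps : L * eps = t * t / 64 by rewrite /eps !mulrA Lt mul1r.
have LLeps : L * (L * eps) = t / 64 by rewrite Leps !mulrA Lt mul1r.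
have tt : t * t <= t / 5 by rewrite ler_wpM2l // ltW.
have ttt : t * t * t <= t / 25.
  by apply: le_trans (ler_wpM2r (ltW t0) tt) _; move: tt; rewrite mulrAC; set s := t * t; lra.
have [i0 _] := lf_index lf.
have [i [a [_ Fa ea]]] := lf_dense lf i0 Me eps0.
have Ma := lf_sub lf Fa.
have aL : N a *+ 2 + 3 <= L.
  have : N a <= N e + N (e - a) by rewrite -{1}[a](subKr e) (le_trans (NB _ _)).
  by move: ea ttt t5; rewrite /L /eps !mulr2n; lra.
have da : N (a * a - a) <= L * eps.
  have Mea : M (e - a) by exact: MB.
  have -> : a * a - a = (e - a) - ((e - a) * a + e * (e - a)).
    by rewrite mulrBl mulrBr ee [_ + (e - _)]addrC subrKA opprB [RHS]addrC subrKA.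
  apply: (le_trans (NB _ _)).
  have : N ((e - a) * a + e * (e - a)) <= N (e - a) * (N a + N e).
    apply: (le_trans (lf_normD lf _ _)); rewrite [leRHS]mulrDr [X in _ <= _ + X]mulrC.
    by apply: lerD; exact: (lf_normM lf).
  have : N (e - a) * (N a + N e + 1) <= eps * L.
    apply: ler_pM => //; rewrite ?addr_ge0 //; first exact: ltW.
    by move: aL (N_ge0 e); rewrite /L !mulr2n; lra.
  by rewrite mulrDr mulr1 [L * _]mulrC; lra.
have [||f Ff [ff fa]] := idempotent_near Fa aL da.
- by rewrite Leps; lra.
- by rewrite LLeps; lra.
have Mf := lf_sub lf Ff.
have [|w [w' [? ? ? ? ?]]] := near_idempotents_conjugate Me Mf ee ff.
  have fe : N (f - e) <= t / 16.
    rewrite -(subrKA a) (le_trans (lf_normD lf _ _)) //.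
    move: fa ea; rewrite LLeps NC /eps mulr2n => fa ea.
    by rewrite [N (a - e)]NC; lra.
  apply: (@le_trans _ _ (L * (t / 16))); last by rewrite mulrA Lt; lra.
  apply: ler_pM => //; first by rewrite addr_ge0 // mulrn_wge0.
  by rewrite /L; lra.
by exists i, f, w, w'.
Qed.

Lemma Mconj w w' x : M (w - 1) -> M (w' - 1) -> M x -> M (w * x * w').
Proof.
move=> Mw Mw' Mx; have Mwx : M (w * x).
  rewrite -(subrK 1 w) mulrDl mul1r; apply: (lfD lf) => //; exact: (lfM lf).
by rewrite -(subrK 1 w') mulrDr mulr1; apply: (lfD lf) => //; exact: (lfM lf).
Qed.

(** After conjugation, [e] becomes some [p] in [F i]. It is primitive in every [F j] containing
    [F i], so the corner of [p] in [F j] consists of multiples of [p] and lies in [F i]. Hence every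
    element of the corner of [p] in [M] is a limit of elements of [F i], and belongs to [F i]
    because [F i] is closed. *)
Lemma lf_primitive_scalar e : M e -> e != 0 -> e * e = e ->
  (forall f, M f -> f * f = f -> e * f = f -> f * e = f -> f = 0 \/ f = e) ->
  forall x, M x -> exists l, e * x * e = l *: e.
Proof.
move=> Me e0 ee eprim x Mx.
have [i [p [w [w' [Fp pp [Mw Mw' ww' w'w wpw']]]]]] := idempotent_conjugate Me ee.
have p0 : p != 0.
  by apply: contra_neq e0 => p0; rewrite -wpw' p0 mulr0 mul0r.
have conjM a b : w * (a * b) * w' = (w * a * w') * (w * b * w').
  by rewrite -!mulrA; congr (_ * (_ * _)); rewrite mulrA w'w mul1r.
have conjK a b : w * a * w' = w * b * w' -> a = b.
  move=> /(congr1 (fun u => w' * u * w)); rewrite !mulrA w'w !mul1r.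
  by rewrite -!mulrA w'w !mulr1.
have pprim f : M f -> f * f = f -> p * f = f -> f * p = f -> f = 0 \/ f = p.
  move=> Mf ff pf fp; have Mf' := Mconj Mw Mw' Mf.
  have [|||f0|f1] := eprim _ Mf'; try by rewrite -?wpw' -conjM ?ff ?pf ?fp.
    by left; apply: conjK; rewrite f0 mulr0 mul0r.
  by right; apply: conjK; rewrite f1 wpw'.
have Fprim j : F i `<=` F j -> forall y, F j y -> exists l, p * y * p = l *: p.
  move=> ij; apply: (primitive_corner_scalar (lf_semiprime lf j)) => //; first exact: ij.
  by move=> f Ff; apply: pprim; exact: (lf_sub lf Ff).
pose x' := w' * x * w; have Mx' : M x' by exact: Mconj.
have Mp := lf_sub lf Fp.
have /choice[u uP] : forall k, exists u, F i u /\
    N (u - p * x' * p) <= (N p * N p) / k.+1%:R.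
  move=> k.
  have k0 : 0 < (k.+1%:R : R)^-1 by rewrite invr_gt0.
  have [j [y [ij Fy xy]]] := lf_dense lf i Mx' k0.
  exists (p * y * p); split.
    by have [l ->] := Fprim j ij y Fy; exact: (sfZ (lf_semiprime lf i)).
  have My := lf_sub lf Fy; have Mxy : M (y - x') by exact: MB.
  rewrite -mulrBl -mulrBr; have Mpxy : M (p * (y - x')) by exact: (lfM lf).
  rewrite NC in xy; apply: (le_trans (lf_normM lf Mpxy Mp)); rewrite mulrAC.
  apply: ler_pM => //; apply: (le_trans (lf_normM lf Mp Mxy)).
  by rewrite ler_wpM2l // ltW.
have Fx : F i (p * x' * p).
  apply: (lf_closed lf (u := u)) => [k||]; first by case: (uP k).
    by apply: (lfM lf) => //; exact: (lfM lf).
  have lim : (N p * N p) / k.+1%:R @[k --> \oo] --> (0 : R).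
    rewrite -[X in _ --> X](mulr0 (N p * N p)); apply: cvgMr; exact: cvg_harmonic.
  by apply: (squeeze_cvgr _ (cvg_cst 0) lim); near=> k; rewrite N_ge0; case: (uP k).
have [//|l lE] := Fprim i _ _ Fx; exists l; rewrite -wpw' -[x]mul1r -ww'.
rewrite -[w * w' * x]mulr1 -ww' [w * w' * x * (w * w')](_ : _ = w * x' * w').
  rewrite -!conjM !mulrA scalerAl scalerAr; congr (_ * _); rewrite -!mulrA; congr (w * _).
  by rewrite -lE !mulrA pp -!mulrA pp.
by rewrite /x' !mulrA.
Unshelve. all: by end_near. Qed.

(* An element close to x in some 1 + F i is right invertible and algebraic, hence
   invertible. *)
Lemma lf_dedekind x y : M (x - 1) -> M (y - 1) -> x * y = 1 -> y * x = 1.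
Proof.
move=> Mx My xy; pose x0 := x - 1; pose y0 := y - 1.
have [i0 _] := lf_index lf.
(* For [a] within [eps] of [x - 1], the element [(a + 1) * y] differs from 1 by [r], and
   [N r <= N (x0 - a) * (1 + N y0) <= 1/2]. *)
pose eps := ((1 + N y0) * 2)^-1; have y1 : 0 < 1 + N y0 by rewrite ltr_pwDl.
have eps0 : 0 < eps by rewrite invr_gt0 mulr_gt0.
have [i [a [_ Fa xa]]] := lf_dense lf i0 Mx eps0; have Ma := lf_sub lf Fa.
pose r := (x0 - a) * y; have Mxa : M (x0 - a) by exact: MB.
have rE : r = (x0 - a) + (x0 - a) * y0 by rewrite /y0 [(x0 - a) * _]mulrBr mulr1 addrC subrK.
have Mr : M r by rewrite rE; apply: (lfD lf) => //; exact: (lfM lf).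
have [|q Mq [rq _]] := neumann Mr.
  rewrite rE (le_trans (lf_normD lf _ _)) //.
  apply: (@le_trans _ _ (N (x0 - a) * (1 + N y0))).
    by rewrite [leRHS]mulrDr mulr1 lerD2l (lf_normM lf).
  apply: (@le_trans _ _ (eps * (1 + N y0))); first by rewrite ler_wpM2r ?ltW.
  by rewrite /eps invfM mulrAC mulVf ?mul1r // gt_eqF.
have a1y : (a + 1 *: 1) * y = 1 - r.
  by rewrite /r mulrBl /x0 mulrBl xy mul1r scale1r mulrDl mul1r opprB opprB [RHS]addrC -addrA subrK.
have alg := algebraic_addC 1 (sf_algebraic (lf_semiprime lf i) Fa).
have [|b [ab ba]] := @algebraic_rinv _ _ _ (y * (1 + q)) alg.
  by rewrite mulrA a1y rq.
have yb : y * (1 + q) = b.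
  by rewrite -[LHS]mul1r -{1}ba -mulrA (mulrA _ y) a1y rq mulr1.
have xE : x = (1 + q) * (a + 1 *: 1).
  by rewrite -[LHS]mulr1 -{1}ba -yb !mulrA xy mul1r.
by rewrite xE mulrA yb ba.
Qed.
End LocallyFiniteDimensional.

(** * Idempotents and dimensions *)

Section DimensionTheory.
Variables (K : fieldType) (U : algType K) (M : set U) (n : nat).
Variable cl : U -> 'rV[int]_n.
Implicit Types (a b c e f k m p q s x y z : U).

Definition idem e : Prop := M e /\ e * e = e.

Definition eqv e f : Prop := exists x y, [/\ M x, M y, e = x * y & f = y * x].

Definition orth e f : Prop := e * f = 0 /\ f * e = 0.

(** For idempotents, [a M s = 0] says that there is no nonzero homomorphism between the modules they
    define. For [a] primitive it expresses that [a] does not occur in [s]. *)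
Definition hom0 a s : Prop := forall m, M m -> a * m * s = 0.

(* In the application, M consists of the finite matrices over A, and cl e is the
   class of e in K_0(A) = Z^n; dt_stable unfolds the equality of two classes in
   the Grothendieck group. *)
Record dimension_theory : Prop := DimensionTheory {
  dtD : forall x y, M x -> M y -> M (x + y);
  dtZ : forall l x, M x -> M (l *: x);
  dtMl : forall x y, M x -> M (x * y);
  dtMr : forall x y, M y -> M (x * y);
  dt_semiprime : forall x, M x -> (forall y, M y -> x * y * x = 0) -> x = 0;
  dt_dedekind : forall x y, M (x - 1) -> M (y - 1) -> x * y = 1 -> y * x = 1;
  dt_scalar : forall e, idem e -> e != 0 ->
    (forall f, idem f -> e * f = f -> f * e = f -> f = 0 \/ f = e) ->
    forall x, M x -> exists l, e * x * e = l *: e;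
  dt_eqv : forall e f, idem e -> idem f -> eqv e f -> cl e = cl f;
  dt_add : forall e f, idem e -> idem f -> orth e f -> cl (e + f) = cl e + cl f;
  dt_ge0 : forall e i, idem e -> 0 <= cl e ord0 i;
  dt_surj : forall g : 'rV_n, (forall i, 0 <= g ord0 i) -> exists2 e, idem e & cl e = g;
  dt_stable : forall p a c, idem p -> idem a -> idem c -> cl p = cl a + cl c ->
    exists p' a' c' k, [/\ idem p' /\ idem a', idem c' /\ idem k,
      [/\ eqv p' p, eqv a' a & eqv c' c],
      [/\ orth p' k, orth a' c', orth a' k & orth c' k] &
      eqv (p' + k) (a' + c' + k)] }.

Hypothesis dt : dimension_theory.

Let MB x y : M x -> M y -> M (x - y).
Proof. by move=> Mx My; rewrite -scaleN1r; apply: (dtD dt) => //; exact: (dtZ dt). Qed.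

Let M0 x : M x -> M 0.
Proof. by move=> Mx; rewrite -(scale0r x); exact: (dtZ dt). Qed.

Lemma idem_0 : idem 0.
Proof.
have [|e [Me _] _] := dt_surj dt (g := 0); first by move=> i; rewrite mxE.
by split; [exact: (M0 Me)|rewrite mulr0].
Qed.

Lemma orth_idemD e f : idem e -> idem f -> orth e f -> idem (e + f).
Proof.
move=> [Me ee] [Mf ff] [ef fe]; split; first exact: (dtD dt).
by rewrite mulrDl !mulrDr ee ff ef fe addr0 add0r.
Qed.

Lemma idemB e f : idem e -> idem f -> e * f = f -> f * e = f ->
  idem (e - f) /\ orth f (e - f).
Proof.
move=> [Me ee] [Mf ff] ef fe; split; last first.
  by split; rewrite ?mulrBr ?mulrBl ?ef ?fe ff subrr.
by split; [exact: MB|rewrite mulrBl !mulrBr ee ef fe ff subrr subr0].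
Qed.

Lemma cl0 : cl 0 = 0.
Proof.
have := dt_add dt idem_0 idem_0; rewrite /orth mulr0 addr0 => /(_ (conj erefl erefl)).
by move=> /eqP; rewrite -subr_eq subrr eq_sym => /eqP.
Qed.

Lemma cl_sub e f : idem e -> idem f -> e * f = f -> f * e = f ->
  cl e = cl f + cl (e - f).
Proof.
move=> ie jf ef fe; have [id od] := idemB ie jf ef fe.
by rewrite -(dt_add dt) // subrKC.
Qed.

Lemma orth_sym e f : orth e f -> orth f e.
Proof. by case. Qed.

Lemma orth_sub e k p : orth e k -> k * p = p -> p * k = p -> orth e p.
Proof. by move=> [ek ke] kp pk; split; [rewrite -kp mulrA ek mul0r|rewrite -pk -mulrA ke mulr0].
Qed.

Lemma orthD e f k : orth e k -> orth f k -> orth (e + f) k.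
Proof. by move=> [ek ke] [fk kf]; split; rewrite ?mulrDl ?mulrDr ?ek ?fk ?ke ?kf addr0. Qed.

Lemma eqv_sym e f : eqv e f -> eqv f e.
Proof. by move=> [x [y [? ? ? ?]]]; exists y, x. Qed.

(** If [z = s * m * a], then [z * y * z] contains the factor [a * y * s], so semiprimeness gives
    [z = 0]. *)
Lemma hom0_sym a s : M a -> M s -> hom0 a s -> hom0 s a.
Proof.
move=> Ma Ms as0 m Mm; apply: (dt_semiprime dt) => [|y My]; first exact: (dtMr dt).
have -> : s * m * a * y * (s * m * a) = s * m * (a * y * s) * m * a by rewrite !mulrA.
by rewrite as0 // mulr0 !mul0r.
Qed.

Lemma eqv_hom0l a b s : M a -> idem a -> eqv a b -> hom0 b s -> hom0 a s.
Proof.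
move=> Ma [_ aa] [x [y [Mx My ax bx]]] bs m Mm.
have -> : a * m * s = x * (b * (y * m) * s).
  by rewrite -aa bx {1 2}ax !mulrA.
by rewrite bs ?mulr0 //; exact: (dtMr dt).
Qed.

Lemma eqv0 a : idem a -> eqv a 0 -> a = 0.
Proof.
move=> [_ aa] [x [y [_ _ ax yx]]].
by rewrite -aa ax mulrA -(mulrA x) -yx mulr0 mul0r.
Qed.

Lemma cl_eq0 a : idem a -> cl a = 0 -> a = 0.
Proof.
move=> ia a0; have [|p' [a' [c' [k]]]] := @dt_stable dt 0 a 0 idem_0 ia idem_0.
  by rewrite a0 cl0 addr0.
move=> [[ip' ia'] [ic' ik] [p0 aa' c0] [pk ac ak ck] pkack].
move: pkack; rewrite (eqv0 ip' p0) (eqv0 ic' c0) add0r addr0.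
move=> /eqv_sym[x [y [Mx My ex kx]]].
have [e eD] : exists e, e = a' + k by exists (a' + k).
have [Me ee] : idem e by rewrite eD; exact: orth_idemD.
rewrite -eD in ex.
have [[Mk kk] [ak0 ka0]] := (ik, ak).
have ke : k * e = k by rewrite eD mulrDr ka0 add0r.
have ek : e * k = k by rewrite eD mulrDl ak0 add0r.
have exkye : e * x * k * (k * y * e) = e.
  have -> : e * x * k * (k * y * e) = e * (x * (k * k) * y) * e by rewrite !mulrA.
  have -> : x * (k * k) * y = e by rewrite kk kx mulrA -ex -mulrA -ex ee.
  by rewrite !ee.
have kyexk : k * y * e * (e * x * k) = k.
  have -> : k * y * e * (e * x * k) = k * (y * (e * e) * x) * k by rewrite !mulrA.
  have -> : y * (e * e) * x = k by rewrite ee ex mulrA -kx -mulrA -kx kk.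
  by rewrite !kk.
have [E ED] : exists E, E = 1 - e by exists (1 - e).
have eE : e * E = 0 by rewrite ED mulrBr mulr1 ee subrr.
have Ee : E * e = 0 by rewrite ED mulrBl mul1r ee subrr.
have EE : E * E = E by rewrite {2}ED mulrBr mulr1 Ee subr0.
have kE : k * E = 0 by rewrite ED mulrBr mulr1 ke subrr.
have Ek : E * k = 0 by rewrite ED mulrBl mul1r ek subrr.
have : (k * y * e + E) * (e * x * k + E) = 1.
  apply: (dt_dedekind dt).
  - rewrite ED -addrA [1 - e - 1]addrAC subrr add0r; apply: MB => //.
    by apply: (dtMr dt).
  - rewrite ED -addrA [1 - e - 1]addrAC subrr add0r; apply: MB => //.
    by apply: (dtMr dt).
  rewrite mulrDl !mulrDr exkye EE -(mulrA _ k E) kE mulr0 addr0.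
  by rewrite !mulrA Ek !mul0r add0r ED subrKC.
rewrite mulrDl !mulrDr kyexk EE -(mulrA _ e E) eE mulr0 addr0.
rewrite !mulrA Ee !mul0r add0r ED eD.
rewrite [a' + k]addrC opprD (addrA 1) addrA subrKC => /eqP.
rewrite subr_eq addrC -subr_eq subrr eq_sym => /eqP a'0.
by apply: eqv0 ia _; apply: eqv_sym; rewrite -a'0.
Qed.

Lemma cl_nz a : idem a -> a != 0 -> cl a != 0.
Proof. by move=> ia; apply: contra_neq => /(cl_eq0 ia). Qed.

(** * Primitive idempotents and what occurs in an idempotent *)

Definition prim a : Prop := [/\ idem a, a != 0 & forall x, M x -> exists l, a * x * a = l *: a].

(** Semiprimeness provides a nonzero [z = a * m * k] and a [y] with [z * y * z] nonzero. The corner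
    of [a] being scalar, a multiple [v] of [k * y * a] satisfies [z * v = a], and [v * z] is the
    copy of [a] below [k]. *)
Lemma sub_idem a k : prim a -> idem k -> ~ hom0 a k ->
  exists q, [/\ idem q, eqv q a, k * q = q & q * k = q].
Proof.
move=> [[Ma aa] a0 asc] [Mk kk] ak.
have [m Mm amk] : exists2 m, M m & a * m * k <> 0.
  by apply: contrapT => h; apply: ak => m Mm; apply: contrapT => amk; apply: h; exists m.
set z := a * m * k in amk; have Mz : M z by exact: (dtMr dt).
have az : a * z = z by rewrite /z !mulrA aa.
have zk : z * k = z by rewrite /z -!mulrA kk.
clearbody z.
have [y My zyz] : exists2 y, M y & z * y * z <> 0.
  apply: contrapT => h; apply: amk; apply: (dt_semiprime dt) => // y My.
  by apply: contrapT => zyz; apply: h; exists y.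
have [|l lE] := asc (z * (k * y)); first exact: (dtMl dt).
have l0 : l != 0.
  apply/eqP => l0; apply: zyz.
  have -> : z * y * z = a * (z * (k * y)) * a * z.
    by rewrite !mulrA az zk -(mulrA _ a z) az.
  by rewrite lE l0 scale0r mul0r.
pose v := l^-1 *: (k * y * a).
have Mv : M v by apply: (dtZ dt); apply: (dtMr dt).
have zv : z * v = a.
  rewrite /v -scalerAr mulrA -{1}az -(mulrA a z) lE scalerA mulVf ?scale1r //.
have va : v * a = v by rewrite /v -scalerAl -!mulrA aa.
have kv : k * v = v by rewrite /v -scalerAr !mulrA kk.
exists (v * z); split.
- split; first exact: (dtMl dt).
  by rewrite mulrA -(mulrA v) zv va.
- by exists v, z.
- by rewrite mulrA kv.
- by rewrite -mulrA zk.
Qed.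

Lemma sub_idem_split a k : prim a -> idem k -> ~ hom0 a k ->
  exists b p, [/\ idem b, idem p, orth b p, k = b + p & eqv b a].
Proof.
move=> pa ik ak; have [q [iq qa kq qk]] := sub_idem pa ik ak.
have [ip op] := idemB ik iq kq qk.
by exists q, (k - q); split=> //; rewrite subrKC.
Qed.

Definition size_cl (e : U) : nat := (\sum_i `|cl e ord0 i|)%N.

Lemma size_clD e f : idem e -> idem f -> orth e f -> size_cl (e + f) = (size_cl e + size_cl f)%N.
Proof.
move=> ie jf ef; rewrite /size_cl dt_add // -big_split; apply: eq_bigr => i _ /=.
rewrite mxE; move: (dt_ge0 dt i ie) (dt_ge0 dt i jf); move: (cl e _ _) (cl f _ _) => u v; lia.
Qed.

Lemma size_cl_gt0 e : idem e -> e != 0 -> (0 < size_cl e)%N.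
Proof.
move=> ie e0; rewrite lt0n; apply: contra (cl_nz ie e0) => /eqP.
rewrite /size_cl => /eqP; rewrite sum_nat_eq0 => /forallP s0.
by apply/eqP/rowP => i; rewrite [RHS]mxE; move: (s0 i); rewrite /= absz_eq0 => /eqP.
Qed.

(** Satisfied by every sum of copies of [a], and stated without counting them: whatever does not
    contain [a] has nothing in common with [p]. *)
Definition isotypic a p : Prop := forall s, M s -> hom0 a s -> hom0 p s.

Lemma eqv_cl_nz a b : idem a -> idem b -> eqv a b -> a != 0 -> b != 0.
Proof.
move=> ia ib ab; apply: contra_neq => b0; apply: (eqv0 ia); by rewrite -b0.
Qed.

(** Copies of [a] are split off from [k] as long as [a] occurs in it. Each has a nonzero class, so
    [size_cl] decreases. *)
Lemma isotypic_split a k : prim a -> idem k ->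
  exists p s, [/\ idem p /\ idem s, orth p s, k = p + s, isotypic a p & hom0 a s].
Proof.
move=> pa; have [ia a0 _] := pa; have [Ma aa] := ia.
have [N] := ubnP (size_cl k); elim: N k => // N IH k kN ik.
have [ak|ak] := pselect (hom0 a k).
  exists 0, k; split=> //; first by split=> //; exact: idem_0.
  - by split; rewrite ?mulr0 ?mul0r.
  - by rewrite add0r.
  - by move=> s _ _ m _; rewrite !mul0r.
have [b [k1 [ib ik1 bk kE ba]]] := sub_idem_split pa ik ak.
have b0 : b != 0 := eqv_cl_nz ia ib (eqv_sym ba) a0.
have [|p [s [[ip iss] ps k1E ap as0]]] := IH k1 _ ik1.
  by move: kN (size_cl_gt0 ib b0); rewrite kE size_clD //; lia.
have [bk1 k1b] := bk; have [[[[Mp pp] [Ms ss]] [psz spz]] [Mb bb]] := (ip, iss, ps, ib).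
have k1p : k1 * p = p by rewrite k1E mulrDl pp spz addr0.
have pk1 : p * k1 = p by rewrite k1E mulrDr pp psz addr0.
have k1s : k1 * s = s by rewrite k1E mulrDl ss psz add0r.
have sk1 : s * k1 = s by rewrite k1E mulrDr ss spz add0r.
have bp : orth b p by split; [rewrite -k1p mulrA bk1 mul0r|rewrite -pk1 -mulrA k1b mulr0].
have bs : orth b s by split; [rewrite -k1s mulrA bk1 mul0r|rewrite -sk1 -mulrA k1b mulr0].
exists (b + p), s; split=> //.
- by split=> //; exact: orth_idemD.
- by split; rewrite ?mulrDl ?mulrDr ?bs.1 ?bs.2 ?psz ?spz addr0.
- by rewrite kE k1E addrA.
- move=> t Mt at0 m Mm; rewrite !mulrDl (ap _ Mt at0) // addr0.
  exact: (eqv_hom0l Mb ib ba at0).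
Qed.

(* The corners P0 x P1 and P1 y P0 of x and y are inverse to each other because
   nothing passes between P0, P1 and T0, T1. *)
Lemma eqv_cancel P0 P1 T0 T1 x y : idem P0 -> idem P1 -> M T0 -> M T1 ->
  M x -> M y -> P0 + T0 = x * y -> P1 + T1 = y * x ->
  hom0 P0 T0 -> hom0 P0 T1 -> hom0 P1 T0 -> hom0 P1 T1 -> eqv P0 P1.
Proof.
move=> [MP0 PP0] [MP1 PP1] MT0 MT1 Mx My ex fx h00 h01 h10 h11.
have absorb P T : idem P -> M T -> hom0 P T -> (P + T) * P = P.
  move=> [MP PP] MT PT; rewrite mulrDl PP; have := hom0_sym MP MT PT MP.
  by rewrite -mulrA PP => ->; rewrite addr0.
exists (P0 * x * P1), (P1 * y * P0); split; do ?exact: (dtMr dt).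
- have -> : P0 * x * P1 * (P1 * y * P0) = P0 * x * (P1 * P1) * y * P0 by rewrite !mulrA.
  have -> : P1 * P1 = y * x - T1 by rewrite PP1 -fx addrK.
  rewrite mulrBr h01 // subr0 -!mulrA (mulrA x y) -ex (mulrA x y) -ex.
  by rewrite !absorb.
- have -> : P1 * y * P0 * (P0 * x * P1) = P1 * y * (P0 * P0) * x * P1 by rewrite !mulrA.
  have -> : P0 * P0 = x * y - T0 by rewrite PP0 -ex addrK.
  rewrite mulrBr h10 // subr0 -!mulrA (mulrA y x) -fx (mulrA y x) -fx.
  by rewrite !absorb.
Qed.

(** Suppose that [a] does not occur in [p]. In the stable equivalence between [p' + k] and
    [a' + c' + k], split [k] and [c'] into an [a]-isotypic part and a rest. The rests can be
    cancelled, and [P] becomes equivalent to [a' + P2 + P]. Hence [cl a' + cl P2 = 0], which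
    positivity forbids because [cl a] is nonzero. *)
Lemma hom0_below a p c : prim a -> idem p -> idem c -> cl p = cl a + cl c -> ~ hom0 a p.
Proof.
move=> pa ip ic pac ap; have [ia a0 _] := pa.
have [p' [a' [c' [k]]]] := dt_stable dt ip ia ic pac.
move=> [[ip' ia'] [ic' ik] [pp' aa' cc'] [pk ac ak ck] [x [y [Mx My ex fx]]]].
have [P [S [[iP iS] PS kE aP aS]]] := isotypic_split pa ik.
have [P2 [S2 [[iP2 iS2] PS2 cE aP2 aS2]]] := isotypic_split pa ic'.
have [[[Ma aid] [Mp' p'id]] [Ma' a'id]] := (ia, ip', ia').
have [[[[MP PP] [MS SS]] [MP2 PP2]] [MS2 SS2]] := (iP, iS, iP2, iS2).
have ap' : hom0 a p'.
  apply: hom0_sym => //; apply: (eqv_hom0l Mp' ip' pp').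
  by apply: hom0_sym => //; case: ip.
have iso_a' : isotypic a a' by move=> s Ms as0; exact: (eqv_hom0l Ma' ia' aa' as0).
have aT0 : hom0 a (p' + S) by move=> m Mm; rewrite mulrDr ap' // aS // addr0.
have aT1 : hom0 a (S2 + S) by move=> m Mm; rewrite mulrDr aS2 // aS // addr0.
have MT0 : M (p' + S) by exact: (dtD dt).
have MT1 : M (S2 + S) by exact: (dtD dt).
have kP : k * P = P by rewrite kE mulrDl PP PS.2 addr0.
have Pk : P * k = P by rewrite kE mulrDr PP PS.1 addr0.
have cP2 : c' * P2 = P2 by rewrite cE mulrDl PP2 PS2.2 addr0.
have P2c : P2 * c' = P2 by rewrite cE mulrDr PP2 PS2.1 addr0.
have o1 : orth a' P2 by exact: orth_sub ac cP2 P2c.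
have o2 : orth (a' + P2) P.
  apply: orthD; first exact: orth_sub ak kP Pk.
  by apply: orth_sub _ kP Pk; apply/orth_sym/(orth_sub _ cP2 P2c)/orth_sym.
have iaP2 := orth_idemD ia' iP2 o1.
have iso1 : isotypic a (a' + P2 + P).
  by move=> s Ms as0 m Mm; rewrite !mulrDl iso_a' ?aP2 ?aP // !addr0.
have : eqv P (a' + P2 + P).
  apply: (eqv_cancel (T0 := p' + S) (T1 := S2 + S) iP (orth_idemD iaP2 iP o2) MT0 MT1 Mx My).
  - by rewrite -ex kE addrCA.
  - by rewrite -fx kE cE [LHS](AC (3*2) ((1*(2*4))*(3*5))).
  - exact: aP.
  - exact: aP.
  - exact: iso1.
  - exact: iso1.
move=> /(dt_eqv dt iP (orth_idemD iaP2 iP o2)).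
rewrite (dt_add dt iaP2 iP o2) => /eqP; rewrite -subr_eq subrr eq_sym.
rewrite (dt_add dt ia' iP2 o1) => /eqP aP20.
have /eqP : cl a = 0; last by apply/negP; exact: cl_nz.
rewrite -(dt_eqv dt ia' ia aa'); apply/rowP => i.
have := congr1 (fun g : 'rV_n => g ord0 i) aP20; rewrite !mxE.
move: (dt_ge0 dt i ia') (dt_ge0 dt i iP2); move: (cl _ _ _) (cl _ _ _) => u v; lia.
Qed.

Lemma hom0_le a p (g : 'rV_n) : prim a -> idem p -> cl p = cl a + g ->
  (forall i, 0 <= g ord0 i) -> ~ hom0 a p.
Proof.
by move=> pa ip pE g0; have [c ic cg] := dt_surj dt g0; apply: (hom0_below pa ip ic); rewrite cg.
Qed.

(** An idempotent below [a] splits [cl a] into two nonnegative parts. One of them vanishes, and so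
    does the idempotent of that class. *)
Lemma prim_of_cl a : idem a -> cl a != 0 ->
  (forall g h : 'rV_n, (forall i, 0 <= g ord0 i) -> (forall i, 0 <= h ord0 i) ->
    cl a = g + h -> g = 0 \/ h = 0) -> prim a.
Proof.
move=> ia ca atom; have a0 : a != 0 by apply: contra_neq ca => ->; exact: cl0.
split=> //; apply: (dt_scalar dt) => // f jf af fa.
have [id od] := idemB ia jf af fa.
case: (atom _ _ (fun i => dt_ge0 dt i jf) (fun i => dt_ge0 dt i id) (cl_sub ia jf af fa)).
  by left; exact: cl_eq0.
by move/(cl_eq0 id)/eqP; rewrite subr_eq0 => /eqP->; right.
Qed.

Lemma prim_sub b q : prim b -> idem q -> q != 0 -> b * q = q -> q * b = q -> q = b.
Proof.
move=> [[_ bb] b0 bsc] [Mq qq] q0 bq qb; have [l] := bsc q Mq; rewrite bq qb => ql.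
move: qq q0; rewrite ql -scalerAr -scalerAl bb => /eqP.
rewrite scalerA -subr_eq0 -scalerBl scaler_eq0 (negPf b0) orbF.
rewrite -[X in _ - X]mulr1 -mulrBr mulf_eq0 subr_eq0 => /orP[/eqP->|/eqP->].
  by rewrite scale0r eqxx.
by rewrite scale1r.
Qed.

Lemma prim_hom_eqv a b : prim a -> prim b -> ~ hom0 a b -> eqv b a.
Proof.
move=> pa pb ab; have [ib _ _] := pb; have [ia a0 _] := pa.
have [q [iq qa bq qb]] := sub_idem pa ib ab.
by rewrite -(prim_sub pb iq _ bq qb) //; exact: eqv_cl_nz (eqv_sym qa) a0.
Qed.

(** The hypotheses on [q] and [c] make them orthogonal, so [q] lies below the primitive [b]. This
    uniqueness turns statements about classes into equalities of idempotents. *)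
Lemma prim_unique_sub b c q : prim b -> idem c -> idem q -> q != 0 -> orth b c ->
  (b + c) * q = q -> q * (b + c) = q -> hom0 q c -> hom0 c q -> q = b.
Proof.
move=> pb [Mc cc] iq q0 [bc cb] eq qe qc cq; have [Mq qq] := iq.
apply: prim_sub => //.
  have := cq c Mc; rewrite cc => cq0.
  by rewrite -[RHS]eq mulrDl cq0 addr0.
have := qc q Mq; rewrite qq => qc0.
by rewrite -[RHS]qe mulrDr qc0 addr0.
Qed.

Lemma prim_hom0 a b : prim a -> prim b -> cl a != cl b -> hom0 a b.
Proof.
move=> pa pb ab; apply: contrapT => /(prim_hom_eqv pa pb) ba; case/negP: ab.
by apply/eqP/esym/(dt_eqv dt); [case: pb|case: pa|].
Qed.

Lemma cl_split p a (g : 'rV_n) : prim a -> idem p -> (forall i, 0 <= g ord0 i) ->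
  cl p = cl a + g -> exists b c, [/\ idem b, idem c, orth b c, p = b + c &
    cl b = cl a /\ cl c = g].
Proof.
move=> pa ip g0 pE; have [ia _ _] := pa.
have [b [c [ib ic bc pbc ba]]] := sub_idem_split pa ip (hom0_le pa ip pE g0).
exists b, c; split=> //; have cb := dt_eqv dt ib ia ba; split=> //.
by apply: (addrI (cl a)); rewrite -pE pbc (dt_add dt) // cb.
Qed.

Lemma not_hom0_cl a k : prim a -> idem k -> ~ hom0 a k ->
  exists2 g : 'rV_n, (forall i, 0 <= g ord0 i) & cl k = cl a + g.
Proof.
move=> pa ik ak; have [ia _ _] := pa.
have [b [c [ib ic bc -> ba]]] := sub_idem_split pa ik ak.
exists (cl c); first by move=> i; exact: (dt_ge0 dt).
by rewrite (dt_add dt) // (dt_eqv dt ib ia ba).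
Qed.

End DimensionTheory.

(** * The swap diagram *)

Section Morphism.
Variables (K : fieldType) (U U' : algType K) (M : set U) (M' : set U').

Record alg_morphism (f : U -> U') : Prop := AlgMorphism {
  amD : {morph f : x y / x + y};
  amM : {morph f : x y / x * y};
  amZ : forall k, {morph f : x / k *: x};
  am_in : forall x, M x -> M' (f x) }.

Variables (f : U -> U') (fm : alg_morphism f).

Lemma am0 : f 0 = 0.
Proof. by have := amZ fm 0 0; rewrite !scale0r. Qed.

Lemma am_idem e : idem M e -> idem M' (f e).
Proof. by move=> [Me ee]; split; [exact: am_in|rewrite -(amM fm) ee]. Qed.
End Morphism.

Lemma delta_atom n (i : 'I_n) (g h : 'rV[int]_n) :
  (forall j, 0 <= g ord0 j) -> (forall j, 0 <= h ord0 j) ->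
  delta_mx ord0 i = g + h -> g = 0 \/ h = 0.
Proof.
move=> g0 h0 gh.
have ghj j : g ord0 j + h ord0 j = (j == i)%:R.
  by have /matrixP/(_ ord0 j) := gh; rewrite !mxE eqxx => <-.
have [gi|gi] := eqVneq (g ord0 i) 0; [left|right]; apply/rowP => j; rewrite [RHS]mxE.
  by have [->//|ji] := eqVneq j i; have := ghj j; have := g0 j; have := h0 j;
    rewrite (negPf ji); move: (g _ _) (h _ _) => u v /=; lia.
have [->|ji] := eqVneq j i.
  by have := ghj i; move: (g0 i) (h0 i) gi; rewrite eqxx; move: (g _ _) (h _ _) => u v /=; lia.
by have := ghj j; move: (g0 j) (h0 j); rewrite (negPf ji); move: (g _ _) (h _ _) => u v /=; lia.
Qed.

Lemma prim_delta (K : fieldType) (U : algType K) (M : set U) n (cl : U -> 'rV[int]_n)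
    (dt : dimension_theory M cl) e i :
  idem M e -> cl e = delta_mx ord0 i -> prim M e.
Proof.
move=> ie ce; apply: (prim_of_cl dt) => //; last by rewrite ce; exact: delta_atom.
apply/eqP; rewrite ce => /matrixP /(_ ord0 i); rewrite !mxE !eqxx.
by [].
Qed.

Section SwapDiagram.
Variable K : fieldType.
Variables (UB UC UD : algType K) (MB : set UB) (MC : set UC) (MD : set UD).
Variables (clB : UB -> 'rV[int]_2) (clC : UC -> 'rV[int]_3) (clD : UD -> 'rV[int]_1).
Hypotheses (dimB : dimension_theory MB clB) (dimC : dimension_theory MC clC)
  (dimD : dimension_theory MD clD).
Variables (sigma : UB -> UB) (s : UC -> UC) (g : UB -> UC) (g' : UD -> UC).
Hypotheses (sigmam : alg_morphism MB MB sigma) (sm : alg_morphism MC MC s)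
  (gm : alg_morphism MB MC g) (g'm : alg_morphism MD MC g').
Variables (pB : UB) (pD : UD).
Hypotheses (ipB : idem MB pB) (ipD : idem MD pD).
Hypotheses (sigma_pB : sigma pB = pB) (g_pB : g pB = g' pD).
Hypotheses (s_g : forall x, MB x -> s (g x) = g (sigma x))
  (s_g' : forall x, MD x -> s (g' x) = g' x).
Hypothesis cl_pB : clB pB = delta_mx ord0 ord0 + delta_mx ord0 (lift ord0 ord0).
Hypothesis cl_pD : clD pD = delta_mx ord0 ord0 + delta_mx ord0 ord0.
Hypothesis cl_sigma : forall e i, idem MB e ->
  clB (sigma e) ord0 i = clB e ord0 (rev_ord i).
Hypothesis cl_s : forall e, idem MC e -> clC e = delta_mx ord0 ord0 ->
  clC (s e) = delta_mx ord0 ord0.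
Hypothesis cl_g' : forall e i, idem MD e -> clC (g' e) ord0 i = clD e ord0 ord0.

Let delta_ge0 n (i j : 'I_n) : 0 <= (delta_mx ord0 i : 'rV[int]_n) ord0 j.
Proof. by rewrite mxE. Qed.

(** The class of [pB] is a sum of two distinct atoms, so each occurs once. The image of [b1] under
    [sigma] lies below [pB] and has the class of [b2]; it must be [b2]. *)
Lemma swapped_summands : exists b1 b2, [/\ idem MB b1, idem MB b2, orth b1 b2,
  pB = b1 + b2 & sigma b1 = b2].
Proof.
have [a ia ca] := dt_surj dimB (delta_ge0 (ord0 : 'I_2)).
have pa := prim_delta dimB ia ca.
have [|b1 [b2 [i1 i2 b12 pE [c1 c2]]]] := cl_split dimB pa ipB (delta_ge0 (lift ord0 ord0)).
  by rewrite ca.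
rewrite ca in c1; exists b1, b2; split=> //.
have is1 := am_idem sigmam i1.
have cs1 : clB (sigma b1) = delta_mx ord0 (lift ord0 ord0).
  apply/rowP => i; rewrite cl_sigma // c1 !mxE.
  by case: i => -[|[|//]].
have p1 := prim_delta dimB i1 c1; have p2 := prim_delta dimB i2 c2.
have ps1 := prim_delta dimB is1 cs1.
have n12 : clB (sigma b1) != clB b1.
  by apply/eqP; rewrite cs1 c1 => /matrixP/(_ ord0 ord0); rewrite !mxE.
have [_ s0 _] := ps1; have [b1b2 b2b1] := b12.
apply: (prim_unique_sub p2 i1) => //; rewrite ?[b2 + b1]addrC -?pE.
- by rewrite -{1}sigma_pB -(amM sigmam) pE mulrDl (proj2 i1) b2b1 addr0.
- by rewrite -{1}sigma_pB -(amM sigmam) pE mulrDr (proj2 i1) b1b2 addr0.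
- exact: (prim_hom0 dimB ps1 p1 n12).
- by apply: (prim_hom0 dimB p1 ps1); rewrite eq_sym.
Qed.

(** The class of [pD] is twice an atom, so [pD] is a sum of two equivalent primitive idempotents.
    Here [x] and [y], cut down by [d1] and [d2], are the off-diagonal matrix units. *)
Lemma equivalent_summands : exists d1 d2 x y,
  [/\ idem MD d1 /\ clD d1 = delta_mx ord0 ord0, idem MD d2 /\ orth d1 d2, pD = d1 + d2,
     [/\ MD x, MD y, x * y = d2 & y * x = d1] & d2 * x = x /\ x * d1 = x /\ d1 * y = y /\ y * d2
       = y].
Proof.
have [a ia ca] := dt_surj dimD (delta_ge0 (ord0 : 'I_1)).
have pa := prim_delta dimD ia ca.
have [|d1 [d2 [i1 i2 d12 pE [c1 c2]]]] := cl_split dimD pa ipD (delta_ge0 ord0).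
  by rewrite ca.
rewrite ca in c1; have p1 := prim_delta dimD i1 c1; have p2 := prim_delta dimD i2 c2.
have h12 : ~ hom0 MD d1 d2.
  apply: (hom0_le dimD (g := 0) p1 i2) => [|i]; last by rewrite mxE.
  by rewrite c1 c2 addr0.
have [x [y [Mx My xy yx]]] := prim_hom_eqv dimD p1 p2 h12.
have [[Md1 d1d1] [Md2 d2d2]] := (i1, i2).
exists d1, d2, (d2 * x * d1), (d1 * y * d2); split=> //.
  split; do ?by apply: (dtMr dimD).
    have -> : d2 * x * d1 * (d1 * y * d2) = d2 * (x * (d1 * d1) * y) * d2 by rewrite !mulrA.
    have -> : x * (d1 * d1) * y = d2 by rewrite d1d1 yx mulrA -xy -mulrA -xy d2d2.
    by rewrite !d2d2.
  have -> : d1 * y * d2 * (d2 * x * d1) = d1 * (y * (d2 * d2) * x) * d1 by rewrite !mulrA.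
  have -> : y * (d2 * d2) * x = d1 by rewrite d2d2 xy mulrA -yx -mulrA -yx d1d1.
  by rewrite !d1d1.
by rewrite !mulrA d1d1 d2d2 -!mulrA d1d1 d2d2.
Qed.

Lemma swap_diagram_absurd : False.
Proof.
have [b1 [b2 [ib1 ib2 [b12 b21] pBE sb1]]] := swapped_summands.
have [d1 [d2 [x [y [[id1 cd1] [id2 [d12 d21]] pDE [Mx My xy yx] [d2x [xd1 [d1y yd2]]]]]]]] :=
  equivalent_summands.
pose c1 := g b1; pose c2 := g b2.
pose e1 := g' d1; pose e2 := g' d2; pose u := g' x; pose v := g' y.
have sc1 : s c1 = c2 by rewrite /c1 s_g ?sb1 //; case: ib1.
have c12 : c1 * c2 = 0 by rewrite -(amM gm) b12 (am0 gm).
have cc1 : c1 * c1 = c1 by rewrite -(amM gm) (proj2 ib1).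
have cD : c1 + c2 = e1 + e2.
  by rewrite -(amD gm) -pBE g_pB pDE (amD g'm).
have Mc1 : MC c1 by apply: (am_in gm); case: ib1.
have Mc2 : MC c2 by apply: (am_in gm); case: ib2.
have ie1 := am_idem g'm id1; have ie2 := am_idem g'm id2; rewrite -/e1 -/e2 in ie1 ie2.
have uv : u * v = e2 by rewrite -(amM g'm) xy.
have vu : v * u = e1 by rewrite -(amM g'm) yx.
have e2u : e2 * u = u by rewrite -(amM g'm) d2x.
have ue1 : u * e1 = u by rewrite -(amM g'm) xd1.
have e1v : e1 * v = v by rewrite -(amM g'm) d1y.
have ve2 : v * e2 = v by rewrite -(amM g'm) yd2.
have e12 : e1 * e2 = 0 by rewrite -(amM g'm) d12 (am0 g'm).
have e21 : e2 * e1 = 0 by rewrite -(amM g'm) d21 (am0 g'm).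
have se1 : s e1 = e1 by rewrite s_g' //; case: id1.
have su : s u = u by exact: s_g'.
have sv : s v = v by exact: s_g'.
have Mu : MC u by exact: (am_in g'm).
have Mv : MC v by exact: (am_in g'm).
have ce1 i : clC e1 ord0 i = 1 by rewrite cl_g' // cd1 mxE.
clearbody c1 c2 e1 e2 u v.
have [a ia ca] := dt_surj dimC (delta_ge0 (ord0 : 'I_3)).
have pa := prim_delta dimC ia ca.
(* The class of [e1] is (1,1,1): [z] takes the first coordinate, and [z'] is left with (0,1,1). *)
have [||z [z' [iz iz' [zz' z'z] e1E [cz cz']]]] :=
    cl_split dimC (g := clC e1 - delta_mx ord0 ord0) pa ie1.
- by move=> i; rewrite !mxE ce1 subr_ge0 eqxx /= lern1 leq_b1.
- by rewrite ca subrKC.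
rewrite ca in cz; have pz := prim_delta dimC iz cz.
have [[Mz zz] [Mz' _]] := (iz, iz').
have not_above t : prim MC t -> clC t = delta_mx ord0 ord0 -> hom0 MC t z'.
  move=> pt ct; apply: contrapT => /(not_hom0_cl dimC pt iz')[h h0].
  rewrite cz' ct => /matrixP/(_ ord0 ord0); rewrite !mxE ce1 eqxx /= subrr => /eqP.
  by have := h0 ord0; move: (h _ _) => w; lia.
have zz'0 := not_above z pz cz.
have isz := am_idem sm iz; have csz := cl_s iz cz; have psz := prim_delta dimC isz csz.
have szz'0 := not_above _ psz csz; have [Msz _] := isz; have [_ sz0 _] := psz.
have e1z : e1 * z = z by rewrite e1E mulrDl zz z'z addr0.
have ze1 : z * e1 = z by rewrite e1E mulrDr zz zz' addr0.
(* The class (1,0,0) occurs only once in [e1], and [s] fixes both [e1] and this class. *)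
have sz : s z = z.
  apply: (prim_unique_sub pz iz' isz sz0) => //; rewrite -?e1E //.
  - by rewrite -{1}se1 -(amM sm) e1z.
  - by rewrite -{1}se1 -(amM sm) ze1.
  - exact: (hom0_sym dimC).
have zu : z * u = 0 by rewrite -ze1 -e2u mulrA -(mulrA z) e12 mulr0 mul0r.
have vz : v * z = 0 by rewrite -e1z -ve2 -mulrA (mulrA e2) e21 mul0r mulr0.
(* Z is the unit of the component of the first coordinate in the corner of p. *)
pose uzv := u * z * v; pose Z := z + uzv; pose W := z' + u * z' * v.
have ZW : Z + W = e1 + e2.
  by rewrite addrACA -e1E; congr (_ + _); rewrite -mulrDl -mulrDr -e1E ue1 uv.
(* Moving [u] and [v] to the outside or into the middle factor reduces all four blocks to
   [z M z' = 0]. *)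
have ZmW m : MC m -> Z * m * W = 0.
  move=> Mm; rewrite /Z /W /uzv mulrDr !mulrDl.
  have h m' : MC m' -> z * m' * z' = 0 := zz'0 m'.
  have -> : u * z * v * m * z' = u * (z * (v * m) * z') by rewrite !mulrA.
  have -> : z * m * (u * z' * v) = z * (m * u) * z' * v by rewrite !mulrA.
  have -> : u * z * v * m * (u * z' * v) = u * (z * (v * m * u) * z') * v by rewrite !mulrA.
  rewrite !h ?mulr0 ?mul0r ?addr0 //.
  - exact: (dtMr dimC).
  - exact: (dtMr dimC).
  - exact: (dtMr dimC).
have ZZ : Z * Z = Z.
  have t1 : z * uzv = 0 by rewrite /uzv !mulrA zu !mul0r.
  have t2 : uzv * z = 0 by rewrite /uzv -mulrA vz mulr0.
  have t3 : uzv * uzv = uzv.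
    have -> : uzv * uzv = u * (z * (v * u) * z) * v by rewrite /uzv !mulrA.
    by rewrite vu ze1 zz.
  by rewrite /Z mulrDr !mulrDl zz t1 t2 t3 addr0 add0r.
have sZ : s Z = Z by rewrite /Z /uzv (amD sm) !(amM sm) sz su sv.
have szmz m : MC m -> s (z * m * z) = z * m * z.
  by move=> Mm; have [_ _ /(_ m Mm)[l ->]] := pz; rewrite (amZ sm) sz.
(* In the decomposition into 2x2 blocks, every entry is a multiple of [z], and [s] fixes [z], [u]
   and [v]. *)
have sZmZ m : MC m -> s (Z * m * Z) = Z * m * Z.
  move=> Mm.
  have -> : Z * m * Z = z * m * z + u * (z * (v * m) * z) +
      (z * (m * u) * z * v + u * (z * (v * m * u) * z) * v).
    by rewrite /Z /uzv mulrDr !mulrDl !mulrA.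
  rewrite !(amD sm) !(amM sm _ v) !(amM sm u) su sv !szmz //.
  - exact: (dtMr dimC).
  - exact: (dtMr dimC).
  - exact: (dtMr dimC).
have Z0 : Z != 0.
  have [_ z0 _] := pz; apply: contra_neq z0 => Z0.
  have <- : z * Z = z by rewrite /Z mulrDr zz /uzv !mulrA zu !mul0r addr0.
  by rewrite Z0 mulr0.
have MZ : MC Z by apply: (dtD dimC) => //; exact: (dtMr dimC).
clearbody Z W.
have ZpZ : Z * (c1 + c2) * Z = Z.
  have : Z * Z * W = 0 by exact: ZmW.
  by rewrite ZZ cD -ZW mulrDr ZZ => ->; rewrite addr0 ZZ.
(* Compression by [Z] is multiplicative here: the inner [Z * Z] equals [p - W], and [ZmW] removes
   the term in [W]. *)
have ZcZ c c' : MC c -> MC c' -> c * (c1 + c2) = c ->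
    Z * c * Z * (Z * c' * Z) = Z * (c * c') * Z.
  move=> Mc Mc' cp.
  have -> : Z * c * Z * (Z * c' * Z) = Z * c * (Z * Z) * c' * Z by rewrite !mulrA.
  have -> : Z * Z = (c1 + c2) - W by rewrite ZZ cD -ZW addrK.
  by rewrite mulrBr ZmW // subr0 -(mulrA Z c) cp !mulrA.
pose w := Z * c1 * Z; have Mw : MC w by exact: (dtMr dimC).
have sw : Z * c2 * Z = w by rewrite -sc1 -{1 2}sZ -!(amM sm) sZmZ.
have c1p : c1 * (c1 + c2) = c1 by rewrite mulrDr cc1 c12 addr0.
(* The common compression of [c1] and [c2] is idempotent, and has square zero because
   [c1 * c2 = 0]. *)
have w0 : w = 0.
  have ww : w * w = w by rewrite /w ZcZ // cc1.
  by rewrite -ww -{2}sw /w ZcZ // c12 mulr0 mul0r.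
by case/negP: Z0; rewrite -ZpZ mulrDr mulrDl sw -/w w0 addr0.
Qed.
End SwapDiagram.

(** * The unitization of the finite matrices over a C*-algebra *)

Section MatrixScaling.
Variables (R : realType) (A : cstarAlgType R).
Implicit Types (x y : nat -> nat -> A) (k : R[i]).

Lemma MinfN x : Minf x -> Minf (- x).
Proof. by move=> [n n0]; exists n => i j /n0 xij; rewrite !fctE xij oppr0. Qed.

Lemma MinfZ k x : Minf x -> Minf (k *: x).
Proof. by move=> [n n0]; exists n => i j /n0 xij; rewrite !fctE xij scaler0. Qed.

Lemma mmulZl k x y : Minf x -> mmul (k *: x) y = k *: mmul x y.
Proof.
move=> [n n0]; have xn := Minf_col n0; apply/funext => i; apply/funext => j.
rewrite !fctE (mmulE (or_introl xn)) (@mmulE _ _ _ _ n); last first.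
  by left=> p q /xn xpq; rewrite !fctE xpq scaler0.
by rewrite scaler_sumr; apply: eq_bigr => p _; exact: cmulZl.
Qed.

Lemma mmulZr k x y : Minf x -> mmul x (k *: y) = k *: mmul x y.
Proof.
move=> [n n0]; have xn := Minf_col n0; apply/funext => i; apply/funext => j.
rewrite !fctE !(mmulE (or_introl xn)) scaler_sumr.
by apply: eq_bigr => p _; exact: cmulZr.
Qed.
End MatrixScaling.

(* The unitization of M_oo(A): the pair of c and x stands for c + x. *)
Record uni (R : realType) (A : cstarAlgType R) := Uni {
  uc : R[i];
  um : nat -> nat -> A;
  umP : Minf um }.

Section Unitization.
Variables (R : realType) (A : cstarAlgType R).
Implicit Types (u v w : uni A) (k : R[i]).

HB.instance Definition _ := gen_eqMixin (uni A).
HB.instance Definition _ := gen_choiceMixin (uni A).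

Lemma uni_ext u v : uc u = uc v -> um u = um v -> u = v.
Proof.
case: u v => c x xf [d y yf] /= cd xy; case: d / cd; case: y / xy yf => yf.
by congr Uni; exact: Prop_irrelevance.
Qed.

Definition uni0 : uni A := Uni 0 (@Minf0 R A).
Definition uni1 : uni A := Uni 1 (@Minf0 R A).
Definition uniD u v : uni A := Uni (uc u + uc v) (MinfD (umP u) (umP v)).
Definition uniN u : uni A := Uni (- uc u) (MinfN (umP u)).
Definition uniZ k u : uni A := Uni (k * uc u) (MinfZ k (umP u)).
Definition uniM u v : uni A := Uni (uc u * uc v)
  (MinfD (MinfD (MinfZ (uc u) (umP v)) (MinfZ (uc v) (umP u))) (Minf_mul (umP u) (umP v))).

Lemma uniDA : associative uniD.
Proof. by move=> u v w; apply: uni_ext; exact: addrA. Qed.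
Lemma uniDC : commutative uniD.
Proof. by move=> u v; apply: uni_ext; exact: addrC. Qed.
Lemma uni0D : left_id uni0 uniD.
Proof. by move=> u; apply: uni_ext; exact: add0r. Qed.
Lemma uniND : left_inverse uni0 uniN uniD.
Proof. by move=> u; apply: uni_ext; exact: addNr. Qed.

HB.instance Definition _ := GRing.isZmodule.Build (uni A) uniDA uniDC uni0D uniND.

Lemma uniMA : associative uniM.
Proof.
move=> u v w; apply: uni_ext; first exact: mulrA.
have [fu fv fw] := And3 (umP u) (umP v) (umP w).
have fuv := Minf_mul fu fv.
rewrite /= !mmulDl ?mmulDr //; do ?exact: MinfD; do ?exact: MinfZ.
rewrite !mmulZl ?mmulZr // mmulA // !scalerDr !scalerA.
rewrite [uc w * uc u]mulrC [uc w * uc v]mulrC.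
by rewrite [LHS](AC (4*3) ((1*(2*4*6))*(3*5*7))).
Qed.

Lemma uni1M : left_id uni1 uniM.
Proof.
move=> u; apply: uni_ext; first exact: mul1r.
by rewrite /= scale1r scaler0 mmul0l !addr0.
Qed.

Lemma uniM1 : right_id uni1 uniM.
Proof.
move=> u; apply: uni_ext; first exact: mulr1.
by rewrite /= scale1r scaler0 mmul0r add0r addr0.
Qed.

Lemma uniMDl : left_distributive uniM uniD.
Proof.
move=> u v w; apply: uni_ext; first exact: mulrDl.
have [fu fv fw] := And3 (umP u) (umP v) (umP w).
by rewrite /= mmulDl // scalerDl scalerDr [LHS](AC ((2*2)*2) ((1*3*5)*(2*4*6))).
Qed.

Lemma uniMDr : right_distributive uniM uniD.
Proof.
move=> u v w; apply: uni_ext; first exact: mulrDr.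
have [fu fv fw] := And3 (umP u) (umP v) (umP w).
by rewrite /= mmulDr // scalerDl scalerDr [LHS](AC ((2*2)*2) ((1*3*5)*(2*4*6))).
Qed.

Lemma uni1_neq0 : uni1 != uni0.
Proof. by apply/eqP => /(congr1 (@uc R A)) /= /eqP; rewrite oner_eq0. Qed.

HB.instance Definition _ := GRing.Zmodule_isNzRing.Build (uni A)
  uniMA uni1M uniM1 uniMDl uniMDr uni1_neq0.

Lemma uniZA k l u : uniZ k (uniZ l u) = uniZ (k * l) u.
Proof. by apply: uni_ext; [exact: mulrA|exact: scalerA]. Qed.
Lemma uni1Z : left_id 1 uniZ.
Proof. by move=> u; apply: uni_ext; [exact: mul1r|exact: scale1r]. Qed.
Lemma uniZDr : right_distributive uniZ +%R.
Proof. by move=> k u v; apply: uni_ext; [exact: mulrDr|exact: scalerDr]. Qed.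
Lemma uniZDl u : {morph uniZ^~ u : k l / k + l}.
Proof. by move=> k l; apply: uni_ext; [exact: mulrDl|exact: scalerDl]. Qed.

HB.instance Definition _ := GRing.Zmodule_isLmodule.Build R[i] (uni A)
  uniZA uni1Z uniZDr uniZDl.

Lemma uniZAl k u v : k *: (u * v) = (k *: u) * v.
Proof.
apply: uni_ext; first exact: mulrA.
by rewrite /= mmulZl; [rewrite !scalerDr !scalerA [uc v * k]mulrC|exact: umP].
Qed.

HB.instance Definition _ := GRing.Lmodule_isLalgebra.Build R[i] (uni A) uniZAl.

Lemma uniZAr k u v : k *: (u * v) = u * (k *: v).
Proof.
apply: uni_ext; first exact: mulrCA.
by rewrite /= mmulZr; [rewrite !scalerDr !scalerA [uc u * k]mulrC|exact: umP].
Qed.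

HB.instance Definition _ := GRing.Lalgebra_isAlgebra.Build R[i] (uni A) uniZAr.

Definition Muni : set (uni A) := [set u | uc u = 0].

Lemma ucM u v : uc (u * v) = uc u * uc v. Proof. by []. Qed.
Lemma ucD u v : uc (u + v) = uc u + uc v. Proof. by []. Qed.
Lemma umD u v : um (u + v) = um u + um v. Proof. by []. Qed.
Lemma umN u : um (- u) = - um u. Proof. by []. Qed.
Lemma umZ k u : um (k *: u) = k *: um u. Proof. by []. Qed.

Lemma MuniMl u v : Muni u -> Muni (u * v).
Proof. by rewrite /Muni /= => ->; rewrite mul0r. Qed.
Lemma MuniMr u v : Muni v -> Muni (u * v).
Proof. by rewrite /Muni /= => ->; rewrite mulr0. Qed.
Lemma MuniD u v : Muni u -> Muni v -> Muni (u + v).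
Proof. by rewrite /Muni /= => -> ->; rewrite addr0. Qed.
Lemma MuniZ k u : Muni u -> Muni (k *: u).
Proof. by rewrite /Muni /= => ->; rewrite mulr0. Qed.

Lemma umM u v : Muni u -> Muni v -> um (u * v) = mmul (um u) (um v).
Proof. by rewrite /Muni /= => -> ->; rewrite !scale0r !add0r. Qed.
End Unitization.

(** * Matrix units and semiprimeness *)

Section MatrixUnit.
Variables (R : realType) (A : cstarAlgType R).

Lemma fsum_single (j : nat) (F : nat -> A) : (forall k, k != j -> F k = 0) ->
  \sum_(k \in [set: nat]) F k = F j.
Proof.
move=> F0; rewrite (@fsum_ord _ _ j.+1) => [|k jk]; last by rewrite F0 // gtn_eqF.
by rewrite big_ord_recr /= big1 ?add0r // => k _; rewrite F0 // ltn_eqF.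
Qed.

Lemma Minf_unit i j (a : A) : Minf (fun p q => if (p == i) && (q == j) then a else 0).
Proof.
exists (maxn i j).+1 => p q; case: ifP => // /andP[/eqP-> /eqP->].
by rewrite ltnn.
Qed.

Definition uni_unit i j (a : A) : uni A := Uni 0 (Minf_unit i j a).

Lemma um_unit_mul (u : uni A) i j a p q : Muni u ->
  um (u * uni_unit i j a * u) p q = cmul (um u p i) (cmul a (um u j q)).
Proof.
move=> Mu; have Ma : Muni (uni_unit i j a) by [].
rewrite umM ?umM //; last exact: MuniMl.
have Ei l : um (uni_unit i j a) i l = if l == j then a else 0 by rewrite /= eqxx.
have E0 m l : (m != i) || (l != j) -> um (uni_unit i j a) m l = 0.
  by rewrite /= -negb_and => /negPf->.
rewrite /mmul (@fsum_single j) => [|l lj].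
  rewrite (@fsum_single i) => [|m mi]; first by rewrite Ei eqxx cmulA.
  by rewrite E0 ?mi // cmul0r.
by rewrite fsbig1 ?cmul0l // => m _; rewrite E0 ?lj ?orbT // cmul0r.
Qed.
End MatrixUnit.

Section Semiprime.
Variables (R : realType) (A : cstarAlgType R).
Implicit Types (u v : uni A) (S : set A).

Lemma cstar_eq0 (a : A) : cmul (cmul a (cstar a)) a = 0 -> a = 0.
Proof.
move=> aaa; have aa0 : cmul (cstar a) a = 0.
  apply/eqP; rewrite -normr_eq0 -sqrf_eq0 -cnorm_star cstarM cstarK.
  by rewrite cmulA -(cmulA _ a) -cmulA aaa cmul0r normr0.
by apply/eqP; rewrite -normr_eq0 -sqrf_eq0 -cnorm_star aa0 normr0.
Qed.

Definition Muni_over n S : set (uni A) :=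
  [set u | [/\ uc u = 0, forall i j, (n <= maxn i j)%N -> um u i j = 0 & forall i j, S (um u i j)]].

(** Let [a] be the entry of [u] at [(i, j)], and let [v] have the adjoint of [a] at [(j, i)] and 0
    elsewhere. Then [u * v * u] has the entry [a a^* a] at [(i, j)], which by the C*-identity
    vanishes only if [a] does. Since [S] is only required to contain 0 and to be closed under
    adjoints, the lemma serves for the whole algebra and for its finite-dimensional subalgebras. *)
Lemma Muni_over_semiprime n S u : S 0 -> (forall a, S a -> S (cstar a)) ->
  Muni_over n S u -> (forall v, Muni_over n S v -> u * v * u = 0) -> u = 0.
Proof.
move=> S0 Sstar [u0 un uS] uvu; apply: uni_ext => //.
apply/funext => i; apply/funext => j; rewrite [RHS]/=.
have [nij|ijn] := leqP n (maxn i j); first exact: un.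
apply: cstar_eq0; rewrite -cmulA -um_unit_mul // uvu //; split=> //=.
  move=> p q npq; case: ifP => // /andP[/eqP pj /eqP qi].
  by move: npq; rewrite pj qi maxnC leqNgt ijn.
by move=> p q; case: ifP => // _; apply: Sstar.
Qed.
End Semiprime.

(** * Closedness of finite-dimensional subspaces *)

Section RealNorm.
Variables (R : realType) (V : normedZmodType R[i]).
Implicit Types x y : V.

(** The norm lives in [R[i]]; its real part carries the same information and allows ordinary real
    estimates. *)
Definition nrm x : R := complex.Re `|x|.

Lemma nrmE x : `|x| = (nrm x)%:C.
Proof. by rewrite /nrm RRe_real // normr_real. Qed.

Lemma nrm_lt x (e : R) : (`|x| < e%:C) = (nrm x < e).
Proof. by rewrite nrmE ltcR. Qed.

Lemma nrm_ge0 x : 0 <= nrm x.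
Proof. by rewrite -ler0c -nrmE. Qed.

Lemma nrm0 : nrm 0 = 0.
Proof. by apply: complexI; rewrite -nrmE normr0. Qed.

Lemma nrmN x : nrm (- x) = nrm x.
Proof. by rewrite /nrm normrN. Qed.

Lemma nrmB x y : nrm (x - y) = nrm (y - x).
Proof. by rewrite -nrmN opprB. Qed.

Lemma nrmD x y : nrm (x + y) <= nrm x + nrm y.
Proof. by rewrite -lecR rmorphD /= -!nrmE ler_normD. Qed.

Lemma nrm_eq0 x : (nrm x == 0) = (x == 0).
Proof. by rewrite -[RHS]normr_eq0 nrmE -[LHS](inj_eq (@complexI R)). Qed.

Lemma nrm_dist x y z : nrm (x - z) <= nrm (x - y) + nrm (y - z).
Proof. by rewrite -(subrKA y) nrmD. Qed.
End RealNorm.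

Section RealNormModule.
Variables (R : realType).

Lemma nrmZ (V : normedModType R[i]) (k : R[i]) (x : V) : nrm (k *: x) = nrm k * nrm x.
Proof. by apply: complexI; rewrite rmorphM /= -!nrmE normrZ. Qed.

Lemma nrm_Re (k : R[i]) : `|complex.Re k| <= nrm k.
Proof. by rewrite -lecR -nrmE normc_ge_Re. Qed.

Lemma nrm_le_ReIm (k : R[i]) : nrm k <= `|complex.Re k| + `|complex.Im k|.
Proof.
rewrite /nrm normc_def /= -[leRHS]ger0_norm ?addr_ge0 // -sqrtr_sqr ler_wsqrtr //.
by rewrite sqrrD !real_normK ?num_real // lerD2r lerDl mulrn_wge0 // mulr_ge0.
Qed.

Lemma nrm_Im (k : R[i]) : `|complex.Im k| <= nrm k.
Proof. by rewrite /nrm normc_def /= -sqrtr_sqr ler_wsqrtr // lerDr sqr_ge0. Qed.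

Lemma complete_ex (V : completeNormedModType R[i]) (u : nat -> V) :
  (forall e : R, 0 < e -> exists k0, forall k, (k0 <= k)%N -> nrm (u k - u k0) < e) ->
  exists l, forall e : R, 0 < e -> exists k0, forall k, (k0 <= k)%N -> nrm (u k - l) < e.
Proof.
move=> uc; have cu : cvg (u @ \oo).
  apply/cauchy_cvgP/cauchy_exP => e e0.
  have ee : e = (complex.Re e)%:C by rewrite RRe_real // ger0_real // ltW.
  have [|k0 k0P] := uc (complex.Re e); first by rewrite -ltcR -ee.
  exists (u k0); exists k0 => // k /= /k0P.
  by rewrite -ball_normE /= ee -nrm_lt distrC.
exists (lim (u @ \oo)) => e e0.
have /cvgrPdist_lt/(_ e%:C) := cu; rewrite ltcR => /(_ e0)[k0 _ k0P].
by exists k0 => k /k0P /=; rewrite nrm_lt nrmB.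
Qed.

Lemma real_complete_ex (t : nat -> R) :
  (forall e : R, 0 < e -> exists k0, forall k, (k0 <= k)%N -> `|t k - t k0| < e) ->
  exists l, forall e : R, 0 < e -> exists k0, forall k, (k0 <= k)%N -> `|t k - l| < e.
Proof.
move=> tc; have ct : cvg (t @ \oo).
  apply/cauchy_cvgP/cauchy_exP => e e0; have [k0 k0P] := tc e e0.
  exists (t k0); exists k0 => // k /= /k0P.
  by rewrite -ball_normE /= distrC.
exists (lim (t @ \oo)) => e e0.
have /cvgrPdist_lt/(_ e e0)[k0 _ k0P] := ct.
by exists k0 => k /k0P /=; rewrite distrC.
Qed.
Lemma complex_complete_ex (t : nat -> R[i]) :
  (forall e : R, 0 < e -> exists k0, forall k, (k0 <= k)%N -> nrm (t k - t k0) < e) ->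
  exists l, forall e : R, 0 < e -> exists k0, forall k, (k0 <= k)%N -> nrm (t k - l) < e.
Proof.
move=> tc.
have [|a ta] := @real_complete_ex (fun k => complex.Re (t k)).
  move=> e e0; have [k0 k0P] := tc e e0; exists k0 => k /k0P; apply: le_lt_trans.
  by rewrite -raddfB nrm_Re.
have [|b tb] := @real_complete_ex (fun k => complex.Im (t k)).
  move=> e e0; have [k0 k0P] := tc e e0; exists k0 => k /k0P; apply: le_lt_trans.
  by rewrite -raddfB nrm_Im.
exists (a +i* b) => e e0; have e2 : 0 < e / 2 by rewrite divr_gt0.
have [[k0 k0P] [k1 k1P]] := (ta _ e2, tb _ e2); exists (maxn k0 k1) => k.
rewrite geq_max => /andP[/k0P ka /k1P kb]; apply: (le_lt_trans (nrm_le_ReIm _)).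
by rewrite [ltRHS]splitr !raddfB /= ltrD.
Qed.

Definition nclosed (V : normedModType R[i]) (S : set V) : Prop :=
  forall l, (forall e : R, 0 < e -> exists2 x, S x & nrm (x - l) < e) -> S l.

(** Induction on the number of generators. If [x = g ord0] is not in the closed span [W] of the
    others, it has a distance [dl > 0] to [W], whence [nrm s * dl <= nrm (s *: x + w)]. So the
    coefficients of [x] along an approximating sequence are Cauchy, and subtracting the limit
    coefficient reduces the claim to [W]. *)
Lemma span_closed (V : normedModType R[i]) d (g : 'I_d -> V) :
  nclosed [set x | exists a : 'I_d -> R[i], x = \sum_i a i *: g i].
Proof.
elim: d g => [|d IH] g l lS.
  exists (fun=> 0); rewrite big_ord0; apply/eqP; rewrite -nrm_eq0 eq_le nrm_ge0 andbT.
  rewrite leNgt; apply/negP => /lS[x [a ->]]; rewrite big_ord0 sub0r nrmN.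
  by rewrite ltxx.
pose W := [set x : V | exists a : 'I_d -> R[i], x = \sum_i a i *: g (lift ord0 i)].
have WB x y : W x -> W y -> W (x - y).
  move=> [a ->] [b ->]; exists (fun i => a i - b i).
  by rewrite -sumrB; apply: eq_bigr => i _; rewrite scalerBl.
have WZ k x : W x -> W (k *: x).
  move=> [a ->]; exists (fun i => k * a i).
  by rewrite scaler_sumr; apply: eq_bigr => i _; rewrite scalerA.
have Wcl : nclosed W := IH _.
pose x := g ord0; pose S := [set y : V | exists a : 'I_d.+1 -> R[i], y = \sum_i a i *: g i].
have SE y : S y <-> exists t w, W w /\ y = t *: x + w.
  split=> [[a ->]|[t [w [[a ->] ->]]]].
    by exists (a ord0), (\sum_i a (lift ord0 i) *: g (lift ord0 i)); rewrite big_ord_recl;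
      split=> //; exists (a \o lift ord0).
  exists (fun i => if unlift ord0 i is Some j then a j else t).
  rewrite big_ord_recl unlift_none; congr (_ + _); apply: eq_bigr => i _.
  by rewrite liftK.
have [Wx|Wx] := pselect (W x).
  apply/SE; exists 0, l; rewrite scale0r add0r; split=> //;
    apply: Wcl => e /lS[y /SE[t [w [Ww ->]]] yl].
  exists (t *: x + w) => //; rewrite -[w]opprK; apply: (WB); first exact: WZ.
  by rewrite -scaleN1r; exact: WZ.
have [dl dl0 dlW] : exists2 dl : R, 0 < dl & forall w, W w -> dl <= nrm (w - x).
  apply: contrapT => h; apply: Wx; apply: Wcl => e e0; apply: contrapT => h'; apply: h.
  exists e => // w Ww; rewrite leNgt; apply/negP => wx; apply: h'; by exists w.
have bound s w : W w -> nrm s * dl <= nrm (s *: x + w).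
  move=> Ww; have [->|s0] := eqVneq s 0; first by rewrite nrm0 mul0r nrm_ge0.
  have -> : s *: x + w = s *: - ((- s^-1) *: w - x).
    by rewrite opprB scaleNr opprK scalerDr scalerA divff // scale1r.
  by rewrite nrmZ nrmN ler_wpM2l ?nrm_ge0 // dlW //; exact: WZ.
have /choice[tw twP] : forall k : nat, exists tw : R[i] * V, W tw.2 /\ nrm (tw.1 *: x + tw.2 - l)
  < k.+1%:R^-1.
  move=> k; have [|y /SE[t [w [Ww ->]]] yl] := lS k.+1%:R^-1; first by rewrite invr_gt0.
  by exists (t, w).
have small (e : R) : 0 < e -> exists k0, forall k, (k0 <= k)%N -> (k.+1%:R : R)^-1 < e.
  move=> e0; have /cvgrPdist_lt/(_ e e0)[k0 _ k0P] := @cvg_harmonic R.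
  exists k0 => k /k0P /=; rewrite sub0r normrN ger0_norm //.
have [|t tt] := @complex_complete_ex (fun k => (tw k).1).
  move=> e e0; have ed : 0 < e * dl / 2 by rewrite divr_gt0 // mulr_gt0.
  have [k0 k0P] := small _ ed; exists k0 => k kk.
  rewrite -(ltr_pM2r dl0);
    have := bound ((tw k).1 - (tw k0).1) ((tw k).2 - (tw k0).2) (WB _ _ (twP k).1 (twP k0).1).
  move=> /le_lt_trans; apply.
  have -> : ((tw k).1 - (tw k0).1) *: x + ((tw k).2 - (tw k0).2) =
    ((tw k).1 *: x + (tw k).2 - l) - ((tw k0).1 *: x + (tw k0).2 - l).
    by rewrite scalerBl opprB [RHS]addrA subrK opprD addrACA.
  rewrite [ltRHS]splitr; apply: (le_lt_trans (nrmD _ _)); rewrite nrmN ltrD //.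
    exact: lt_trans (twP _).2 (k0P _ kk).
  exact: lt_trans (twP _).2 (k0P _ (leqnn _)).
apply/SE; exists t, (l - t *: x); split; last by rewrite subrKC.
apply: Wcl => e e0; pose e' := e / 2 / (1 + nrm x).
have x1 : 0 < 1 + nrm x by rewrite ltr_pwDl ?nrm_ge0.
have e2 : 0 < e / 2 by rewrite divr_gt0.
have e'0 : 0 < e' by rewrite divr_gt0.
have [k0 k0P] := tt _ e'0; have [k1 k1P] := small _ e2.
pose k := maxn k0 k1; exists (tw k).2; first by case: (twP k).
have -> : (tw k).2 - (l - t *: x) = ((tw k).1 *: x + (tw k).2 - l) - ((tw k).1 - t) *: x.
  by rewrite scalerBl !opprB [RHS](AC (3*2) ((2*(4*3))*(1*5))) /= subrr addr0.
apply: (le_lt_trans (nrmD _ _)); rewrite nrmN nrmZ [ltRHS]splitr ltrD //.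
  by apply: lt_trans (twP _).2 (k1P _ _); rewrite leq_maxr.
apply: (@le_lt_trans _ _ (nrm ((tw k).1 - t) * (1 + nrm x))).
  by rewrite ler_wpM2l ?nrm_ge0 // lerDr.
by rewrite -ltr_pdivlMr // k0P // leq_maxl.
Qed.
End RealNormModule.

(** * Density of the union of the algebras of a directed colimit *)

Record closed_subalg (R : realType) (A : cstarAlgType R) := ClosedSubalg {
  cs_set :> A -> Prop;
  cs0 : cs_set 0;
  csD : forall x y, cs_set x -> cs_set y -> cs_set (x + y);
  csZ : forall k x, cs_set x -> cs_set (k *: x);
  csM : forall x y, cs_set x -> cs_set y -> cs_set (cmul x y);
  cs_star : forall x, cs_set x -> cs_set (cstar x);
  cs_closed : nclosed cs_set }.

(** The universal property of a colimit only speaks of objects of the category, so a closed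
    subalgebra has to become a C*-algebra of its own before it can be tested against. *)
Record cs_elt (R : realType) (A : cstarAlgType R) (S : closed_subalg A) := CsElt {
  cs_val :> A;
  cs_valP : S cs_val }.

Section ClosedSubalgebra.
Variables (R : realType) (A : cstarAlgType R) (S : closed_subalg A).
Local Notation T := (cs_elt S).
Implicit Types (x y z : T) (k : R[i]).

HB.instance Definition _ := gen_eqMixin T.
HB.instance Definition _ := gen_choiceMixin T.

Lemma cs_ext x y : cs_val x = cs_val y -> x = y.
Proof.
case: x y => x xS [y yS] /= xy; case: y / xy yS => yS.
by congr CsElt; exact: Prop_irrelevance.
Qed.

Lemma csN a : S a -> S (- a).
Proof. by move=> Sa; rewrite -scaleN1r; exact: csZ. Qed.

Definition cs_zero : T := CsElt (cs0 S).
Definition cs_add x y : T := CsElt (csD (cs_valP x) (cs_valP y)).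
Definition cs_opp x : T := CsElt (csN (cs_valP x)).
Definition cs_scale k x : T := CsElt (csZ k (cs_valP x)).
Definition cs_mul x y : T := CsElt (csM (cs_valP x) (cs_valP y)).
Definition cs_adj x : T := CsElt (cs_star (cs_valP x)).

Lemma cs_addA : associative cs_add.
Proof. by move=> x y z; apply: cs_ext; exact: addrA. Qed.
Lemma cs_addC : commutative cs_add.
Proof. by move=> x y; apply: cs_ext; exact: addrC. Qed.
Lemma cs_add0 : left_id cs_zero cs_add.
Proof. by move=> x; apply: cs_ext; exact: add0r. Qed.
Lemma cs_addN : left_inverse cs_zero cs_opp cs_add.
Proof. by move=> x; apply: cs_ext; exact: addNr. Qed.

HB.instance Definition _ := GRing.isZmodule.Build T cs_addA cs_addC cs_add0 cs_addN.

Lemma cs_scaleA k l x : cs_scale k (cs_scale l x) = cs_scale (k * l) x.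
Proof. by apply: cs_ext; exact: scalerA. Qed.
Lemma cs_scale1 : left_id 1 cs_scale.
Proof. by move=> x; apply: cs_ext; exact: scale1r. Qed.
Lemma cs_scaleDr : right_distributive cs_scale +%R.
Proof. by move=> k x y; apply: cs_ext; exact: scalerDr. Qed.
Lemma cs_scaleDl x : {morph cs_scale^~ x : k l / k + l}.
Proof. by move=> k l; apply: cs_ext; exact: scalerDl. Qed.

HB.instance Definition _ := GRing.Zmodule_isLmodule.Build R[i] T
  cs_scaleA cs_scale1 cs_scaleDr cs_scaleDl.

Definition cs_norm x : R[i] := `|cs_val x|.

Lemma cs_normD x y : cs_norm (x + y) <= cs_norm x + cs_norm y.
Proof. exact: ler_normD. Qed.
Lemma cs_normZ k x : cs_norm (k *: x) = `|k| * cs_norm x.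
Proof. exact: normrZ. Qed.
Lemma cs_norm_eq0 x : cs_norm x = 0 -> x = 0.
Proof. by move=> /eqP; rewrite normr_eq0 => /eqP x0; exact: cs_ext. Qed.

HB.instance Definition _ := @Lmodule_isNormed.Build R[i] T cs_norm
  cs_normD cs_normZ cs_norm_eq0.

Lemma cs_complete (F : set_system T) : ProperFilter F -> cauchy F -> cvg F.
Proof.
move=> FF /cauchyP Fc.
pose G : set_system A := (@cs_val _ _ S) @ F.
have GF : ProperFilter G by exact: fmap_proper_filter.
have Gc : cvg G.
  apply/cauchy_cvgP/cauchy_exP => e e0; have [x xF] := Fc e e0.
  by exists (cs_val x); rewrite -ball_normE; rewrite -ball_normE in xF; exact: xF.
have lG e : 0 < e -> F [set x | `|lim G - cs_val x| < e].
  by move=> e0; have /cvgrPdist_lt/(_ e e0) := Gc.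
have Sl : S (lim G).
  apply: cs_closed => e e0.
  have /filter_ex[x xl] : F [set x | `|lim G - cs_val x| < e%:C] by apply: lG; rewrite ltcR.
  by exists (cs_val x); [exact: cs_valP|rewrite nrmB -nrm_lt].
apply/cvg_ex; exists (CsElt Sl); apply/cvgrPdist_lt => e e0.
exact: lG.
Qed.

HB.instance Definition _ := Uniform_isComplete.Build T cs_complete.

Lemma cs_mulA : associative cs_mul.
Proof. by move=> x y z; apply: cs_ext; exact: cmulA. Qed.
Lemma cs_mulDl : left_distributive cs_mul +%R.
Proof. by move=> x y z; apply: cs_ext; exact: cmulDl. Qed.
Lemma cs_mulDr : right_distributive cs_mul +%R.
Proof. by move=> x y z; apply: cs_ext; exact: cmulDr. Qed.
Lemma cs_mulZl k x y : cs_mul (k *: x) y = k *: cs_mul x y.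
Proof. by apply: cs_ext; exact: cmulZl. Qed.
Lemma cs_mulZr k x y : cs_mul x (k *: y) = k *: cs_mul x y.
Proof. by apply: cs_ext; exact: cmulZr. Qed.
Lemma cs_adjK : involutive cs_adj.
Proof. by move=> x; apply: cs_ext; exact: cstarK. Qed.
Lemma cs_adjD : {morph cs_adj : x y / x + y}.
Proof. by move=> x y; apply: cs_ext; exact: cstarD. Qed.
Lemma cs_adjZ k x : cs_adj (k *: x) = k^*%C *: cs_adj x.
Proof. by apply: cs_ext; exact: cstarZ. Qed.
Lemma cs_adjM x y : cs_adj (cs_mul x y) = cs_mul (cs_adj y) (cs_adj x).
Proof. by apply: cs_ext; exact: cstarM. Qed.
Lemma cs_normM x y : `|cs_mul x y| <= `|x| * `|y|.
Proof. exact: cnormM. Qed.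
Lemma cs_norm_adj x : `|cs_mul (cs_adj x) x| = `|x| ^+ 2.
Proof. exact: cnorm_star. Qed.

HB.instance Definition _ := CompleteNormedModule_isCStarAlgebra.Build R T
  cs_mulA cs_mulDl cs_mulDr cs_mulZl cs_mulZr cs_adjK cs_adjD cs_adjZ cs_adjM
  cs_normM cs_norm_adj.

Definition cs_incl : cstar_hom (T : cstarAlgType R) A.
Proof. by exists (@cs_val _ _ S). Defined.

Definition cs_corestrict (B : cstarAlgType R) (f : cstar_hom B A) (fS : forall b, S (f b)) :
  cstar_hom B (T : cstarAlgType R).
Proof.
exists (fun b => CsElt (fS b)).
- by move=> k a b; apply: cs_ext; exact: chom_linear.
- by move=> a b; apply: cs_ext; exact: chomM.
- by move=> a; apply: cs_ext; exact: chom_star.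
Defined.
End ClosedSubalgebra.

Lemma nrm_cmul (R : realType) (A : cstarAlgType R) (a b : A) :
  nrm (cmul a b) <= nrm a * nrm b.
Proof. by rewrite -lecR rmorphM /= -!nrmE cnormM. Qed.

Lemma nrm_cstar (R : realType) (A : cstarAlgType R) (a : A) : nrm (cstar a) = nrm a.
Proof.
have le b : nrm b <= nrm (cstar b).
  have [->|b0] := eqVneq b 0; first by rewrite nrm0 nrm_ge0.
  have b1 : 0 < nrm b by rewrite lt_def nrm_eq0 b0 nrm_ge0.
  rewrite -(ler_pM2r b1) (le_trans _ (nrm_cmul _ _)) //.
  by rewrite -lecR -nrmE cnorm_star nrmE -rmorphXn /= expr2.
by apply/eqP; rewrite eq_le le -{2}[a]cstarK le.
Qed.

Section ColimitDense.
Variables (R : realType) (d : Order.disp_t) (I : porderType d).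
Variables (D : poset_diagram (CStar R) I) (A : cstarAlgType R).
Variable c : forall i, hom (D i) (A : CStar R).
Hypotheses (dirI : directed I) (cc : is_cocone c).

Local Notation ch i := (c i : cstar_hom _ _).

Lemma cocone_le i j (ij : (i <= j)%O) a : ch j ((dhom D ij : cstar_hom _ _) a) = ch i a.
Proof. by rewrite -(cc ij). Qed.

Lemma cocone_pair i j a b : exists k a' b', ch i a = ch k a' /\ ch j b = ch k b'.
Proof.
have [k [ik jk]] := dirI.2 i j.
by exists k, ((dhom D ik : cstar_hom _ _) a), ((dhom D jk : cstar_hom _ _) b); rewrite !cocone_le.
Qed.

Definition image_closure : set A :=
  [set x | forall e : R, 0 < e -> exists i a, nrm (ch i a - x) < e].

Definition image_closure_subalg : closed_subalg A.
Proof.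
exists image_closure.
- move=> e e0; have [[i _] _] := dirI; exists i, 0.
  by rewrite (chom0 (ch i)) subrr nrm0.
- move=> x y xT yT e e0; have e2 : 0 < e / 2 by rewrite divr_gt0.
  have [[i [a ia]] [j [b jb]]] := (xT _ e2, yT _ e2).
  have [k [a' [b' [aE bE]]]] := cocone_pair a b.
  exists k, (a' + b'); rewrite (chomD (ch k)) -aE -bE opprD addrACA.
  by rewrite [ltRHS]splitr (le_lt_trans (nrmD _ _)) // ltrD.
- move=> k x xT e e0; have k1 : 0 < 1 + nrm k by rewrite ltr_pwDl ?nrm_ge0.
  have [|i [a ia]] := xT (e / (1 + nrm k)); first by rewrite divr_gt0.
  exists i, (k *: a); have -> : ch i (k *: a) = k *: ch i a.
    by have := chom_linear (ch i) k a 0; rewrite (chom0 (ch i)) !addr0.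
  rewrite -scalerBr nrmZ; apply: (@le_lt_trans _ _ ((1 + nrm k) * nrm (ch i a - x))).
    by rewrite ler_wpM2r ?nrm_ge0 // lerDr.
  by rewrite mulrC -ltr_pdivlMr.
- move=> x y xT yT e e0; have e2 : 0 < e / 2 by rewrite divr_gt0.
  have y1 : 0 < 1 + nrm y by rewrite ltr_pwDl ?nrm_ge0.
  have [|i [a ia]] := xT (e / 2 / (1 + nrm y)); first by rewrite divr_gt0.
  have a1 : 0 < 1 + nrm (ch i a) by rewrite ltr_pwDl ?nrm_ge0.
  have [|j [b jb]] := yT (e / 2 / (1 + nrm (ch i a))); first by rewrite divr_gt0.
  have [k [a' [b' [aE bE]]]] := cocone_pair a b.
  exists k, (cmul a' b'); rewrite (chomM (ch k)) -aE -bE.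
  have -> : cmul (ch i a) (ch j b) - cmul x y =
      cmul (ch i a) (ch j b - y) + cmul (ch i a - x) y.
    by rewrite cmulDr cmulDl -[- y]scaleN1r -[- x]scaleN1r cmulZr cmulZl !scaleN1r addrA subrK.
  rewrite [ltRHS]splitr (le_lt_trans (nrmD _ _)) // ltrD //.
    rewrite (le_lt_trans (nrm_cmul _ _)) //.
    apply: (@le_lt_trans _ _ ((1 + nrm (ch i a)) * nrm (ch j b - y))).
      by rewrite ler_wpM2r ?nrm_ge0 // lerDr.
    by rewrite mulrC -ltr_pdivlMr.
  rewrite (le_lt_trans (nrm_cmul _ _)) //.
  apply: (@le_lt_trans _ _ (nrm (ch i a - x) * (1 + nrm y))).
    by rewrite ler_wpM2l ?nrm_ge0 // lerDr.
  by rewrite -ltr_pdivlMr.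
- move=> x xT e e0; have [i [a ia]] := xT e e0.
  exists i, (cstar a); rewrite (chom_star (ch i)) -nrm_cstar cstarD cstarK.
  by rewrite -[- cstar x]scaleN1r cstarZ cstarK rmorphN rmorph1 scaleN1r.
- move=> l lT e e0; have e2 : 0 < e / 2 by rewrite divr_gt0.
  have [x xT xl] := lT _ e2; have [i [a ia]] := xT _ e2.
  exists i, a; rewrite [ltRHS]splitr (le_lt_trans (nrm_dist _ x _)) // ltrD //.
Defined.

(* The cocone factors through the closure of the union, and the inclusion of the
   latter splits by the uniqueness in the universal property. *)
Lemma colimit_dense : is_colimit c -> forall x : A, image_closure x.
Proof.
move=> [_ cu] x; pose S := image_closure_subalg.
have cS i a : S (ch i a) by move=> e e0; exists i, a; rewrite subrr nrm0.
have [|h [hc _]] := cu (cs_elt S : cstarAlgType R) (fun i => cs_corestrict (cS i)).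
  by move=> i j ij; apply: cstar_hom_ext => a; apply: cs_ext; exact: cocone_le.
have [k [_ kuniq]] := cu A c cc.
have h1 : k = cstar_id A by apply: kuniq => i; exact: compIm.
have h2 : k = cstar_comp (cs_incl S) h.
  apply: kuniq => i; apply: cstar_hom_ext => a.
  by have := congr1 (fun f : cstar_hom _ _ => f a) (hc i) => /= ->.
have := congr1 (fun f : cstar_hom A A => f x) (etrans (esym h1) h2) => /= ->.
exact: (cs_valP (h x)).
Qed.
End ColimitDense.

(** * Matrices over an AF algebra *)

Lemma cvg_sum_ord (R : realType) m (f : 'I_m -> nat -> R) :
  (forall i, f i k @[k --> \oo] --> (0 : R)) -> \sum_i f i k @[k --> \oo] --> (0 : R).
Proof.
elim: m f => [|m IH] f f0.
  rewrite (_ : (fun k => _) = cst 0) ?[X in X @ _]/=; first exact: cvg_cst.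
  by apply/funext => k; rewrite big_ord0.
rewrite (_ : (fun k => _) = (fun k => \sum_(i < m) f (widen_ord (leqnSn m) i) k + f ord_max k)).
  by rewrite -[X in _ --> X]addr0; apply: cvgD => //; apply: IH.
by apply/funext => k; rewrite big_ord_recr.
Qed.

(** * A complete submultiplicative norm on matrices *)

Section MatrixNorm.
Variables (R : realType) (A : cstarAlgType R) (n : nat).
Implicit Types (u v : uni A) (S : set A).

(** The entrywise l1-norm. It is submultiplicative and complete on matrices of size [n], which is
    all that the approximation arguments ask of it; the C*-norm of matrices is avoided. *)
Definition mnorm u : R := \sum_(i < n) \sum_(j < n) nrm (um u i j).

Local Notation Mn := (@Muni_over R A n setT).

Lemma mnorm_entry u i j : (i < n)%N -> (j < n)%N -> nrm (um u i j) <= mnorm u.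
Proof.
move=> ni nj; rewrite /mnorm (bigD1 (Ordinal ni)) //= (bigD1 (Ordinal nj)) //=.
rewrite -addrA lerDl addr_ge0 ?sumr_ge0 // => *; rewrite ?sumr_ge0 // => *; exact: nrm_ge0.
Qed.

Lemma mnorm_ge0 u : 0 <= mnorm u.
Proof. by rewrite sumr_ge0 // => i _; rewrite sumr_ge0 // => j _; exact: nrm_ge0. Qed.

Lemma mnorm0 : mnorm 0 = 0.
Proof. by rewrite /mnorm big1 // => i _; rewrite big1 // => j _; exact: nrm0. Qed.

Lemma mnormN u : mnorm (- u) = mnorm u.
Proof. by apply: eq_bigr => i _; apply: eq_bigr => j _; rewrite umN !fctE nrmN. Qed.

Lemma mnormD u v : mnorm (u + v) <= mnorm u + mnorm v.
Proof.
rewrite -big_split; apply: ler_sum => i _; rewrite -big_split; apply: ler_sum => j _.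
exact: nrmD.
Qed.

Lemma nrm_sum (V : normedZmodType R[i]) m (F : 'I_m -> V) :
  nrm (\sum_i F i) <= \sum_i nrm (F i).
Proof.
elim/big_ind2: _ => [|x a y b xa yb|//]; first by rewrite nrm0.
by apply: (le_trans (nrmD _ _)); exact: lerD.
Qed.

Lemma mnormM u v : Mn u -> Mn v -> mnorm (u * v) <= mnorm u * mnorm v.
Proof.
move=> [u0 un _] [v0 _ _]; rewrite /mnorm umM // mulr_suml; apply: ler_sum => i _.
apply: (@le_trans _ _ (\sum_(j < n) \sum_(k < n) nrm (um u i k) * nrm (um v k j))).
  apply: ler_sum => j _; rewrite (mmulE (or_introl (Minf_col un))).
  apply: (le_trans (nrm_sum _)); apply: ler_sum => k _; exact: nrm_cmul.
rewrite exchange_big mulr_suml; apply: ler_sum => k _; rewrite -mulr_sumr.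
rewrite ler_wpM2l ?nrm_ge0 // [leRHS](bigD1 k) //= lerDl.
by rewrite sumr_ge0 // => l _; rewrite sumr_ge0 // => j _; exact: nrm_ge0.
Qed.

Lemma Mn_ext u v : Mn u -> Mn v ->
  (forall i j, (i < n)%N -> (j < n)%N -> um u i j = um v i j) -> u = v.
Proof.
move=> [u0 un _] [v0 vn _] uv; apply: uni_ext; first by rewrite u0 v0.
apply/funext => i; apply/funext => j; have [nij|] := leqP n (maxn i j).
  by rewrite un // vn.
by rewrite gtn_max => /andP[ni nj]; exact: uv.
Qed.

Lemma Minf_restrict (x : nat -> nat -> A) :
  Minf (fun i j => if (maxn i j < n)%N then x i j else 0).
Proof. by exists n => i j; rewrite leqNgt; case: ifP. Qed.

Definition uni_restrict x : uni A := Uni 0 (Minf_restrict x).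

Lemma uni_restrict_over S x : S 0 -> (forall i j, S (x i j)) -> Muni_over n S (uni_restrict x).
Proof. by move=> S0 Sx; split=> //= i j; rewrite 1?leqNgt; case: ifP. Qed.

Lemma um_restrict x i j : (i < n)%N -> (j < n)%N -> um (uni_restrict x) i j = x i j.
Proof. by move=> ni nj; rewrite /= gtn_max ni nj. Qed.

Section Subalgebra.
Variable S : set A.
Hypotheses (S0 : S 0) (SD : forall a b, S a -> S b -> S (a + b))
  (SZ : forall k a, S a -> S (k *: a)) (SM : forall a b, S a -> S b -> S (cmul a b)).

Lemma Muni_overD u v : Muni_over n S u -> Muni_over n S v -> Muni_over n S (u + v).
Proof.
move=> [u0 un uS] [v0 vn vS]; split; first exact: MuniD.
  by move=> i j nij; rewrite umD !fctE un // vn // addr0.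
by move=> i j; apply: SD.
Qed.

Lemma Muni_overZ k u : Muni_over n S u -> Muni_over n S (k *: u).
Proof.
move=> [u0 un uS]; split; first exact: MuniZ.
  by move=> i j nij; rewrite umZ !fctE un // scaler0.
by move=> i j; apply: SZ.
Qed.

Lemma Muni_overM u v : Muni_over n S u -> Muni_over n S v -> Muni_over n S (u * v).
Proof.
move=> [u0 un uS] [v0 vn vS]; split; first exact: MuniMl.
  move=> i j nij; rewrite umM // (mmulE (or_introl (Minf_col un))) big1 // => k _.
  move: nij; rewrite leq_max => /orP[ni|nj].
    by rewrite un ?cmul0l // leq_max ni.
  by rewrite vn ?cmul0r // leq_max nj orbT.
move=> i j; rewrite umM // (mmulE (or_introl (Minf_col un))).
by elim/big_ind: _ => // k _; exact: SM.
Qed.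
End Subalgebra.

Lemma mnorm_eq0 u : Mn u -> mnorm u = 0 -> u = 0.
Proof.
move=> Mu u0; apply: Mn_ext => //.
move=> i j ni nj; apply/eqP; rewrite -nrm_eq0 eq_le nrm_ge0 andbT -u0.
exact: mnorm_entry.
Qed.

Lemma mnorm_complete (u : nat -> uni A) (C : R) : (forall k, Mn (u k)) ->
  (forall k, mnorm (u k.+1 - u k) <= C / 2 ^+ k) ->
  exists2 l, Mn l & mnorm (u k - l) @[k --> \oo] --> (0 : R).
Proof.
move=> Mu uC.
have C0 : 0 <= C by have := le_trans (mnorm_ge0 _) (uC 0%N); rewrite expr0 divr1.
have entry i j : exists l : A, (i < n)%N -> (j < n)%N ->
    forall e : R, 0 < e -> exists k0, forall k, (k0 <= k)%N -> nrm (um (u k) i j - l) < e.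
  have [ni|] := ltnP i n; last by exists 0.
  have [nj|] := ltnP j n; last by exists 0.
  have [|l lP] := @complete_ex R A (fun k => um (u k) i j); last by exists l.
  move=> e e0.
  have small : (C * 2) / 2 ^+ k @[k --> \oo] --> (0 : R).
    rewrite (_ : (fun k => _) = geometric (C * 2) 2^-1).
      by apply: cvg_geometric; rewrite ger0_norm ?invf_lt1 ?ltr1n.
    by apply/funext => k; rewrite /geometric /= exprVn.
  have /cvgrPdist_lt/(_ e e0)[k0 _ /(_ k0 (leqnn _))/=] := small.
  rewrite sub0r normrN => k0e; exists k0 => k /subnK<-; move: (k - k0)%N => m.
  apply: le_lt_trans (le_lt_trans (ler_norm _) k0e).
  apply: (@le_trans _ _ ((C * 2) / 2 ^+ k0 * (1 - (2 ^+ m)^-1))); last first.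
    by rewrite ler_piMr ?gerBl ?invr_ge0 ?exprn_ge0 // mulr_ge0 ?invr_ge0 ?exprn_ge0 // mulr_ge0.
  elim: m => [|m IH]; first by rewrite subrr nrm0 expr0 invr1 subrr mulr0.
  apply: (le_trans (nrm_dist _ (um (u (m + k0)%N) i j) _)).
  apply: le_trans (lerD (le_trans (mnorm_entry (u (m.+1 + k0)%N - u (m + k0)%N) ni nj) (uC _))
    IH) _.
  rewrite exprD exprS !invfM.
  by move: ((2 ^+ m : R)^-1) ((2 ^+ k0 : R)^-1) => s t; lra.
have /choice[l lP] (ij : nat * nat) := entry ij.1 ij.2.
pose L := uni_restrict (fun i j => l (i, j)).
exists L; first exact: uni_restrict_over.
apply: cvg_sum_ord => i; apply: cvg_sum_ord => j.
apply/cvgrPdist_lt => e e0; have [k0 k0P] := lP (i : nat, j : nat) (ltn_ord i) (ltn_ord j) e e0.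
exists k0 => // k /k0P kl; change (`|0 - nrm (um (u k - L) i j)| < e).
have -> : um (u k - L) i j = um (u k) i j - um L i j by [].
by rewrite sub0r normrN ger0_norm ?nrm_ge0 // um_restrict.
Qed.
End MatrixNorm.

Section AFMatrices.
Variables (R : realType) (d : Order.disp_t) (I : porderType d).
Variables (D : poset_diagram (CStar R) I) (A : cstarAlgType R).
Variable c : forall i, hom (D i) (A : CStar R).
Hypotheses (dirI : directed I) (fdD : forall i, finite_dimensional (D i))
  (colim : is_colimit c).

Local Notation ch i := (c i : cstar_hom _ _).

(** The maps of the cocone need not be injective, so the algebras [D i] are replaced by their
    images. *)
Definition cimg i : set A := [set x | exists a, ch i a = x].

Lemma cimg0 i : cimg i 0.
Proof. by exists 0; exact: (chom0 (ch i)). Qed.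
Lemma cimgD i a b : cimg i a -> cimg i b -> cimg i (a + b).
Proof. by move=> [x <-] [y <-]; exists (x + y); exact: (chomD (ch i)). Qed.
Lemma chomZ (B : cstarAlgType R) (f : cstar_hom B A) k a : f (k *: a) = k *: f a.
Proof. by have := chom_linear f k a 0; rewrite (chom0 f) !addr0. Qed.
Lemma cimgZ i k a : cimg i a -> cimg i (k *: a).
Proof. by move=> [x <-]; exists (k *: x); exact: chomZ. Qed.
Lemma cimgM i a b : cimg i a -> cimg i b -> cimg i (cmul a b).
Proof. by move=> [x <-] [y <-]; exists (cmul x y); exact: (chomM (ch i)). Qed.
Lemma cimg_star i a : cimg i a -> cimg i (cstar a).
Proof. by move=> [x <-]; exists (cstar x); exact: (chom_star (ch i)). Qed.

Lemma cimgS i j : (i <= j)%O -> cimg i `<=` cimg j.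
Proof.
move=> ij _ [x <-]; exists ((dhom D ij : cstar_hom _ _) x); exact: cocone_le colim.1 _ _ _ _.
Qed.

Lemma cimg_span i : exists m (g : 'I_m -> A),
  cimg i = [set x | exists a : 'I_m -> R[i], x = \sum_r a r *: g r].
Proof.
have [m [f [f' fK f'K]]] := fdD i.
have f'E (a : 'I_m -> R[i]) : ch i (f' (\sum_r a r *: delta_mx ord0 r)) =
    \sum_r a r *: ch i (f' (delta_mx ord0 r)).
  have -> : f' (\sum_r a r *: delta_mx ord0 r) = \sum_r a r *: f' (delta_mx ord0 r).
    by rewrite -[RHS]fK linear_sum; congr f'; apply: eq_bigr => r _; rewrite linearZ /= f'K.
  by rewrite (chom_sum (ch i)); apply: eq_bigr => r _; exact: chomZ.
exists m, (fun r => ch i (f' (delta_mx ord0 r))); apply/seteqP; split=> [_ [x <-]|_ [a ->]].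
  by exists (f x ord0); rewrite -f'E -row_sum_delta fK.
by exists (f' (\sum_r a r *: delta_mx ord0 r)); rewrite f'E.
Qed.

Lemma directed_seq (s : seq I) (i0 : I) : exists k, (i0 <= k)%O /\ forall i, i \in s -> (i <= k)%O.
Proof.
elim: s => [|i s [k [ik ks]]]; first by exists i0.
have [l [kl il]] := dirI.2 k i; exists l; split; first exact: le_trans kl.
move=> j; rewrite inE => /orP[/eqP->//|/ks jk]; exact: le_trans kl.
Qed.

Variable n : nat.

Local Notation Mn := (@Muni_over R A n setT).
Local Notation Fn i := (@Muni_over R A n (cimg i)).

Lemma Muni_over_findim i : semiprime_findim (Fn i).
Proof.
split.
- by split=> // p q; exact: cimg0.
- by move=> x y; apply: Muni_overD; exact: cimgD.
- by move=> k x; apply: Muni_overZ; exact: cimgZ.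
- move=> x y; apply: Muni_overM; [exact: cimg0|exact: cimgD|exact: cimgM].
- have [m [g gE]] := cimg_span i; eexists.
  apply: (dim_le_span (g := fun pqr : 'I_n * 'I_n * 'I_m => uni_unit pqr.1.1 pqr.1.2 (g pqr.2))).
  move=> u [u0 un uF].
  have /choice[a aE] (pq : 'I_n * 'I_n) : exists a : 'I_m ->
    R[i], um u pq.1 pq.2 = \sum_r a r *: g r.
    by have := uF pq.1 pq.2; rewrite gE.
  exists (fun pqr => a pqr.1 pqr.2).
  have umE v p q : um (\sum_(t : 'I_n * 'I_n * 'I_m) v t) p q = \sum_t um (v t : uni A) p q.
    by elim/big_ind2: _ => // y y' z z' <- <-.
  apply: (@Mn_ext _ _ n) => [||p q np nq]; first by split.
    elim/big_ind: _ => [|y z|[[p q] r] _]; [by split|exact: Muni_overD|].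
    apply: Muni_overZ => //; split=> // p' q' npq /=; case: ifP => // /andP[/eqP p'p /eqP q'q].
    by move: npq; rewrite p'p q'q leqNgt gtn_max !ltn_ord.
  rewrite umE (aE (Ordinal np, Ordinal nq)).
  rewrite -(pair_bigA _ (fun pq r => um (a pq r *: uni_unit pq.1 pq.2 (g r)) p q)) /=.
  rewrite (bigD1 (Ordinal np, Ordinal nq)) //= [X in _ + X]big1 => [|[p' q'] pq].
    by rewrite addr0; apply: eq_bigr => r _; rewrite !fctE !eqxx.
  rewrite big1 // => r _; rewrite !fctE /=; case: ifP => [/andP[/eqP pp /eqP qq]|_];
    last exact: scaler0.
  by case/eqP: pq; congr (_, _); apply: val_inj.
- move=> u Fu; apply: (Muni_over_semiprime (cimg0 i) (@cimg_star i) Fu).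
Qed.

Lemma AF_locally_findim : locally_findim Mn (mnorm n) (fun i => Fn i).
Proof.
split.
- by move=> x y; apply: Muni_overD.
- by move=> k x; apply: Muni_overZ.
- by move=> x y; apply: Muni_overM.
- exact: mnorm0.
- exact: mnormN.
- exact: mnormD.
- exact: mnormM.
- exact: mnorm_eq0.
- exact: mnorm_complete.
- by move=> i u [].
- exact: Muni_over_findim.
- move=> i u l Fu [l0 ln _] ul; split=> // p q.
  have [npq|] := leqP n (maxn p q); first by rewrite ln //; exact: cimg0.
  rewrite gtn_max => /andP[np nq].
  have [m [g gE]] := cimg_span i; rewrite gE; apply: span_closed => e e0; rewrite -gE.
  have /cvgrPdist_lt/(_ e e0)[k0 _ /(_ k0 (leqnn _))/=] := ul.
  rewrite sub0r normrN => k0e; exists (um (u k0) p q); first by case: (Fu k0).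
  apply: le_lt_trans (le_lt_trans (ler_norm _) k0e).
  exact: (mnorm_entry (u k0 - l) np nq).
- move=> i x e [x0 xn _] e0.
  (* There are [n * n] entries; the successor makes the total error strictly smaller than [e] and
     covers [n = 0]. *)
  pose e' := e / (n * n).+1%:R.
  have e'0 : 0 < e' by rewrite divr_gt0.
  have /choice[ia iaP] (pq : 'I_n * 'I_n) : exists ia : {i : I & D i},
      nrm (ch (tag ia) (tagged ia) - um x pq.1 pq.2) < e'.
    have [j [a ja]] := colimit_dense dirI colim.1 colim (um x pq.1 pq.2) e'0.
    by exists (Tagged (fun i => D i : Type) a).
  (* The approximations of the entries live at different indices. Directedness collects them above
     one index, taken above the given [i] as well. *)
  have [k [ik ks]] := directed_seq [seq tag (ia pq) | pq <- enum {: 'I_n * 'I_n}] i.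
  have /choice[b bP] (pq : nat * nat) : exists b : A, cimg k b /\
      ((pq.1 < n)%N -> (pq.2 < n)%N -> nrm (b - um x pq.1 pq.2) < e').
    have [np|] := ltnP pq.1 n; last by exists 0; split=> //; exact: cimg0.
    have [nq|] := ltnP pq.2 n; last by exists 0; split=> //; exact: cimg0.
    pose pq' := (Ordinal np, Ordinal nq); exists (ch (tag (ia pq')) (tagged (ia pq'))).
    split=> [|_ _]; last exact: (iaP pq').
    apply: (@cimgS (tag (ia pq'))); last by eexists.
    by apply: ks; apply/mapP; exists pq' => //; rewrite mem_enum.
  exists k, (uni_restrict n (fun p q => b (p, q))); split.
  + by move=> u [u0 un uF]; split=> // p q; apply: cimgS (uF p q).
  + apply: uni_restrict_over => [|p q]; first exact: cimg0.
    by case: (bP (p, q)).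
  + apply: (@le_lt_trans _ _ (\sum_(p < n) \sum_(q < n) e')).
      apply: ler_sum => p _; apply: ler_sum => q _.
      have -> : um (x - uni_restrict n (fun p q => b (p, q))) p q =
        um x p q - um (uni_restrict n (fun p q => b (p, q))) p q by [].
      rewrite (um_restrict _ (ltn_ord p) (ltn_ord q)) nrmB; apply: ltW.
      by have [_ h] := bP (p : nat, q : nat); exact: (h (ltn_ord p) (ltn_ord q)).
    rewrite !big_const_ord !iter_addr_0 -mulrnA -mulr_natr /e' mulrAC -mulrA.
    by rewrite gtr_pMr // ltr_pdivrMr // mul1r ltr_nat.
- by have [[i _] _] := dirI; exists i.
Qed.
End AFMatrices.

(** * The dimension theory of an AF algebra *)

Section IdempotentsInUnitization.
Variables (R : realType) (A : cstarAlgType R).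
Implicit Types (a b : idempotent A).

Definition uidem a : uni A := Uni 0 (idem_Minf a).

Lemma uidem_inj : injective uidem.
Proof. by move=> a b /(congr1 (@um R A)) /= ab; exact: idem_ext. Qed.

Lemma idem_uidem a : idem (@Muni R A) (uidem a).
Proof. by split=> //; apply: uni_ext; [rewrite ucM mulr0|rewrite umM //= idem_idem]. Qed.

Lemma uidem_ex e : idem (@Muni R A) e -> exists a, uidem a = e.
Proof.
move=> [Me ee]; have ee' : mmul (um e) (um e) = um e by rewrite -umM // ee.
by exists (Idempotent (umP e) ee'); apply: uni_ext.
Qed.

Lemma eqv_uidem a b : eqv (@Muni R A) (uidem a) (uidem b) <-> mvn a b.
Proof.
split=> [[x [y [Mx My ax bx]]]|[x [y [fx fy ax bx]]]].
  exists (um x), (um y); split; do ?exact: umP.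
    by rewrite -umM // -ax.
  by rewrite -umM // -bx.
exists (Uni 0 fx), (Uni 0 fy); split=> //; apply: uni_ext; do ?by rewrite ucM mulr0.
  by rewrite umM.
by rewrite umM.
Qed.

Lemma orth_uidem a b : orth (uidem a) (uidem b) <-> orthogonal_idem a b.
Proof.
have E x y : uidem x * uidem y = 0 <-> mmul x y = 0.
  split=> [/(congr1 (@um R A))|xy]; first by rewrite umM.
  by apply: uni_ext; rewrite ?ucM ?mulr0 // umM.
by split=> -[/E ? /E ?].
Qed.

Lemma uidemD a b (ab : orthogonal_idem a b) : uidem (idem_add ab) = uidem a + uidem b.
Proof. by apply: uni_ext => //; rewrite ucD addr0. Qed.

Lemma Muni_bound (u : uni A) : Muni u -> exists n, Muni_over n setT u.
Proof. by move=> u0; have [n un] := umP u; exists n. Qed.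

Lemma Muni_overS n m S (u : uni A) : (n <= m)%N -> Muni_over n S u -> Muni_over m S u.
Proof. by move=> nm [u0 un uS]; split=> // i j mij; apply: un; exact: leq_trans mij. Qed.
End IdempotentsInUnitization.

Section AFDimensionTheory.
Variables (R : realType) (X : AF_algebra R) (n : nat).
Variable phi : groth (V X) -> 'rV[int]_n.
Hypotheses (phiD : {morph phi : x y / x + y}) (phi_inj : injective phi).
Hypothesis phi_ge0 : forall v i, 0 <= phi (groth_of v) ord0 i.
Hypothesis phi_surj : forall g : 'rV_n, (forall i, 0 <= g ord0 i) ->
  exists v, phi (groth_of v) = g.

Local Notation M := (@Muni R X).

(* The junk value 0 is taken where u is not an idempotent of M_oo(X). *)
Definition K0cl (u : uni X) : 'rV[int]_n :=
  if pselect (exists a, uidem a = u) is left h then phi (groth_of (Vclass (projT1 (cid h)))) else 0.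

Lemma K0clE a : K0cl (uidem a) = phi (groth_of (Vclass a)).
Proof.
rewrite /K0cl; case: pselect => [h|[]]; last by exists a.
by case: cid => b /= /uidem_inj->.
Qed.

Lemma groth_ofD (N : nmodType) (x y : N) : groth_of (x + y) = groth_of x + groth_of y.
Proof. by rewrite /groth_of [RHS]gadd_diff addr0. Qed.

(** Each algebraic property involves finitely many matrices, which have a common finite size, and
    there [AF_locally_findim] applies. Stability is the definition of the Grothendieck group, made
    concrete by orthogonal representatives. *)
Lemma AF_dimension_theory : dimension_theory M K0cl.
Proof.
have [d [I [D [c [dirI fdD colim]]]]] := AF_is_AF X.
have lf m := AF_locally_findim dirI fdD colim m.
split.
- exact: MuniD.
- exact: MuniZ.
- exact: MuniMl.
- exact: MuniMr.
- move=> x Mx xyx; have [m Mm] := Muni_bound Mx.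
  apply: (Muni_over_semiprime (S := setT) _ _ Mm) => // y [y0 _ _]; exact: xyx.
- move=> x y /Muni_bound[p px] /Muni_bound[q qy].
  apply: (lf_dedekind (lf (maxn p q))).
    exact: Muni_overS (leq_maxl _ _) px.
  exact: Muni_overS (leq_maxr _ _) qy.
- move=> e [Me ee] e0 eprim x Mx; have [m em] := Muni_bound Me.
  have ex : M (e * x * e) by exact: MuniMr.
  have [p xp] := Muni_bound ex.
  have [|||l lE] := lf_primitive_scalar (lf (maxn m p)) _ e0 ee _ (x := e * x * e).
  + exact: Muni_overS (leq_maxl _ _) em.
  + by move=> f [f0 _ _] ff; apply: eprim.
  + exact: Muni_overS (leq_maxr _ _) xp.
  by exists l; rewrite -lE !mulrA ee -!mulrA ee.
- by move=> e f /uidem_ex[a <-] /uidem_ex[b <-] /eqv_uidem/Vclass_eq ab; rewrite !K0clE ab.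
- move=> e f /uidem_ex[a <-] /uidem_ex[b <-] /orth_uidem ab.
  by rewrite -(uidemD ab) !K0clE -Vclass_add groth_ofD phiD.
- by move=> e i /uidem_ex[a <-]; rewrite K0clE.
- move=> g /phi_surj[v <-]; exists (uidem (repr v)); first exact: idem_uidem.
  by rewrite K0clE Vclass_repr.
- move=> _ _ _ /uidem_ex[p <-] /uidem_ex[a <-] /uidem_ex[c' <-].
  rewrite !K0clE -phiD -groth_ofD => /phi_inj/gdiff_eq[k].
  rewrite !addr0 -(Vclass_repr k); set k0 := repr k.
  have VD (x y : idempotent X) : Vclass x + Vclass y = Vclass (idem_oplus x y) := Vadd_class x y.
  rewrite (VD a c') (VD p k0) (VD _ k0) => /Vclass_eq pack.
  have [pk kp] := orthogonal_spread p k0.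
  have [ak ka] := orthogonal_spread (idem_spread false a) k0.
  have [ck kc] := orthogonal_spread (idem_spread true c') k0.
  (* The iterated spreads place [a], [c'] and [k0] on the indices congruent to 0 and 2 modulo 4 and
     on the odd ones, which is the layout of the nested [idem_oplus] in [pack]. *)
  exists (uidem (idem_spread false p)), (uidem (idem_spread false (idem_spread false a))),
    (uidem (idem_spread false (idem_spread true c'))), (uidem (idem_spread true k0)).
  split.
  + by split; exact: idem_uidem.
  + by split; exact: idem_uidem.
  + by split; apply/eqv_uidem; do ?[apply: mvn_trans (mvn_sym (mvn_spread _ _)) _];
      exact: mvn_refl.
  + split; apply/orth_uidem; split=> //; rewrite /= mmul_spread;
      by [exact: Minf_spread (idem_Minf _)|rewrite (mmul_spread_orth false, mmul_spread_orth
        true) spread0].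
  + have := pack; rewrite -eqv_uidem /idem_oplus !uidemD.
    have -> : uidem (idem_spread false (idem_add (orthogonal_spread a c'))) =
        uidem (idem_spread false (idem_spread false a)) +
        uidem (idem_spread false (idem_spread true c')).
      by apply: uni_ext; [rewrite ucD addr0|rewrite /= spreadD].
    by [].
Qed.
End AFDimensionTheory.

Section UniMap.
Variables (R : realType) (A B : cstarAlgType R) (f : cstar_hom A B).

Definition uni_map (u : uni A) : uni B := Uni (uc u) (Minf_map f (umP u)).

Lemma uni_map_morphism : alg_morphism (@Muni R A) (@Muni R B) uni_map.
Proof.
have fZ k a : f (k *: a) = k *: f a by have := chom_linear f k a 0; rewrite (chom0 f) !addr0.
split=> //.
- move=> u v; apply: uni_ext => //; apply/funext => i; apply/funext => j.
  exact: chomD.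
- move=> u v; apply: uni_ext => //=; rewrite -mmap_mul ?umP //.
    by apply/funext => i; apply/funext => j; rewrite /mmap !fctE !chomD !fZ.
  exact: umP.
- by move=> k u; apply: uni_ext => //; apply/funext => i; apply/funext => j; exact: fZ.
Qed.

Lemma uni_map_uidem (a : idempotent A) : uni_map (uidem a) = uidem (idem_map f a).
Proof. by apply: uni_ext. Qed.
End UniMap.

Lemma uni_map_comp (R : realType) (A B C : cstarAlgType R) (g : cstar_hom B C)
  (f : cstar_hom A B) u : uni_map (cstar_comp g f) u = uni_map g (uni_map f u).
Proof. exact: uni_ext. Qed.

(** * Simplicial groups *)

(** A separate name for the integer row vectors, to which the componentwise order is attached. *)
Definition zvec (n : nat) : Type := 'rV[int]_n.

Section ZVec.
Variable n : nat.
Implicit Types x y z : zvec n.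

HB.instance Definition _ := GRing.Zmodule.copy (zvec n) 'rV[int]_n.

Definition zle x y : bool := [forall i, x ord0 i <= y ord0 i].

Lemma zle_refl : reflexive zle.
Proof. by move=> x; apply/forallP. Qed.

Lemma zle_anti : antisymmetric zle.
Proof.
move=> x y /andP[/forallP xy /forallP yx]; apply/rowP => i.
by apply/eqP; rewrite eq_le xy yx.
Qed.

Lemma zle_trans : transitive zle.
Proof.
by move=> y x z /forallP xy /forallP yz; apply/forallP => i; exact: le_trans (xy i) (yz i).
Qed.

HB.instance Definition _ := Order.Le_isPOrder.Build ring_display (zvec n)
  zle_refl zle_anti zle_trans.

Lemma zleE x y : (x <= y) = [forall i, x ord0 i <= y ord0 i].
Proof. by []. Qed.

Definition zvec_val (x : zvec n) : 'rV[int]_n := x.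

Lemma zvec_val_is_additive : nmod_morphism zvec_val.
Proof. by []. Qed.

HB.instance Definition _ := GRing.isNmodMorphism.Build (zvec n) 'rV[int]_n zvec_val
  zvec_val_is_additive.

Lemma zvec_simplicial : simplicial (zvec n : porderZmodType).
Proof. by exists n, zvec_val; split; [exists zvec_val|]. Qed.

Lemma zvec_order_unit (u : zvec n) : (forall i, 0 < u ord0 i) ->
  order_unit (u : (zvec n : porderZmodType)).
Proof.
move=> u0; split.
  by rewrite zleE; apply/forallP => i; rewrite mxE ltW.
move=> x; exists (\sum_i `|x ord0 i|).+1%N; split=> //; rewrite zleE; apply/forallP => i.
rewrite mulmxnE.
have xi : (`|x ord0 i| <= \sum_j `|x ord0 j|)%N by rewrite (bigD1 i) //= leq_addr.
move: xi (u0 i); rewrite -mulr_natr; move: (\sum_j _)%N => S; move: (x _ _) (u _ _) => a b; nia.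
Qed.
End ZVec.

Definition zsimp n (u : zvec n) (u0 : forall i, 0 < u ord0 i) : simp_group :=
  SimpGroup (zvec_simplicial n) (zvec_order_unit u0).

Section Entries.
Variable n : nat.

(** Indexing by natural numbers lets maps be given by literal sequences and be checked by cases on
    the index. Values of [k] above [n] are meaningless. *)
Definition ent (x : zvec n.+1) (k : nat) : int := x ord0 (inord k).

Definition zrow (s : seq int) : zvec n.+1 := \row_(j < n.+1) s`_j.

Lemma ent_zrow s k : (k <= n)%N -> ent (zrow s) k = s`_k.
Proof. by move=> kn; rewrite /ent mxE inordK. Qed.

Lemma entP (x y : zvec n.+1) : (forall k, (k <= n)%N -> ent x k = ent y k) -> x = y.
Proof.
move=> xy; apply/rowP => j; have := xy j; rewrite /ent inord_val; apply.
by rewrite -ltnS.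
Qed.

Lemma entD x y k : ent (x + y) k = ent x k + ent y k.
Proof. by rewrite /ent mxE. Qed.

Lemma entE (x : zvec n.+1) i : x ord0 i = ent x i.
Proof. by rewrite /ent inord_val. Qed.

Lemma ent_delta (j : 'I_n.+1) k : (k <= n)%N -> ent (delta_mx ord0 j) k = (k == j)%:R.
Proof. by move=> kn; rewrite /ent mxE eqxx -val_eqE /= inordK. Qed.

Lemma ent_le0 (x : zvec n.+1) : (0 <= x) <-> (forall k, (k <= n)%N -> 0 <= ent x k).
Proof.
rewrite zleE; split=> [/forallP x0 k kn|x0]; first by have := x0 (inord k); rewrite mxE.
apply/forallP => j; rewrite mxE; have := x0 j; rewrite /ent inord_val; apply.
by rewrite -ltnS.
Qed.

Lemma zrow_gt0 s : (forall k, (k <= n)%N -> 0 < s`_k) -> forall i, 0 < zrow s ord0 i.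
Proof. by move=> s0 i; rewrite mxE s0 // -ltnS. Qed.
End Entries.

(** * The four groups and six embeddings of the diagram *)

Lemma all_nth_gt0 (s : seq int) n : (n < size s)%N -> all (fun x => 0 < x) s ->
  forall k, (k <= n)%N -> 0 < s`_k.
Proof. by move=> ns /allP s0 k kn; apply/s0/mem_nth; exact: leq_ltn_trans ns. Qed.

Definition zgroup n (s : seq int) (ns : (n < size s)%N) (s0 : all (fun x => 0 < x) s) :
  simp_group :=
  zsimp (zrow_gt0 (all_nth_gt0 ns s0)).

(** In [simpZ1] and [simpZ2] the digit is the order-unit: both groups are Z. *)
Definition simpZ1 : simp_group := @zgroup 0 [:: 1] isT isT.
Definition simpZZ : simp_group := @zgroup 1 [:: 1; 1] isT isT.
Definition simpZZZ : simp_group := @zgroup 2 [:: 2; 2; 2] isT isT.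
Definition simpZ2 : simp_group := @zgroup 0 [:: 2] isT isT.

Definition zgroup_emb n m (s : seq int) ns s0 (t : seq int) nt t0 (f : zvec n.+1 -> seq int)
  (fD : forall x y k, (k <= m)%N -> (f (x + y))`_k = (f x)`_k + (f y)`_k)
  (f_inj : forall x y, (forall k, (k <= m)%N -> (f x)`_k = (f y)`_k) -> x = y)
  (f_pos : forall x, (forall k, (k <= n)%N -> 0 <= ent x k) -> forall k, (k <= m)%N ->
    0 <= (f x)`_k)
  (f_unit : forall k, (k <= m)%N -> (f (zrow n s))`_k = t`_k) :
  simp_emb (@zgroup n s ns s0) (@zgroup m t nt t0).
Proof.
exists (fun x : zvec n.+1 => zrow m (f x)).
- move=> x y; apply: entP => k km.
  by rewrite [LHS]ent_zrow // fD // entD !ent_zrow.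
- move=> x y /= xy; apply: f_inj => k km.
  by rewrite -!(@ent_zrow m) // xy.
- move=> x /ent_le0 x0; apply/ent_le0 => k km.
  by rewrite ent_zrow //; exact: f_pos.
- apply: entP => k km /=.
  by rewrite ent_zrow // f_unit // ent_zrow.
Defined.


Definition emb_diag : hom (simpZ1 : SGrpEmb1) simpZZ.
Proof.
apply: (@zgroup_emb 0 1 _ _ _ _ _ _ (fun x => [:: ent x 0; ent x 0])).
- by move=> x y [|[|//]] _ /=; rewrite entD.
- by move=> x y xy; apply: entP => -[|//] _; exact: (xy 0%N).
- by move=> x x0 [|[|//]] _ /=; exact: (x0 0%N).
- by move=> [|[|//]] _ /=; rewrite ent_zrow.
Defined.

Definition emb_double : hom (simpZ1 : SGrpEmb1) simpZ2.
Proof.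
apply: (@zgroup_emb 0 0 _ _ _ _ _ _ (fun x => [:: ent x 0 + ent x 0])).
- by move=> x y [|//] _ /=; rewrite !entD addrACA.
- by move=> x y xy; apply: entP => -[|//] _; have := xy 0%N isT => /=; lia.
- by move=> x x0 [|//] _ /=; have := x0 0%N isT; lia.
- by move=> [|//] _ /=; rewrite ent_zrow.
Defined.

Definition emb_swap : hom (simpZZ : SGrpEmb1) simpZZ.
Proof.
apply: (@zgroup_emb 1 1 _ _ _ _ _ _ (fun x => [:: ent x 1; ent x 0])).
- by move=> x y [|[|//]] _ /=; rewrite entD.
- by move=> x y xy; apply: entP => -[|[|//]] _; [exact: (xy 1%N)|exact: (xy 0%N)].
- by move=> x x0 [|[|//]] _ /=; exact: x0.
- by move=> [|[|//]] _ /=; rewrite ent_zrow.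
Defined.

Definition emb_swap12 : hom (simpZZZ : SGrpEmb1) simpZZZ.
Proof.
apply: (@zgroup_emb 2 2 _ _ _ _ _ _ (fun x => [:: ent x 0; ent x 2; ent x 1])).
- by move=> x y [|[|[|//]]] _ /=; rewrite entD.
- by move=> x y xy; apply: entP => -[|[|[|//]]] _;
  [exact: (xy 0%N)|exact: (xy 2%N)|exact: (xy 1%N)].
- by move=> x x0 [|[|[|//]]] _ /=; exact: x0.
- by move=> [|[|[|//]]] _ /=; rewrite ent_zrow.
Defined.

(** The coordinate [a + b] makes the two summands of Z^2 meet, but alone it is not injective; the
    other two coordinates repair this and are exchanged by the swap. Their factor 2 sends (1,1) to
    the constant vector (2,2,2), which also comes from (Z,2). *)
Definition emb_sum : hom (simpZZ : SGrpEmb1) simpZZZ.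
Proof.
apply: (@zgroup_emb 1 2 _ _ _ _ _ _ (fun x => [:: ent x 0 + ent x 1; ent x 0 + ent x 0;
  ent x 1 + ent x 1])).
- by move=> x y [|[|[|//]]] _ /=; rewrite !entD addrACA.
- move=> x y xy; apply: entP => -[|[|//]] _.
    by have := xy 1%N isT => /=; lia.
  by have := xy 2%N isT => /=; lia.
- by move=> x x0 [|[|[|//]]] _ /=; apply: addr_ge0; exact: x0.
- by move=> [|[|[|//]]] _ /=; rewrite !ent_zrow.
Defined.

Definition emb_const : hom (simpZ2 : SGrpEmb1) simpZZZ.
Proof.
apply: (@zgroup_emb 0 2 _ _ _ _ _ _ (fun x => [:: ent x 0; ent x 0; ent x 0])).
- by move=> x y [|[|[|//]]] _ /=; rewrite entD.
- by move=> x y xy; apply: entP => -[|//] _; exact: (xy 0%N).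
- by move=> x x0 [|[|[|//]]] _ /=; exact: (x0 0%N).
- by move=> [|[|[|//]]] _ /=; rewrite ent_zrow.
Defined.

Lemma emb_swapE x k : (k <= 1)%N -> ent (emb_swap x) k = [:: ent x 1; ent x 0]`_k.
Proof. exact: ent_zrow. Qed.

Lemma emb_swap12E x k : (k <= 2)%N -> ent (emb_swap12 x) k = [:: ent x 0; ent x 2; ent x 1]`_k.
Proof. exact: ent_zrow. Qed.

Lemma emb_constE x k : (k <= 2)%N -> ent (emb_const x) k = [:: ent x 0; ent x 0; ent x 0]`_k.
Proof. exact: ent_zrow. Qed.

Lemma swap_diag : comp emb_swap emb_diag = emb_diag.
Proof.
apply: simp_emb_ext => x; apply: entP => -[|[|//]] _ /=; by rewrite !ent_zrow.
Qed.

Lemma swap_sum : comp emb_swap12 emb_sum = comp emb_sum emb_swap.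
Proof.
apply: simp_emb_ext => x; apply: entP => -[|[|[|//]]] _ /=; by rewrite !ent_zrow //= addrC.
Qed.

Lemma swap_const : comp emb_swap12 emb_const = emb_const.
Proof.
apply: simp_emb_ext => x; apply: entP => -[|[|[|//]]] _ /=; by rewrite !ent_zrow.
Qed.

Lemma sum_diag : comp emb_sum emb_diag = comp emb_const emb_double.
Proof.
apply: simp_emb_ext => x; apply: entP => -[|[|[|//]]] _ /=; by rewrite !ent_zrow.
Qed.

(** * The functor does not exist *)

Section Lifting.
Variables (R : realType) (Gamma : functor SGrpEmb1 (AF R)).
Variable eta : forall G : SGrpEmb1, hom (functor_comp (K0 R) Gamma G) (forget_unit G).
Hypothesis eta_iso : forall G, is_iso (eta G).
Hypothesis eta_nat : forall (G H : SGrpEmb1) (f : hom G H),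
  comp (eta H) (fhom (functor_comp (K0 R) Gamma) f) = comp (fhom forget_unit f) (eta G).

Section Object.
Variables (n : nat) (u : zvec n) (u0 : forall i, 0 < u ord0 i).
Local Notation G := (zsimp u0).

Definition lift_iso : groth (V (Gamma G)) -> 'rV[int]_n := phom (eta G).

Definition lift_cl : uni (Gamma G) -> 'rV[int]_n := K0cl lift_iso.

Lemma lift_iso_surj (g : 'rV[int]_n) : (forall i, 0 <= g ord0 i) ->
  exists v, lift_iso (groth_of v) = g.
Proof.
move=> g0; have [psi [_ ep]] := eta_iso G.
have : pcone (psi g).
  apply: (phom_pos psi); rewrite /= zleE; apply/forallP => i; rewrite mxE; exact: g0.
move=> [v _ vE]; exists v; rewrite vE.
by have := congr1 (fun f : preab_hom (simp_preab G) (simp_preab G) => f g) ep.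
Qed.

Lemma lift_cl_dimension_theory : dimension_theory (@Muni R (Gamma G)) lift_cl.
Proof.
have [psi [pe ep]] := eta_iso G.
apply: AF_dimension_theory.
- exact: (phomD (eta G)).
- apply: (can_inj (g := psi)) => x.
  exact: (congr1 (fun f : preab_hom _ _ => f x) pe).
- move=> v i; have : pcone (eta G (groth_of v)) by apply: phom_pos; exists v.
  by move=> /forallP/(_ i); rewrite mxE.
- exact: lift_iso_surj.
Qed.
End Object.

Lemma lift_cl_map n (u : zvec n) u0 m (w : zvec m) w0
    (f : hom (@zsimp n u u0 : SGrpEmb1) (@zsimp m w w0)) e :
  idem (@Muni R (Gamma (zsimp u0))) e ->
  lift_cl (uni_map (fhom Gamma f : cstar_hom _ _) e) = semb f (lift_cl e).
Proof.
move=> /uidem_ex[a <-]; rewrite uni_map_uidem /lift_cl !K0clE -Vmap_class.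
have := congr1 (fun h : preab_hom (K0_ob (Gamma (zsimp u0))) (simp_preab (zsimp w0)) =>
  h (groth_of (Vclass a))) (eta_nat f).
rewrite /= /groth_of groth_map_diff raddf0; exact.
Qed.

(** Here the functoriality of [Gamma] enters: relations between embeddings hold exactly for the
    lifted homomorphisms, and not only for the maps they induce on K_0. *)
Lemma uni_map_comp_eq (G H H' L : SGrpEmb1) (f : hom G H) (g : hom H L)
    (f' : hom G H') (g' : hom H' L) (x : uni (Gamma G)) : comp g f = comp g' f' ->
  uni_map (fhom Gamma g : cstar_hom _ _) (uni_map (fhom Gamma f : cstar_hom _ _) x) =
  uni_map (fhom Gamma g' : cstar_hom _ _) (uni_map (fhom Gamma f' : cstar_hom _ _) x).
Proof.
move=> gf; have := congr1 (fhom Gamma) gf; rewrite !fhom_comp => E.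
by rewrite -!uni_map_comp; congr (uni_map _ x).
Qed.

Lemma uni_map_absorb (G H : SGrpEmb1) (f : hom G H) (g : hom H H) (x : uni (Gamma G)) :
  comp g f = f ->
  uni_map (fhom Gamma g : cstar_hom _ _) (uni_map (fhom Gamma f : cstar_hom _ _) x) =
  uni_map (fhom Gamma f : cstar_hom _ _) x.
Proof.
move=> gf; have := congr1 (fhom Gamma) gf; rewrite fhom_comp => E.
by rewrite -uni_map_comp; congr (uni_map _ x).
Qed.

Lemma no_lifting : False.
Proof.
have [|v vE] := @lift_iso_surj 1 _ (zrow_gt0 (@all_nth_gt0 [:: 1] 0 isT isT)) (zrow 0 [:: 1]).
  by move=> i; rewrite mxE; case: i => -[].
pose p := uidem (repr v) : uni (Gamma simpZ1).
have ip : idem (@Muni R (Gamma simpZ1)) p := idem_uidem _.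
have cp : lift_cl p = zrow 0 [:: 1] by rewrite /lift_cl K0clE Vclass_repr vE.
have mor (G H : SGrpEmb1) (f : hom G H) := uni_map_morphism (fhom Gamma f : cstar_hom _ _).
have dB := lift_cl_dimension_theory (zrow_gt0 (@all_nth_gt0 [:: 1; 1] 1 isT isT)).
have dC := lift_cl_dimension_theory (zrow_gt0 (@all_nth_gt0 [:: 2; 2; 2] 2 isT isT)).
have dD := lift_cl_dimension_theory (zrow_gt0 (@all_nth_gt0 [:: 2] 0 isT isT)).
apply: (@swap_diagram_absurd _ _ _ _ _ _ _ _ _ _ dB dC dD _ _ _ _
  (mor _ _ emb_swap) (mor _ _ emb_swap12) (mor _ _ emb_sum) (mor _ _ emb_const)
  (uni_map (fhom Gamma emb_diag : cstar_hom _ _) p)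
  (uni_map (fhom Gamma emb_double : cstar_hom _ _) p)).
- exact (am_idem (mor _ _ emb_diag) ip).
- exact (am_idem (mor _ _ emb_double) ip).
- exact: uni_map_absorb swap_diag.
- exact: uni_map_comp_eq sum_diag.
- by move=> x _; exact: uni_map_comp_eq swap_sum.
- by move=> x _; exact: uni_map_absorb swap_const.
- apply: (etrans (lift_cl_map emb_diag ip)); rewrite cp; apply: entP => k k1.
  rewrite entD !(ent_delta _ k1) [LHS](ent_zrow _ k1) !(ent_zrow _ (leqnn 0)).
  by move: k k1 => [|[|//]] _.
- apply: (etrans (lift_cl_map emb_double ip)); rewrite cp; apply: entP => k k1.
  rewrite entD !(ent_delta _ k1) [LHS](ent_zrow _ k1) !(ent_zrow _ (leqnn 0)).
  by move: k k1 => [|//] _.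
- move=> e i ie; rewrite (lift_cl_map emb_swap ie) !entE (emb_swapE _ (ltn_ord i)).
  by case: i => -[|[|//]].
- move=> e ie ce; apply: (etrans (lift_cl_map emb_swap12 ie)); rewrite ce; apply: entP => k k2.
  by rewrite (emb_swap12E _ k2) !ent_delta //; move: k k2 => [|[|[|//]]] _.
- move=> e i ie; rewrite (lift_cl_map emb_const ie) !entE (emb_constE _ (ltn_ord i)).
  by case: i => -[|[|[|//]]].
Qed.
End Lifting.

Theorem proposition7p1 (R : realType) :
  ~ exists Gamma : functor SGrpEmb1 (AF R),
      naturally_isomorphic (functor_comp (K0 R) Gamma) forget_unit.
Proof. by move=> [Gamma [eta [eta_iso eta_nat]]]; exact: no_lifting eta_iso eta_nat. Qed.
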